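(* Let $\lambda,\gamma>0$, and let $f_0\in L^1_+(\mathbb{R})$, $g_0\in L^1_+(\mathbb{R}^2)$. Let $(M_f,M_g)$ be the solution on $[0,\infty)$ of $$\dot M_f=2\gamma M_g-2\lambda M_f^2,\qquad \dot M_g=\lambda M_f^2-\gamma M_g,\qquad M_f(0)=\int_{\mathbb{R}}f_0\,\mathrm{d}\varphi,\quad M_g(0)=\int_{\mathbb{R}^2}g_0\,\mathrm{d}\varphi\,\mathrm{d}\varphi_*,$$ and let $F(s,t)=\exp\left(-2\lambda\int_s^tM_f(r)\,\mathrm{d}r\right)$. Then the system $$f(\varphi,t)=F(0,t)f_0(\varphi)+2\gamma\int_0^tF(s,t)\int_{\mathbb{R}}g(\varphi,\varphi_*,s)\,\mathrm{d}\varphi_*\,\mathrm{d}s,$$ $$g(\varphi,\varphi_*,t)=(S(t)g_0)(\varphi,\varphi_* )+\lambda\int_0^t\big(S(t-s)[f(\cdot,s)f_*(\cdot,s)]\big)(\varphi,\varphi_* )\,\mathrm{d}s,\qquad t\ge0,$$ has a unique solution $(f,g)\in C\big([0,\infty);L^1_+(\mathbb{R})\times L^1_+(\mathbb{R}^2)\big)$.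
   Context: $L^1_+$ denotes the set of (a.e.) nonnegative functions in $L^1$. The notation $f(\cdot,s)f_*(\cdot,s)$ means the function $(\varphi,\varphi_* )\mapsto f(\varphi,s)f(\varphi_*,s)$ on $\mathbb{R}^2$. For $t\in\mathbb{R}$, $$\Phi^t(\varphi,\varphi_* )=\frac{\varphi+\varphi_*}{2}+e^{-t}\frac{\varphi-\varphi_*}{2},\qquad \Phi^t_*(\varphi,\varphi_* )=\frac{\varphi+\varphi_*}{2}+e^{-t}\frac{\varphi_*-\varphi}{2},$$ and for $t\ge0$ the semigroup $S(t)$ on $L^1(\mathbb{R}^2)$ is $$(S(t)g)(\varphi,\varphi_* )=e^{(1-\gamma)t}\,g\big(\Phi^{-t}(\varphi,\varphi_* ),\Phi^{-t}_*(\varphi,\varphi_* )\big).$$ The system in the claim is the mild formulation of the initial value problem, with initial data $(f_0,g_0)$, for $$\partial_tf=2\Big(\gamma\int_{\mathbb{R}}g\,\mathrm{d}\varphi_*-\lambda f\int_{\mathbb{R}}f(\varphi_*,t)\,\mathrm{d}\varphi_*\Big),\qquad \partial_tg+\nabla\cdot(v_1g)=\lambda f(\varphi,t)f(\varphi_*,t)-\gamma g,$$ with $\nabla=(\partial_\varphi,\partial_{\varphi_*})$ and $v_1(\varphi,\varphi_* )=\frac{\varphi-\varphi_*}{2}(-1,1)$. *)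

(* Defs.v *)
From HB Require Import structures.
From mathcomp Require Import all_boot all_order all_algebra.
From mathcomp Require Import all_classical all_reals all_analysis.
Set Implicit Arguments.
Unset Strict Implicit.
Unset Printing Implicit Defensive.
Import Order.TTheory GRing.Theory Num.Theory.
Import numFieldNormedType.Exports.
Local Open Scope classical_set_scope.
Local Open Scope ring_scope.

Section L1.
Context {d : measure_display} {T : measurableType d} {R : realType}.
Variable mu : {measure set T -> \bar R}.

(* Elements of [LspaceType1 mu] are classes of functions modulo equality
   [mu]-a.e.; they coerce to functions through a chosen representative. *)
Definition L1_nneg : set (LspaceType1 mu) :=
  [set u | {ae mu, forall x, 0 <= (u : T -> R) x}].

Definition L1_dist (u v : LspaceType1 mu) : \bar R :=
  Lnorm mu 1 (fun x => ((u : T -> R) x - (v : T -> R) x)%:E).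

(* [u] restricted to [0, +oo[ belongs to C([0, +oo[; L^1_+(mu)); the values of
   [u] at negative times are irrelevant. *)
Definition C_L1_nneg (u : R -> LspaceType1 mu) : Prop :=
  forall t : R, 0 <= t ->
    L1_nneg (u t) /\
    L1_dist (u s) (u t) @[s --> within `[0, +oo[ (nbhs t)] --> 0%E.

(* An L^1-valued curve only determines [u t] up to a null set depending on [t].
   Time integrals of [u] are written pointwise on a jointly measurable
   representative [f (x, t)]; every curve in C([0, +oo[; L^1) has one, and two
   of them agree a.e. on T x [0, +oo[. *)
Definition represents (f : T * measurableTypeR R -> R)
    (u : R -> LspaceType1 mu) : Prop :=
  measurable_fun [set xt : T * measurableTypeR R | 0 <= xt.2 :> R] f /\
  forall t : R, 0 <= t -> {ae mu, forall x, f (x, t) = (u t : T -> R) x}.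

End L1.

Section Model.
Context {R : realType}.

Notation R1 := (measurableTypeR R).
Notation R2 := (measurableTypeR R * measurableTypeR R)%type.

Definition leb1 : {measure set R1 -> \bar R} := lebesgue_measure.
Definition leb2 : {measure set R2 -> \bar R} :=
  (@lebesgue_measure R \x @lebesgue_measure R)%E.

(* Derivative at [t] of a function on [0, +oo[, hence one-sided at [t = 0]. *)
Definition has_derivative_ge0 (M : R -> R) (t l : R) : Prop :=
  h^-1 * (M (t + h) - M t) @[h --> within [set h | 0 <= t + h] 0^'] --> l.

Definition mass_system (lambda gamma : R) (Mf Mg : R -> R) : Prop :=
  forall t : R, 0 <= t ->
    has_derivative_ge0 Mf t (2 * gamma * Mg t - 2 * lambda * Mf t ^+ 2) /\
    has_derivative_ge0 Mg t (lambda * Mf t ^+ 2 - gamma * Mg t).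

Definition damping (lambda : R) (Mf : R -> R) (s t : R) : R :=
  expR (- 2 * lambda * \int[leb1]_(r in `[s, t]) Mf r).

Definition Phi (t : R) (z : R2) : R :=
  (z.1 + z.2) / 2 + expR (- t) * ((z.1 - z.2) / 2).

Definition Phi_star (t : R) (z : R2) : R :=
  (z.1 + z.2) / 2 + expR (- t) * ((z.2 - z.1) / 2).

(* The map z |-> (Phi (- t) z, Phi_star (- t) z) is a linear bijection of R^2,
   so this action on functions is compatible with a.e. equality. *)
Definition semigroup (gamma t : R) (g : R2 -> R) : R2 -> R :=
  fun z => expR ((1 - gamma) * t) * g (Phi (- t) z, Phi_star (- t) z).

(* The equations are between extended reals, so that they entail the
   finiteness (for a.e. point) of the integrals they contain. *)
Definition mild_equations (lambda gamma : R) (Mf : R -> R)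
    (f0 : R1 -> R) (g0 : R2 -> R)
    (f : R1 * R1 -> R) (g : R2 * R1 -> R) : Prop :=
  forall t : R, 0 <= t ->
    {ae leb1, forall x,
      (f (x, t))%:E =
        ((damping lambda Mf 0 t * f0 x)%:E +
         (2 * gamma)%:E *
           \int[leb1]_(s in `[0%R, t])
             ((damping lambda Mf s t)%:E *
              \int[leb1]_y (g ((x, y), s))%:E))%E} /\
    {ae leb2, forall z,
      (g (z, t))%:E =
        ((semigroup gamma t g0 z)%:E +
         lambda%:E *
           \int[leb1]_(s in `[0%R, t])
             (semigroup gamma (t - s) (fun p => f (p.1, s) * f (p.2, s))%R z)%:E)%E}.

Definition mild_solution (lambda gamma : R) (Mf : R -> R)
    (f0 : LspaceType1 leb1) (g0 : LspaceType1 leb2)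
    (u : R -> LspaceType1 leb1) (v : R -> LspaceType1 leb2) : Prop :=
  [/\ C_L1_nneg u, C_L1_nneg v &
      exists f g, [/\ represents f u, represents g v &
                      mild_equations lambda gamma Mf f0 g0 f g]].

End Model.

(* Main.v *)
Require Import Defs.
From HB Require Import structures.
From mathcomp Require Import all_boot all_order all_algebra.
From mathcomp Require Import all_classical all_reals all_analysis.
From mathcomp Require Import measurable_realfun.
From mathcomp Require Import lra ring.
Set Implicit Arguments.
Unset Strict Implicit.
Unset Printing Implicit Defensive.
Import Order.TTheory GRing.Theory Num.Theory.
Import numFieldNormedType.Exports.
Local Open Scope classical_set_scope.
Local Open Scope ring_scope.

(** Write (S(t) h)(z) = e^((1 - gamma) t) h(Phi^(-t) z). Both equations have the
    form y(t) = U(t) (y_0 + int_0^t V(s) q(s) ds) with a nonnegative source q and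
    V(s) the inverse of U(s): for f the operators are the multiplications by
    F(0, t) and 1 / F(0, s), for g they are S(t) and S(-s). In each case U(t) and
    V(s) multiply a function by a positive number and compose it with a map that
    scales the measure ([wflow]), so that the masses of such an expression
    ([duhamel]) are explicit: [integral_duhamel]. The masses of a solution are
    thus governed by the integrated form of the mass system ([mass_f_mild],
    [mass_g_mild]).

    Existence. The sources 2 gamma int g dy and lambda f(x) f(y) are monotone in
    nonnegative (f, g). Picard iteration from (0, 0) therefore increases, and
    since (M_f, M_g) solves the integrated mass system exactly, every iterate has
    masses at most (M_f, M_g) ([picard_mass]). By monotone convergence the limit
    satisfies the equations at every point, and it is finite almost everywhere
    ([step_existence]).

    Continuity in L1. In U(t) k(t) the factor k(t) is nondecreasing, so that its
    increments have norms equal to increments of mass; the rest is the strong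
    continuity of U ([cvg_duhamel_L1]). For S this is the continuity of dilations
    in the variable z.1 - z.2 ([collision_flow_continuous]): on each line it
    follows from the density of continuous functions with compact support
    ([L1_dilation_continuous]), and Tonelli with dominated convergence gives the
    plane.

    Uniqueness. The distance of two solutions is dominated by the Duhamel
    integral, with zero initial data, of that same distance, with constants
    depending on bounds of the masses on a compact time interval; Gronwall's
    lemma concludes ([step_uniqueness]).

    The equations are written with representatives that are determined only up
    to null sets depending on time. Since the flows preserve null sets,
    [duhamel_negligible] allows replacing the sources by versions that are
    nonnegative everywhere ([mild_equationsP]). *)

(** * Nonnegative measurable functions and limits of extended reals *)

Section NonnegativeMeasurable.
Context {d : measure_display} {T : measurableType d} {R : realType}.
Local Open Scope ereal_scope.

Definition nnmeas {d'} {T' : measurableType d'} (h : T' -> \bar R) :=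
  measurable_fun setT h /\ forall x, 0 <= h x.

Lemma nnmeas_comp {d'} {T' : measurableType d'}
    (h : T' -> \bar R) (f : T -> T') :
  nnmeas h -> measurable_fun setT f -> nnmeas (h \o f).
Proof. by move=> [mh h0] mf; split => //=; exact: measurableT_comp. Qed.

Lemma nnmeas0 : nnmeas (cst 0 : T -> \bar R).
Proof. by split => //; exact: measurable_cst. Qed.

Lemma nnmeasD (h h' : T -> \bar R) : nnmeas h -> nnmeas h' -> nnmeas (h \+ h').
Proof.
by move=> [mh h0] [mh' h0']; split => [|x]; [exact: emeasurable_funD|rewrite adde_ge0].
Qed.

End NonnegativeMeasurable.

Section Convergence.
Context {R : realType} {I : Type} (F : set_system I) {FF : Filter F}.
Local Open Scope ereal_scope.

Lemma ge0_cvge0P (f : I -> \bar R) : (forall i, 0 <= f i) ->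
  (forall e : R, (0 < e)%R -> \forall i \near F, f i <= e%:E) <->
  f i @[i --> F] --> 0.
Proof.
move=> f0; split => [H|].
  apply/fine_cvgP; split.
    apply: filterS (H _ ltr01) => i fi.
    by rewrite ge0_fin_numE// (le_lt_trans fi)// ltry.
  apply/cvgrPdist_le => /= e e0; apply: filterS (H _ e0) => i fi.
  rewrite sub0r normrN ger0_norm ?fine_ge0// -lee_fin fineK//.
  by rewrite ge0_fin_numE// (le_lt_trans fi)// ltry.
move=> /fine_cvgP[fin /cvgrPdist_le c0] e e0.
apply: filterS2 fin (c0 _ e0) => i fi /=.
by rewrite sub0r normrN ger0_norm ?fine_ge0// -lee_fin fineK.
Qed.

Lemma squeeze_cvg0 (f g : I -> \bar R) :
  (\forall i \near F, 0 <= f i <= g i) ->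
  g i @[i --> F] --> 0 -> f i @[i --> F] --> 0.
Proof. by move=> fg; apply: (squeeze_cvge fg); exact: cvg_cst. Qed.

End Convergence.

Section MonotoneLimits.
Context {R : realType}.
Local Open Scope ereal_scope.

Lemma nondecreasing_cvg_le (u : nat -> \bar R) (l : \bar R) :
  {homo u : n m / (n <= m)%N >-> n <= m} -> u n @[n --> \oo] --> l ->
  forall n, u n <= l.
Proof.
move=> nd ul n; apply: (cvge_to_ge ul).
by exists n => // m /= nm; exact: nd.
Qed.

(** Monotonicity takes care of the indeterminate product: if one limit is zero,
    then so is every term of that sequence. *)
Lemma nondecreasing_cvgM (u v : nat -> \bar R) (a b : \bar R) :
  (forall n, 0 <= u n) -> (forall n, 0 <= v n) ->
  {homo u : n m / (n <= m)%N >-> n <= m} ->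
  {homo v : n m / (n <= m)%N >-> n <= m} ->
  u n @[n --> \oo] --> a -> v n @[n --> \oo] --> b ->
  u n * v n @[n --> \oo] --> a * b.
Proof.
move=> u0 v0 ndu ndv ua vb.
have ule := nondecreasing_cvg_le ndu ua.
have vle := nondecreasing_cvg_le ndv vb.
have a0 : 0 <= a by apply: le_trans (ule 0%N).
have b0 : 0 <= b by apply: le_trans (vle 0%N).
have [az|an0] := eqVneq a 0.
  rewrite az mul0e; apply: cvg_near_cst; apply: nearW => n.
  have -> : u n = 0 by apply/eqP; rewrite eq_le u0 -az ule.
  by rewrite mul0e.
have [bz|bn0] := eqVneq b 0.
  rewrite bz mule0; apply: cvg_near_cst; apply: nearW => n.
  have -> : v n = 0 by apply/eqP; rewrite eq_le v0 -bz vle.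
  by rewrite mule0.
by apply: cvgeM => //; rewrite mule_defE (negbTE an0) (negbTE bn0).
Qed.

End MonotoneLimits.

(** * Duhamel formulas for weighted flows *)

Section TimeIntegral.
Context {d : measure_display} {T : measurableType d} {R : realType}.
Variable mu : {sigma_finite_measure set T -> \bar R}.
Notation R1 := (measurableTypeR R).
Local Open Scope ereal_scope.

Lemma measurable_le_time :
  measurable [set q : R1 * R1 | (0 <= q.2 <= q.1)%R].
Proof.
have m1 : measurable_fun setT (fun q : R1 * R1 => (q.1 : R)%:E : \bar R).
  by apply/measurable_EFinP; exact: measurable_fst.
have m2 : measurable_fun setT (fun q : R1 * R1 => (q.2 : R)%:E : \bar R).
  by apply/measurable_EFinP; exact: measurable_snd.
have := measurableI _ _ (measurable_lee measurableT (measurable_cst 0%:E) m2)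
  (measurable_lee measurableT m2 m1).
congr measurable; apply/seteqP; split => q /=.
  by rewrite !lee_fin => -[[_ ->] [_ ->]].
by rewrite !lee_fin => /andP[-> ->].
Qed.

Lemma measurable_primitive (k : T * R1 -> \bar R) :
  measurable_fun setT k -> (forall p, 0 <= k p) ->
  measurable_fun setT
    (fun p : T * R1 => \int[@leb1 R]_(s in `[0%R, p.2]) k (p.1, s)).
Proof.
move=> mk k0.
pose L : set ((T * R1) * R1) :=
  (fun q => (q.1.2, q.2)) @^-1` [set q : R1 * R1 | (0 <= q.2 <= q.1)%R].
have mL : measurable L.
  rewrite -[L]setTI; apply: (measurable_fun_pair _ _ measurableT).
  - by apply: (measurableT_comp measurable_snd); exact: measurable_fst.
  - exact: measurable_snd.
  - exact: measurable_le_time.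
pose K (q : (T * R1) * R1) := k (q.1.1, q.2) * (\1_L q)%:E.
have mK : measurable_fun setT K.
  apply: emeasurable_funM.
    apply: (measurableT_comp mk); apply: measurable_fun_pair.
      by apply: (measurableT_comp measurable_fst); exact: measurable_fst.
    exact: measurable_snd.
  by apply/measurable_EFinP; exact: measurable_indic.
have K0 q : 0 <= K q by rewrite mule_ge0// lee_fin.
have := measurable_fun_fubini_tonelli_F (m2 := @leb1 R) K mK K0.
apply: eq_measurable_fun => p _; rewrite /fubini_F [RHS]integral_mkcond.
apply: eq_integral => s _; rewrite /K patchE indicE.
have [sp|sp] := boolP (s \in `[0%R, p.2]%classic).
  by rewrite (_ : _ \in L) ?mule1//; move: sp; rewrite !inE /L/= ?in_itv/=.
rewrite (_ : _ \in L = false) ?mule0//; apply/negbTE; move: sp.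
by apply: contra; rewrite !inE /L/= ?in_itv/=.
Qed.

Lemma integral_time_swap (D : set R1) (k : T * R1 -> \bar R) :
  measurable D -> measurable_fun setT k -> (forall p, 0 <= k p) ->
  \int[mu]_x \int[@leb1 R]_(s in D) k (x, s) =
  \int[@leb1 R]_(s in D) \int[mu]_x k (x, s).
Proof.
move=> mD mk k0.
pose K (p : T * R1) := k p * (\1_D p.2)%:E.
have mD' : measurable_fun setT (fun p : T * R1 => (\1_D p.2)%:E : \bar R).
  apply/measurable_EFinP; apply: (measurableT_comp (measurable_indic mD)).
  exact: measurable_snd.
have mK : measurable_fun setT K by exact: emeasurable_funM.
have K0 q : 0 <= K q by rewrite mule_ge0// lee_fin.
transitivity (\int[mu]_x \int[@leb1 R]_s K (x, s)).
  apply: eq_integral => x _; rewrite integral_mkcond.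
  apply: eq_integral => s _; rewrite /K/= patchE indicE.
  by case: ifPn => _; rewrite ?mule1 ?mule0.
rewrite (fubini_tonelli (m1 := mu) (m2 := @leb1 R))//.
rewrite [RHS]integral_mkcond; apply: eq_integral => s _; rewrite patchE.
case: ifPn => sD; rewrite /K/= indicE.
  by rewrite sD; apply: eq_integral => x _; rewrite mule1.
rewrite (negbTE sD); apply: integral0_eq => x _.
by rewrite mule0.
Qed.

Lemma measurable_mass (k : T * R1 -> \bar R) :
  measurable_fun setT k -> (forall p, 0 <= k p) ->
  measurable_fun setT (fun s : R1 => \int[mu]_x k (x, s)).
Proof.
by move=> mk k0; exact: (measurable_fun_fubini_tonelli_G (m1 := mu) k).
Qed.

End TimeIntegral.

Section WeightedFlow.
Context {d : measure_display} {T : measurableType d} {R : realType}.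
Notation R1 := (measurableTypeR R).

(** A positive function of time times composition with a map of the space,
    acting on functions. Conservation of mass up to the factor [gain]
    gives both the masses of Duhamel integrals and, applied to indicators, the
    invariance of null sets. *)
Record wflow (mu : {sigma_finite_measure set T -> \bar R}) := Wflow {
  weight : R -> R;
  transport : R -> T -> T;
  gain : R -> R;
  weight_gt0 : forall t, 0 < weight t;
  gain_gt0 : forall t, 0 < gain t;
  measurable_weight : measurable_fun [set: R1] weight;
  measurable_gain : measurable_fun [set: R1] gain;
  measurable_transport :
    measurable_fun [set: T * R1] (fun p : T * R1 => transport p.2 p.1);
  integral_transport : forall t (h : T -> \bar R),
    measurable_fun setT h -> (forall x, 0 <= h x)%E ->
    (\int[mu]_x ((weight t)%:E * h (transport t x)) =
     (gain t)%:E * \int[mu]_x h x)%E }.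

End WeightedFlow.

Section Duhamel.
Context {d : measure_display} {T : measurableType d} {R : realType}.
Variable mu : {sigma_finite_measure set T -> \bar R}.
Notation R1 := (measurableTypeR R).
Local Open Scope ereal_scope.
Implicit Types (U V : wflow mu) (y : T -> \bar R) (q : T * R1 -> \bar R).

Definition act U (t : R) y : T -> \bar R :=
  fun x => (weight U t)%:E * y (transport U t x).

Definition pullback V q : T * R1 -> \bar R :=
  fun p => (weight V p.2)%:E * q (transport V p.2 p.1, p.2).

(** The interaction picture: with [V s] the inverse of [U s], the solution of
    y' = A y + q is [U t] applied to [memory V y q (., t)], which is
    nondecreasing in t when q is nonnegative. *)
Definition memory V y q : T * R1 -> \bar R :=
  fun p => y p.1 + \int[@leb1 R]_(s in `[0%R, p.2]) pullback V q (p.1, s).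

Definition duhamel U V y q : T * R1 -> \bar R :=
  fun p => act U p.2 (fun x => memory V y q (x, p.2)) p.1.

Lemma nnmeas_slice q (t : R1) : nnmeas q -> nnmeas (fun x => q (x, t)).
Proof.
move=> [mq q0]; split => //.
by apply: (measurableT_comp mq); exact: measurable_fun_pair.
Qed.

Lemma nnmeas_timeslice q (x : T) : nnmeas q -> nnmeas (fun t : R1 => q (x, t)).
Proof.
move=> [mq q0]; split => //.
by apply: (measurableT_comp mq); exact: measurable_fun_pair.
Qed.

Lemma nnmeas_pullback V q : nnmeas q -> nnmeas (pullback V q).
Proof.
move=> [mq q0]; split => [|p]; last first.
  by rewrite mule_ge0// lee_fin; apply/ltW/weight_gt0.
apply: emeasurable_funM.
  apply/measurable_EFinP; apply: (measurableT_comp (measurable_weight V)).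
  exact: measurable_snd.
apply: (measurableT_comp mq); apply: measurable_fun_pair.
  exact: measurable_transport.
exact: measurable_snd.
Qed.

Lemma nnmeas_memory V y q : nnmeas y -> nnmeas q -> nnmeas (memory V y q).
Proof.
move=> [my y0] nq; have [mp p0] := nnmeas_pullback V nq; split => [|p].
  apply: emeasurable_funD.
    by apply: (measurableT_comp my); exact: measurable_fst.
  exact: measurable_primitive.
by rewrite adde_ge0// integral_ge0.
Qed.

Lemma nnmeas_act U t y : nnmeas y -> nnmeas (act U t y).
Proof.
move=> [my y0]; split => [|x]; last first.
  by rewrite mule_ge0// lee_fin; apply/ltW/weight_gt0.
apply: emeasurable_funM => //; apply: (measurableT_comp my).
apply: (measurableT_comp (measurable_transport U) (g := fun x => (x, t))).
exact: measurable_fun_pair.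
Qed.

Lemma nnmeas_duhamel U V y q : nnmeas y -> nnmeas q ->
  nnmeas (duhamel U V y q).
Proof.
by move=> ny nq; apply: (nnmeas_pullback U); exact: nnmeas_memory.
Qed.

(** Tonelli, then the mass balance of the flow at each time s. *)
Lemma integral_memory V y q t : nnmeas y -> nnmeas q ->
  \int[mu]_x memory V y q (x, t) =
  \int[mu]_x y x +
  \int[@leb1 R]_(s in `[0%R, t]) ((gain V s)%:E * \int[mu]_x q (x, s)).
Proof.
move=> [my y0] nq; have np := nnmeas_pullback V nq.
rewrite ge0_integralD//=; last first.
- have [+ _] := @nnmeas_slice _ t (nnmeas_memory V (conj (measurable_cst 0)
     (fun=> lexx 0)) nq).
  by apply: eq_measurable_fun => x _; rewrite /memory/= add0e.
- by move=> x _; apply: integral_ge0 => s _; case: np.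
congr (_ + _); rewrite integral_time_swap//; [|by case: np..].
by apply: eq_integral => s _; have [? ?] := @nnmeas_slice _ s nq;
   rewrite -(@integral_transport _ _ _ _ V).
Qed.

Lemma integral_duhamel U V y q t : nnmeas y -> nnmeas q ->
  \int[mu]_x duhamel U V y q (x, t) =
  (gain U t)%:E * (\int[mu]_x y x +
  \int[@leb1 R]_(s in `[0%R, t]) ((gain V s)%:E * \int[mu]_x q (x, s))).
Proof.
move=> ny nq; have [? ?] := @nnmeas_slice _ t (nnmeas_memory V ny nq).
by rewrite -integral_memory// -integral_transport.
Qed.

End Duhamel.

Section DuhamelOrder.
Context {d : measure_display} {T : measurableType d} {R : realType}.
Variable mu : {sigma_finite_measure set T -> \bar R}.
Notation R1 := (measurableTypeR R).
Local Open Scope ereal_scope.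
Implicit Types (U V : wflow mu) (y : T -> \bar R) (q : T * R1 -> \bar R).

Lemma weight_ge0E U t : 0 <= (weight U t)%:E.
Proof. by rewrite lee_fin; exact/ltW/weight_gt0. Qed.

Lemma measurable_slice_itv (k : T * R1 -> \bar R) x (D : set R1) :
  nnmeas k -> measurable_fun D (fun s : R1 => k (x, s)).
Proof. by move=> /(nnmeas_timeslice x)[/measurable_funTS]. Qed.

Lemma le_act U t y y' : (forall x, y x <= y' x) ->
  forall x, act U t y x <= act U t y' x.
Proof. by move=> yy x; rewrite lee_wpmul2l// weight_ge0E. Qed.

Lemma le_duhamel U V y y' q q' (t : R1) :
  nnmeas q -> nnmeas q' -> (forall x, y x <= y' x) ->
  (forall x s, (0 <= s <= t)%R -> q (x, s) <= q' (x, s)) ->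
  forall x, duhamel U V y q (x, t) <= duhamel U V y' q' (x, t).
Proof.
move=> nq nq' yy qq x; rewrite /duhamel/=; apply: le_act => {}x; apply: leeD => //=.
have np := nnmeas_pullback V nq; have np' := nnmeas_pullback V nq'.
apply: ge0_le_integral => //.
- by move=> s _; case: np.
- exact: measurable_slice_itv.
- exact: measurable_slice_itv.
- move=> s; rewrite /= in_itv/= => st.
  by apply: lee_wpmul2l; [exact: weight_ge0E|exact: qq].
Qed.

Lemma duhamelD U V y q q' p : nnmeas y -> nnmeas q -> nnmeas q' ->
  duhamel U V y (q \+ q') p =
  duhamel U V y q p + duhamel U V (cst 0) q' p.
Proof.
move=> [my y0] nq nq'; rewrite /duhamel/= /act -ge0_muleDr; last 2 first.
- by have [] := nnmeas_memory V (conj my y0) nq.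
- by have [] := nnmeas_memory V (conj (measurable_cst 0) (fun=> lexx 0)) nq'.
congr (_ * _); rewrite /memory/= add0e -addeA; congr (_ + _).
have np := nnmeas_pullback V nq; have np' := nnmeas_pullback V nq'.
rewrite -ge0_integralD//.
- apply: eq_integral => s _; rewrite /pullback/= ge0_muleDr//.
  + by case: nq.
  + by case: nq'.
- by move=> s _; case: np.
- exact: measurable_slice_itv.
- by move=> s _; case: np'.
- exact: measurable_slice_itv.
Qed.

(** The factored form suits continuity in time; this unfactored one is that of
    the mild equations. *)
Lemma duhamel_unfold U V y q (x : T) (t : R1) : nnmeas y -> nnmeas q ->
  duhamel U V y q (x, t) = act U t y x +
    \int[@leb1 R]_(s in `[0%R, t])
      ((weight U t * weight V s)%:E * q (transport V s (transport U t x), s)).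
Proof.
move=> [my y0] nq; have np := nnmeas_pullback V nq.
rewrite /duhamel/= /act/= ge0_muleDr//; last first.
  by apply: integral_ge0 => s _; case: np.
congr (_ + _); rewrite -ge0_integralZl//.
- by apply: eq_integral => s _; rewrite EFinM -muleA.
- exact: measurable_slice_itv.
- by move=> s _; case: np.
- by rewrite weight_ge0E.
Qed.

Lemma cvg_duhamel U V y (q_ : nat -> T * R1 -> \bar R) q p :
  nnmeas y -> (forall n, nnmeas (q_ n)) ->
  (forall p, {homo q_^~ p : n m / (n <= m)%N >-> n <= m}) ->
  (forall p, q_ n p @[n --> \oo] --> q p) ->
  duhamel U V y (q_ n) p @[n --> \oo] --> duhamel U V y q p.
Proof.
move=> [_ y0] nq ndq qq.
have np n := nnmeas_pullback V (nq n).
have pp0 r : pullback V (q_ n) r @[n --> \oo] --> pullback V q r.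
  by apply: cvgeZl => //; exact: qq.
have p0 r : 0 <= pullback V q r.
  by apply: cvge_to_ge (pp0 r) _; apply: nearW => n; case: (np n).
apply: cvgeZl => //; apply: cvgeD.
- by rewrite ge0_adde_def ?inE//= integral_ge0.
- exact: cvg_cst.
- rewrite [X in _ --> X](_ : _ = \int[@leb1 R]_(s in `[0%R, p.2])
     limn (fun n => pullback V (q_ n) (transport U p.2 p.1, s))); last first.
    by apply: eq_integral => s _; apply/esym/cvg_lim => //; exact: pp0.
  apply: cvg_monotone_convergence => //.
  + by move=> n; exact: measurable_slice_itv.
  + by move=> n s _; case: (np n).
  + move=> s _ n m nm; by apply: lee_wpmul2l; [exact: weight_ge0E|exact: ndq].
Qed.

(** The indicator of a set with null slices has zero mass at every time, hence
    so does its Duhamel integral, which therefore vanishes almost everywhere.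
    Consequently the mild equations do not see changes of the source on null
    sets depending on time. *)
Lemma duhamel_negligible U V (N : set (T * R1)) (t : R1) : measurable N ->
  (forall s, (0 <= s <= t)%R -> mu (ysection N s) = 0) ->
  {ae mu, forall x, {ae @leb1 R, forall s, (0 <= s <= t)%R ->
    ~ N (transport V s (transport U t x), s)}}.
Proof.
move=> mN N0.
pose q (p : T * R1) : \bar R := (\1_N p)%:E.
have nq : nnmeas q.
  by split => [|p]; [exact/measurable_EFinP/measurable_indic|rewrite lee_fin].
have n0 : nnmeas (cst 0 : T -> \bar R) by split => //; exact: measurable_cst.
have [mD D0] := nnmeas_slice t (nnmeas_duhamel U V n0 nq).
have : \int[mu]_x `|duhamel U V (cst 0) q (x, t)| = 0.
  under eq_integral do rewrite gee0_abs//.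
  rewrite integral_duhamel// integral0 add0e integral0_eq ?mule0// => s.
  rewrite /= in_itv/= => st; rewrite -[RHS](mule0 (gain V s)%:E).
  congr (_ * _); rewrite -(N0 _ st).
  have := integral_indic mu measurableT (measurable_ysection s mN).
  rewrite setIT => <-; apply: eq_integral => x _.
  by rewrite /q !indicE mem_ysection.
move=> /(ae_eq_integral_abs _ measurableT mD); apply: filterS => x /(_ I).
rewrite duhamel_unfold// /act/= mule0 add0e => int0.
pose h (s : R1) := (weight U t * weight V s)%:E * q (transport V s (transport U t x), s).
have nh : nnmeas h.
  have [mp p0] := nnmeas_timeslice (transport U t x) (nnmeas_pullback V nq).
  have -> : h = (fun s => (weight U t)%:E * pullback V q (transport U t x, s)).
    by apply/funext => s; rewrite /h EFinM -muleA.
  split => [|s]; first exact: measurable_funeM.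
  by rewrite mule_ge0// weight_ge0E.
have mh : measurable_fun `[0%R, t] h by apply: measurable_funTS; case: nh.
have mI : measurable (`[0%R, t]%classic : set R1) by [].
have : \int[@leb1 R]_(s in `[0%R, t]) `|h s| = 0.
  rewrite -[RHS]int0; apply: eq_integral => s _; rewrite gee0_abs//.
  by case: nh.
move=> /(ae_eq_integral_abs _ mI mh); apply: filterS => s hs st Ns.
have := hs; rewrite /= in_itv/= => /(_ st)/eqP.
rewrite /h /q indicE mem_set// mule1 eqe gt_eqF//.
by rewrite mulr_gt0// weight_gt0.
Qed.

End DuhamelOrder.

Section DuhamelContinuity.
Context {d : measure_display} {T : measurableType d} {R : realType}.
Variable mu : {sigma_finite_measure set T -> \bar R}.
Notation R1 := (measurableTypeR R).
Local Open Scope ereal_scope.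
Implicit Types (U V : wflow mu) (y : T -> \bar R) (q : T * R1 -> \bar R).

Definition L1_strongly_continuous U (t : R) :=
  forall k : T -> R, measurable_fun setT k -> (forall x, (0 <= k x)%R) ->
  \int[mu]_x (k x)%:E < +oo ->
  \int[mu]_x `|weight U s * k (transport U s x)
               - weight U t * k (transport U t x)|%:E
    @[s --> within `[0%R, +oo[ (nbhs t)] --> 0.

(** Also true at infinity, where [fine] is zero on both sides; this avoids
    discarding the null set where a solution is infinite. *)
Lemma fine_posZ (r : R) (e : \bar R) : (0 < r)%R ->
  fine (r%:E * e) = (r * fine e)%R.
Proof.
move=> r0; case: e => [x| |] //=.
  by rewrite gt0_muley ?lte_fin//= mulr0.
by rewrite gt0_muleNy ?lte_fin//= mulr0.
Qed.

(** If p and r are both infinite the left side is zero; if exactly one is, then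
    D is infinite. *)
Lemma fine_dist_le (p r D : \bar R) : 0 <= p -> 0 <= r -> 0 <= D ->
  r = p + D \/ p = r + D -> `|fine r - fine p|%:E <= D.
Proof.
wlog rp : p r / r = p + D.
  move=> H p0 r0 D0 [|] E; first by apply: H => //; left.
  by rewrite distrC; apply: H => //; left.
move=> p0 r0 D0 _; move: p p0 rp => [p| |]//= p0 rp.
  move: D D0 rp => [D| |]//= D0 rp; last by rewrite leey.
  by rewrite rp/= addrAC subrr add0r lee_fin ger0_norm// -lee_fin.
rewrite addye in rp; last by rewrite gt_eqF// (lt_le_trans _ D0).
by rewrite rp subrr normr0.
Qed.

Lemma memory_split V y q x (a b : R) : nnmeas q -> (0 <= a <= b)%R ->
  memory V y q (x, b) =
  memory V y q (x, a) + \int[@leb1 R]_(s in `]a, b]) pullback V q (x, s).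
Proof.
move=> nq /andP[a0 ab]; have np := nnmeas_pullback V nq.
rewrite /memory/= -addeA; congr (_ + _).
rewrite (@itv_bndbnd_setU _ _ _ (BRight a)) ?bnd_simp//.
rewrite ge0_integral_setU//.
- exact: measurable_slice_itv.
- by move=> s _; case: np.
- apply/disj_set2P; rewrite -subset0 => z/=; rewrite !in_itv/=.
  by move=> [/andP[_ za] /andP[az _]]; move: (lt_le_trans az za); rewrite ltxx.
Qed.

(** In U(s) k(s) - U(t) k(t) = U(s) (k(s) - k(t)) + (U(s) - U(t)) k(t) the
    first term is small because the memory k is monotone in time, so that the
    norm of k(s) - k(t) is a difference of masses, of order |s - t|; the second
    one because U is strongly continuous. *)
Lemma cvg_duhamel_L1 U V y q (t b C M : R) :
  nnmeas y -> nnmeas q -> \int[mu]_x y x < +oo ->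
  (0 <= t < b)%R ->
  (forall s, (0 <= s <= b)%R -> [/\ (gain U s <= C)%R, (gain V s <= C)%R &
    \int[mu]_x q (x, s) <= M%:E]) ->
  L1_strongly_continuous U t ->
  \int[mu]_x `|fine (duhamel U V y q (x, s)) -
               fine (duhamel U V y q (x, t))|%:E
    @[s --> within `[0%R, +oo[ (nbhs t)] --> 0.
Proof.
move=> ny nq y_fin /andP[t0 tb] bnd Ucont.
have b0 : (0 <= b)%R by rewrite (le_trans t0)// ltW.
have [C0 _ M0] := bnd _ (introT andP (conj (lexx 0%R) b0)).
have {}C0 : (0 <= C)%R by apply: le_trans C0; rewrite ltW// gain_gt0.
have {}M0 : (0 <= M)%R.
  rewrite -lee_fin; apply: le_trans M0; apply: integral_ge0 => x _.
  by case: nq.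
have np := nnmeas_pullback V nq; have nm := nnmeas_memory V ny nq.
have le_int_itv (D : set R1) : measurable D -> D `<=` `[0%R, b] ->
    \int[@leb1 R]_(s in D) ((gain V s)%:E * \int[mu]_x q (x, s)) <=
    (C * M)%:E * leb1 D.
  move=> mD Db; have <- := integral_cst (@leb1 R) mD (C * M)%:E.
  apply: ge0_le_integral => //.
  - move=> s _; rewrite mule_ge0 ?lee_fin ?(ltW (gain_gt0 _ _))//.
    by apply: integral_ge0 => x _; case: nq.
  - apply: measurable_funTS; apply: emeasurable_funM.
      by apply/measurable_EFinP; exact: measurable_gain.
    by apply: measurable_mass; case: nq.
  - move=> s /Db; rewrite /= in_itv/= => /bnd[_ gC qM]; rewrite EFinM.
    apply: lee_pmul => //; first by rewrite lee_fin ltW// gain_gt0.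
    by apply: integral_ge0 => x _; case: nq.
pose k x := fine (memory V y q (x, t)).
have [mk k0] := nnmeas_slice t nm.
have mkf : measurable_fun setT k.
  by apply: (measurableT_comp (fine_measurable measurableT)).
have kf0 x : (0 <= k x)%R by rewrite fine_ge0.
have k_fin : \int[mu]_x (k x)%:E < +oo.
  apply: (@le_lt_trans _ _ (\int[mu]_x memory V y q (x, t))).
    apply: ge0_le_integral => //.
    - by move=> x _; rewrite lee_fin.
    - exact/measurable_EFinP.
    - by move=> x _; rewrite /k; case: memory (k0 x) => //= *; rewrite leey.
  rewrite integral_memory// lte_add_pinfty//.
  apply: (le_lt_trans (le_int_itv `[0%R, t]%classic _ _)) => //.
    move=> s /=; rewrite !in_itv/= => /andP[-> st].
    by rewrite (le_trans st)// ltW.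
  rewrite [leb1 _](lebesgue_measure_itv `[0%R, t]%R).
  by case: ifPn => _; rewrite ?mule0 ?ltry// -EFinB -EFinM ltry.
(* one factor C for U(s), one for V, and M for the source *)
pose bound (s : R) := (C * (C * M) * `|s - t|)%:E +
  \int[mu]_x `|weight U s * k (transport U s x)
               - weight U t * k (transport U t x)|%:E.
apply: (@squeeze_cvge _ _ _ _ (cst 0) _ bound).
- have : within `[0%R, +oo[ (nbhs t) [set s | (0 <= s <= b)%R].
    have : \forall s \near t, (s < b)%R by exact: lt_nbhsl.
    rewrite /within; apply: filterS => s /=; rewrite in_itv/= andbT.
    by move=> sb s0; rewrite s0 ltW.
  apply: filterS => s sb; apply/andP; split.
    by apply: integral_ge0 => x _; rewrite lee_fin.
  (* k(s) and k(t) differ by the integral of the pulled back source over J,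
     whichever of s and t comes first *)
  pose J := `]Num.min s t, Num.max s t]%classic.
  have mJ : measurable (J : set R1) by exact: measurable_itv.
  pose Dl x := \int[@leb1 R]_(r in J) pullback V q (x, r).
  have nDl : nnmeas Dl.
    split => [|x]; last by apply: integral_ge0 => r _; case: np.
    have [mp p0] := np.
    pose kk (p : T * R1) := pullback V q p * (\1_J p.2)%:E.
    have mkk : measurable_fun setT kk.
      apply: emeasurable_funM => //; apply/measurable_EFinP.
      apply: (measurableT_comp _ measurable_snd).
      exact: measurable_indic.
    have kk0 p : 0 <= kk p by rewrite mule_ge0// lee_fin.
    have := measurable_fun_fubini_tonelli_F (m2 := @leb1 R) kk mkk kk0.
    apply: eq_measurable_fun => x _; rewrite /fubini_F /Dl [RHS]integral_mkcond.
    apply: eq_integral => r _; rewrite /kk patchE indicE/=.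
    by case: ifPn => _; rewrite ?mule1 ?mule0.
  have [mD D0] := nDl; have [mUD UD0] := nnmeas_act U s nDl.
  have iUD : \int[mu]_x act U s Dl x <= (C * (C * M) * `|s - t|)%:E.
    rewrite integral_transport// /Dl integral_time_swap//; [|by case: np..].
    rewrite -mulrA EFinM; apply: lee_pmul.
    - by rewrite lee_fin ltW// gain_gt0.
    - apply: integral_ge0 => r _; apply: integral_ge0 => x _; by case: np.
    - by rewrite lee_fin; have [] := bnd _ sb.
    - have -> : \int[@leb1 R]_(r in J) \int[mu]_x pullback V q (x, r) =
          \int[@leb1 R]_(r in J) ((gain V r)%:E * \int[mu]_x q (x, r)).
        apply: eq_integral => r _; have [? ?] := nnmeas_slice r nq.
        by rewrite -(@integral_transport _ _ _ _ V).
      apply: (le_trans (le_int_itv _ mJ _)).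
        move=> r; rewrite /J /= !in_itv/= => /andP[r1 r2].
        apply/andP; split.
          by apply: le_trans (ltW r1); rewrite le_min t0; case/andP: sb => ->.
        apply: le_trans r2 _.
        by rewrite ge_max (ltW tb) andbT; case/andP: sb => _ ->.
      rewrite [leb1 _](lebesgue_measure_itv `]Num.min s t, Num.max s t]%R)/=.
      rewrite lte_fin; case: ifPn => _; last first.
        by rewrite mule0 lee_fin mulr_ge0// mulr_ge0.
      rewrite -EFinB -EFinM lee_fin ler_wpM2l// ?mulr_ge0//.
      by case: (leP s t) => st; rewrite ?ler_norm// distrC ler_norm.
  rewrite /bound.
  have mw (r : R) : measurable_fun setT
      (fun x => weight U r * k (transport U r x))%R.
    apply: measurable_funM => //; apply: (measurableT_comp mkf).
    apply: (measurableT_comp (measurable_transport U) (g := fun x => (x, r))).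
    exact: measurable_fun_pair.
  have mdiff : measurable_fun setT (fun x =>
      `|weight U s * k (transport U s x)
        - weight U t * k (transport U t x)|%:E).
    apply/measurable_EFinP; apply: measurableT_comp => //.
    exact: measurable_funB.
  apply: le_trans (leeD iUD (lexx _)).
  rewrite -ge0_integralD//.
  have md (r : R) : measurable_fun setT (fun x => fine (duhamel U V y q (x, r))).
    apply: (measurableT_comp (fine_measurable measurableT)).
    by case: (nnmeas_slice r (nnmeas_duhamel U V ny nq)).
  apply: ge0_le_integral => //.
  - apply/measurable_EFinP; apply: measurableT_comp => //.
    exact: measurable_funB.
  - exact: emeasurable_funD.
  move=> x _; rewrite /duhamel/= /act !fine_posZ ?weight_gt0// -/(k _).
  set z := transport U s x; set w := transport U t x.
  apply: (@le_trans _ _ (`|weight U s * fine (memory V y q (z, s))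
      - weight U s * k z|%:E + `|weight U s * k z - weight U t * k w|%:E)).
    by rewrite -EFinD lee_fin ler_distD.
  apply: leeD => //; rewrite -mulrBr normrM gtr0_norm ?weight_gt0// EFinM.
  apply: lee_wpmul2l; first exact: weight_ge0E.
  apply: fine_dist_le => //; try by case: nm.
  have [st|/ltW ts] := leP s t.
    right; rewrite /Dl /J min_l// max_r//; apply: memory_split => //.
    by rewrite st andbT; case/andP: sb.
  left; rewrite /Dl /J min_r// max_l//; apply: memory_split => //.
  by rewrite ts t0.
- exact: cvg_cst.
- rewrite -[X in _ --> X]add0e; apply: cvgeD => //; last exact: Ucont.
  apply: cvg_EFin.
    by apply: nearW => s.
  apply: cvg_within_filter.
  have c : (C * (C * M) * `|s - t|)%R @[s --> t] -->
           (C * (C * M) * `|t - t|)%R.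
    apply: cvgM; first exact: cvg_cst.
    by apply: cvg_norm; apply: cvgB; [exact: cvg_id|exact: cvg_cst].
  by rewrite subrr normr0 mulr0 in c; exact: c.
Qed.

End DuhamelContinuity.

(** * Lebesgue measure on the plane and linear maps *)

Section LebesguePlane.
Context {R : realType}.
Notation R1 := (measurableTypeR R).
Notation R2 := (R1 * R1)%type.
Notation mu1 := (@leb1 R).
Local Open Scope ereal_scope.

(** A copy of the product measure, to be declared sigma-finite. *)
Definition lebesgue_plane : set R2 -> \bar R :=
  (@lebesgue_measure R \x @lebesgue_measure R)%E.

HB.instance Definition _ := Measure.on lebesgue_plane.

Lemma lebesgue_plane_sigma_finite : sigma_finite setT lebesgue_plane.
Proof.
pose I (n : nat) : set R1 := [set` `[(- n%:R)%R, n%:R%R]].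
exists (fun n => I n `*` I n).
  apply/esym/seteqP; split => // -[x y] _.
  have xy0 : (0 <= `|x : R| + `|y : R|)%R by rewrite addr_ge0.
  have := ltW (archi_boundP xy0); set n := Num.bound _ => xyn.
  exists n => //; split; rewrite /I/= in_itv/= -ler_norml.
    by apply: le_trans xyn; rewrite lerDl.
  by apply: le_trans xyn; rewrite lerDr.
move=> n; have mI : measurable (I n) by exact: measurable_itv.
split; first exact: measurableX.
have I_fin : lebesgue_measure (I n) \is a fin_num.
  by rewrite lebesgue_measure_itv; case: ifPn.
rewrite /lebesgue_plane product_measure1E// lte_mul_pinfty//.
by rewrite ltey_eq I_fin.
Qed.

HB.instance Definition _ := Measure_isSigmaFinite.Build _ _ _ lebesgue_plane
  lebesgue_plane_sigma_finite.

Definition plane_measure : {sigma_finite_measure set R2 -> \bar R} :=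
  lebesgue_plane.

Lemma measurable_affine (a b : R) :
  measurable_fun [set: R1] (fun x : R1 => (a * x + b)%R : R1).
Proof. by apply: measurable_funD => //; apply: measurable_funM. Qed.

(** The image of the Lebesgue measure under the affine map, rescaled, has the
    right value on half-open intervals. *)
Lemma ge0_integral_affine (a b : R) (h : R1 -> \bar R) :
  (0 < a)%R -> nnmeas h ->
  \int[mu1]_x h (a * x + b)%R = (a^-1)%:E * \int[mu1]_x h x.
Proof.
move=> a0 [mh h0].
pose phi (x : R1) : R1 := (a * x + b)%R.
have mphi : measurable_fun setT phi := measurable_affine a b.
pose nphi : {measure set R1 -> \bar R} := pushforward (@lebesgue_measure R) phi.
have an : (0 <= a)%R := ltW a0.
pose nu : {measure set R1 -> \bar R} := mscale (NngNum an) (nphi mphi).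
have nuE X : ocitv X -> lebesgue_measure X = nu X.
  move=> [[u v] _ <-] /=; rewrite /nu /mscale /= /nphi /pushforward.
  have -> : phi @^-1` [set` `]u, v]%R] = [set` `]((u - b) / a), ((v - b) / a)]%R].
    apply/seteqP; split => x /=; rewrite !in_itv/= /phi.
      by rewrite ltr_pdivrMr// ler_pdivlMr// ltrBlDr lerBrDr mulrC.
    by rewrite ltr_pdivrMr// ler_pdivlMr// ltrBlDr lerBrDr mulrC.
  rewrite !lebesgue_measure_itv/= !lte_fin ltr_pM2r ?invr_gt0// ltrD2r.
  case: ifPn => _; last by rewrite mule0.
  rewrite -!EFinB -EFinM; congr EFin.
  by field; rewrite gt_eqF.
have -> : \int[mu1]_x h x = \int[nu]_x h x.
  by apply: eq_measure_integral => A mA _; exact: lebesgue_measure_unique.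
rewrite ge0_integral_mscale//= muleA -EFinM mulVf ?gt_eqF// mul1e.
by rewrite ge0_integral_pushforward.
Qed.

Lemma plane_tonelli12 (h : R2 -> \bar R) : nnmeas h ->
  \int[plane_measure]_z h z = \int[mu1]_x \int[mu1]_y h (x, y).
Proof. by move=> [mh h0]; exact: fubini_tonelli1. Qed.

Lemma plane_tonelli21 (h : R2 -> \bar R) : nnmeas h ->
  \int[plane_measure]_z h z = \int[mu1]_y \int[mu1]_x h (x, y).
Proof. by move=> [mh h0]; exact: fubini_tonelli2. Qed.

Lemma measurable_linear_form (a b : R) :
  measurable_fun [set: R2] (fun z : R2 => (a * z.1 + b * z.2)%R : R1).
Proof.
by apply: measurable_funD; apply: measurable_funM.
Qed.

(** Elimination: integrate first in the first variable, which is replaced by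
    u = p x + q y, then in the second one, with
    p' x + q' y = (p' / p) u + (D / p) y, where D is the determinant. Two
    one-dimensional affine substitutions and Tonelli suffice. *)
Lemma ge0_integral_linear (p q p' q' : R) (h : R2 -> \bar R) :
  (0 < p)%R -> (0 < p * q' - q * p')%R -> nnmeas h ->
  \int[plane_measure]_z h (p * z.1 + q * z.2, p' * z.1 + q' * z.2)%R =
  ((p * q' - q * p')^-1)%:E * \int[plane_measure]_z h z.
Proof.
move=> p0 det0 nh; set D := (p * q' - q * p')%R in det0 *.
have pn0 : (p != 0)%R by rewrite gt_eqF.
have Dn0 : (D != 0)%R by rewrite gt_eqF.
have nhL : nnmeas
    (fun z : R2 => h (p * z.1 + q * z.2, p' * z.1 + q' * z.2)%R).
  by apply: (nnmeas_comp nh); apply: measurable_fun_pair;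
    exact: measurable_linear_form.
rewrite plane_tonelli21//=.
(* h in the variables (u, y) *)
pose h1 (z : R2) := h (z.1, p' / p * z.1 + D / p * z.2)%R.
have nh1 : nnmeas h1.
  apply: (nnmeas_comp nh); apply: measurable_fun_pair.
    exact: measurable_fst.
  exact: measurable_linear_form.
transitivity (\int[mu1]_y ((p^-1)%:E * \int[mu1]_x h1 (x, y))).
  apply: eq_integral => y _.
  have nh1y : nnmeas (fun x : R1 => h1 (x, y)).
    by apply: (nnmeas_comp nh1); exact: measurable_fun_pair.
  rewrite -(ge0_integral_affine (q * y) p0 nh1y).
  apply: eq_integral => x _; rewrite /h1/=; congr (h (_, _)).
  by rewrite /D; field.
have [mh1 h10] := nh1.
rewrite ge0_integralZl//; last 3 first.
- exact: (measurable_fun_fubini_tonelli_G (m1 := mu1) h1).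
- by move=> y _; exact: integral_ge0.
- by rewrite lee_fin invr_ge0 ltW.
rewrite -plane_tonelli21// plane_tonelli12//.
transitivity ((p^-1)%:E *
    \int[mu1]_x (((D / p)^-1)%:E * \int[mu1]_y h (x, y))).
  congr (_ * _); apply: eq_integral => x _.
  have nhx : nnmeas (fun y : R1 => h (x, y)).
    by apply: (nnmeas_comp nh); exact: measurable_fun_pair.
  rewrite -(ge0_integral_affine (p' / p * x) _ nhx) ?divr_gt0//.
  by apply: eq_integral => y _; rewrite /h1/= addrC.
have [mh h0] := nh.
rewrite ge0_integralZl//; last 3 first.
- exact: (measurable_fun_fubini_tonelli_F (m2 := mu1) h).
- by move=> y _; exact: integral_ge0.
- by rewrite lee_fin invr_ge0 divr_ge0 ?ltW.
rewrite -plane_tonelli12// muleA -EFinM; congr (_%:E * _).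
by field; rewrite pn0 Dn0.
Qed.

End LebesguePlane.

(** * Strong continuity of the semigroup *)

Section DilationContinuity.
Context {R : realType}.
Notation R1 := (measurableTypeR R).
Notation R2 := (R1 * R1)%type.
Notation mu1 := (@leb1 R).
Local Open Scope ereal_scope.

Let nn (f : R1 -> R) : measurable_fun [set: R1] f ->
  nnmeas (fun x : R1 => `|f x|%:E).
Proof.
move=> mf; split => [|x]; last by rewrite lee_fin.
by apply/measurable_EFinP; exact: measurableT_comp.
Qed.

Lemma measurable_dilation (c : R) (f : R1 -> R) :
  measurable_fun [set: R1] f -> measurable_fun [set: R1] (fun x : R1 => f (c * x)%R).
Proof. by move=> mf; apply: (measurableT_comp mf); exact: measurable_funM. Qed.

Lemma integral_dilation (c : R) (f : R1 -> R) : (0 < c)%R ->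
  measurable_fun [set: R1] f ->
  \int[mu1]_x `|f (c * x)%R|%:E = (c^-1)%:E * \int[mu1]_x `|f x|%:E.
Proof.
move=> c0 mf; rewrite -(ge0_integral_affine 0 c0 (nn mf)).
by apply: eq_integral => x _; rewrite addr0.
Qed.

Lemma le_integral_dist (f g h : R1 -> R) : measurable_fun [set: R1] f ->
  measurable_fun [set: R1] g -> measurable_fun [set: R1] h ->
  \int[mu1]_x `|f x - h x|%:E <=
  \int[mu1]_x `|f x - g x|%:E + \int[mu1]_x `|g x - h x|%:E.
Proof.
move=> mf mg mh; have [? ?] := nn (measurable_funB mf mg).
have [? ?] := nn (measurable_funB mg mh).
have [? ?] := nn (measurable_funB mf mh).
rewrite -ge0_integralD//; apply: ge0_le_integral => //.
  exact: emeasurable_funD.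
by move=> x _; rewrite -EFinD lee_fin ler_distD.
Qed.

(** The lower bound on c_ n, harmless for the limit, makes the dilations
    uniformly bounded on L1 and their supports uniformly bounded. *)
Definition dilation_continuous (h : R1 -> R) := forall (c_ : nat -> R) (c : R),
  (0 < c)%R -> (forall n, (c / 2 <= c_ n)%R) -> c_ n @[n --> \oo] --> c ->
  \int[mu1]_x `|h (c_ n * x)%R - h (c * x)%R|%:E @[n --> \oo] --> 0.

(** Dilations by c and by c_ n with c_ n >= c / 2 are bounded on L1 by 2 / c, so
    that the property passes to L1 limits. *)
Lemma dilation_continuous_closed (h : R1 -> R) : measurable_fun [set: R1] h ->
  (forall e : R, (0 < e)%R -> exists k : R1 -> R,
    [/\ measurable_fun [set: R1] k, dilation_continuous k &
        \int[mu1]_x `|h x - k x|%:E <= e%:E]) ->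
  dilation_continuous h.
Proof.
move=> mh approx c_ c c0 c_ge cc.
have cp n : (0 < c_ n)%R by apply: lt_le_trans (c_ge n); rewrite divr_gt0.
apply/ge0_cvge0P => [n|e e0].
  by apply: integral_ge0 => x _; rewrite lee_fin.
(* dilating by c_ n costs a factor at most 2 / c, dilating by c a factor 1 / c:
   together e / 3 + e / 6, which leaves e / 2 for k *)
have ec0 : (0 < e * c / 6)%R by rewrite divr_gt0// mulr_gt0.
have [k [mk /(_ c_ c c0 c_ge cc) kc hk]] := approx _ ec0.
have e20 : (0 < e / 2)%R by rewrite divr_gt0.
move/ge0_cvge0P : kc => /(_ _ _ e20).
have k0 n : 0 <= \int[mu1]_x `|k (c_ n * x)%R - k (c * x)%R|%:E.
  by apply: integral_ge0 => x _; rewrite lee_fin.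
move=> /(_ k0); apply: filterS => n kn.
have md a (f : R1 -> R) := @measurable_dilation a f.
apply: le_trans (le_integral_dist (md (c_ n) _ mh) (md (c_ n) _ mk) (md c _ mh)) _.
apply: (@le_trans _ _ ((e / 3)%:E + ((e / 2)%:E + (e / 6)%:E))); last first.
  by rewrite -!EFinD lee_fin; lra.
apply: leeD.
  rewrite (@integral_dilation (c_ n) (fun x => h x - k x)%R)//; last first.
    exact: measurable_funB.
  apply: (@le_trans _ _ (((c / 2)^-1)%:E * (e * c / 6)%:E)).
    apply: lee_pmul => //; first by rewrite lee_fin invr_ge0 ltW.
      by apply: integral_ge0 => x _; rewrite lee_fin.
    by rewrite lee_fin lef_pV2 ?posrE// divr_gt0.
  by rewrite -EFinM lee_fin le_eqVlt; apply/orP; left; apply/eqP; field;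
     rewrite gt_eqF.
apply: le_trans (le_integral_dist (md (c_ n) _ mk) (md c _ mk) (md c _ mh)) _.
apply: leeD => //.
under eq_integral do rewrite distrC.
rewrite (@integral_dilation c (fun x => h x - k x)%R)//; last first.
  exact: measurable_funB.
apply: (@le_trans _ _ ((c^-1)%:E * (e * c / 6)%:E)).
  by rewrite lee_wpmul2l// lee_fin invr_ge0 ltW.
rewrite -EFinM lee_fin le_eqVlt; apply/orP; left; apply/eqP; field.
by rewrite gt_eqF.
Qed.

(** Dominated convergence: all dilates vanish outside [- 2 M / c, 2 M / c]. *)
Lemma dilation_continuous_compact (k : R -> R) (M : R) : continuous k ->
  (0 <= M)%R -> (forall x, M <= `|x| -> k x = 0)%R ->
  dilation_continuous k.
Proof.
move=> ck M0 k0 c_ c c0 c_ge cc.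
have cp n : (0 < c_ n)%R by apply: lt_le_trans (c_ge n); rewrite divr_gt0.
have [B B0 kB] : exists2 B, (0 <= B)%R & forall x, (`|k x| <= B)%R.
  have MM : (- M <= M)%R by lra.
  have cnk : {within [set` `[- M, M]%R], continuous (fun x => `|k x|%R)}.
    by apply: continuous_subspaceT => x; apply: cvg_norm; exact: ck.
  have [b _ kb] := EVT_max MM cnk.
  exists `|k b|%R => // x; have [xM|Mx] := leP M `|x|%R; last first.
    by apply: kb; rewrite in_itv/= -ler_norml ltW.
  by rewrite k0// normr0.
pose L := (2 * M / c)%R; pose E : set R1 := [set` `[- L, L]%R].
have mE : measurable E by exact: measurable_itv.
have mk : measurable_fun [set: R1] k by exact: continuous_measurable_fun.
have mEi : measurable_fun [set: R1] (fun x : R1 => (2 * B * \1_E x)%:E : \bar R).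
  by apply/measurable_EFinP; apply: measurable_funM.
have iE : mu1.-integrable setT (fun x => (2 * B * \1_E x)%:E).
  apply/integrableP; split => //.
  under eq_integral do rewrite gee0_abs ?lee_fin ?mulr_ge0// EFinM.
  rewrite ge0_integralZl//; last 2 first.
  - by apply/measurable_EFinP.
  - by rewrite lee_fin mulr_ge0.
  rewrite integral_indic// setIT [leb1 _](lebesgue_measure_itv `[- L, L]%R)/=.
  by case: ifPn => _; rewrite -?EFinB ?mule0 ?ltry// -EFinM ltry.
have mdiff (a : R) : measurable_fun [set: R1]
    (fun x : R1 => (`|k (a * x)%R - k (c * x)%R|%:E : \bar R)).
  apply/measurable_EFinP; apply: measurableT_comp => //.
  by apply: measurable_funB; exact: measurable_dilation.
have [|||_ _] := @dominated_convergence _ _ _ mu1 setT measurableT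
  (fun n x => `|k (c_ n * x)%R - k (c * x)%R|%:E) (cst 0)
  (fun x => (2 * B * \1_E x)%:E) (fun n => mdiff (c_ n)) (measurable_cst _).
- apply: aeW => x _; apply: cvg_EFin; first exact: nearW.
  have c1 : `|k (c_ n * x)%R - k (c * x)%R|%R @[n --> \oo] -->
      `|k (c * x)%R - k (c * x)%R|%R.
    apply: cvg_norm; apply: cvgB; last exact: cvg_cst.
    apply: (continuous_cvg _ (ck _)); apply: cvgM => //; exact: cvg_cst.
  by rewrite subrr normr0 in c1.
- exact: iE.
- apply: aeW => x n _; rewrite gee0_abs ?lee_fin// indicE.
  have [_|] := boolP (x \in E).
    by rewrite mulr1 (le_trans (ler_normB _ _))// mulr_natl mulr2n lerD.
  rewrite notin_setE /E/= in_itv/= => /negP; rewrite -ler_norml -ltNge => Lx.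
  have H (a : R) : (c / 2 <= a)%R -> (M <= `|a * x|)%R.
    move=> ca; have a0 : (0 < a)%R by apply: lt_le_trans ca; rewrite divr_gt0.
    rewrite normrM (gtr0_norm a0).
    apply: (@le_trans _ _ (c / 2 * L)%R).
      rewrite /L le_eqVlt; apply/orP; left; apply/eqP; field.
      by rewrite gt_eqF.
    apply: ler_pM => //; first by rewrite divr_ge0// ltW.
      by rewrite /L divr_ge0 ?mulr_ge0// ltW.
    exact: ltW.
  rewrite !k0 ?subrr ?normr0 ?mulr0//; apply: H => //.
  by rewrite ler_pdivrMr// ler_peMr// ?ltW// ltr1n.
by rewrite integral0.
Qed.

(** A continuous cutoff rather than an indicator, so that the approximants of
    [L1_dilation_continuous] are continuous on the whole line. *)
Definition cutoff (N x : R) : R := (Num.max 0 (Num.min 1 (N + 1 - `|x|)))%R.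

Lemma cutoff_itv N x : (0 <= cutoff N x <= 1)%R.
Proof. by rewrite /cutoff le_max lexx/= ge_max ler01/= ge_min lexx. Qed.

Lemma continuous_cutoff N : continuous (cutoff N).
Proof.
have c1 : continuous (fun x : R => N + 1 - `|x|)%R.
  by move=> x; apply: cvgB; [exact: cvg_cst|apply: cvg_norm].
have c2 : continuous ((fun=> 1%R) \min (fun x : R => N + 1 - `|x|)%R : R -> R^o).
  by move=> x; apply: continuous_min; [exact: cvg_cst|exact: c1].
move=> x; have := @continuous_max R R (fun=> 0%R) _ x (cvg_cst _) (c2 x).
exact.
Qed.

Lemma cutoff0 N x : (N + 1 <= `|x|)%R -> cutoff N x = 0%R.
Proof.
move=> Nx; rewrite /cutoff max_l// ge_min; apply/orP; right.
by rewrite subr_le0.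
Qed.

Lemma cutoff1 N x : (`|x| <= N)%R -> cutoff N x = 1%R.
Proof.
by move=> Nx; rewrite /cutoff min_l ?max_r// lerBrDr addrC lerD2r.
Qed.

(** Continuous functions with compact support are dense in L1: first multiply
    by a cutoff, then approximate on the interval that supports the cutoff. *)
Lemma L1_dilation_continuous (h : R1 -> R) :
  mu1.-integrable setT (EFin \o h) -> dilation_continuous h.
Proof.
move=> ih; have mh : measurable_fun [set: R1] h.
  by apply/measurable_EFinP; case/integrableP : ih.
apply: dilation_continuous_closed => // e e0.
have mc N : measurable_fun [set: R1] (cutoff N).
  by apply: continuous_measurable_fun; exact: continuous_cutoff.
have e20 : (0 < e / 2)%R by rewrite divr_gt0.
have [N hN] : exists N : nat,
    \int[mu1]_x `|h x - h x * cutoff N%:R x|%:E <= (e / 2)%:E.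
  have mdiff n : measurable_fun [set: R1]
      (fun x : R1 => (`|h x - h x * cutoff n%:R x|%:E : \bar R)).
    apply/measurable_EFinP; apply: measurableT_comp => //.
    by apply: measurable_funB => //; exact: measurable_funM.
  have [|||_ _] := @dominated_convergence _ _ _ mu1 setT measurableT
    (fun n x => `|h x - h x * cutoff n%:R x|%:E) (cst 0)
    (abse \o (EFin \o h)) mdiff (measurable_cst _).
  - apply: aeW => x _; apply: cvg_near_cst.
    apply: filterS (nbhs_infty_ger `|x : R|) => n xn.
    by rewrite cutoff1// mulr1 subrr normr0.
  - exact: integrable_abse.
  - apply: aeW => x n _; rewrite gee0_abs ?lee_fin//=.
    rewrite -{1}[h x]mulr1 -mulrBr normrM ler_piMr//.
    have /andP[c0 c1] := cutoff_itv n%:R x.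
    by rewrite ger0_norm ?subr_ge0//; lra.
  rewrite integral0 => /ge0_cvge0P H.
  have [|N _ /(_ N (leqnn N))] := H _ _ e20; last by exists N.
  by move=> n; apply: integral_ge0 => x _; rewrite lee_fin.
pose M : R := (N%:R + 1)%R; pose E : set R1 := [set` `[- M, M]%R].
have M0 : (0 <= M)%R by rewrite addr_ge0.
have mE : measurable E by exact: measurable_itv.
have Efin : lebesgue_measure E < +oo.
  by rewrite lebesgue_measure_itv; case: ifPn => _; rewrite ?ltry// -EFinB ltry.
have ihE : (@lebesgue_measure R).-integrable E (EFin \o h).
  exact: integrableS ih.
have [g_ [gc _ gh]] := approximation_continuous_integrable mE Efin ihE.
have [n hg] : exists n, \int[mu1]_(x in E) `|h x - g_ n x|%:E <= (e / 2)%:E.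
  move/ge0_cvge0P : gh => H.
  have [|n _ /(_ n (leqnn n))] := H _ _ e20; last by exists n.
  by move=> n; apply: integral_ge0 => x _; rewrite abse_ge0.
have mg : measurable_fun [set: R1] (g_ n) by exact: continuous_measurable_fun.
exists (fun x => g_ n x * cutoff N%:R x)%R; split.
- exact: measurable_funM.
- apply: (@dilation_continuous_compact _ M) => //.
    by move=> x; apply: cvgM; [exact: gc|exact: continuous_cutoff].
  by move=> x Mx; rewrite cutoff0// mulr0.
have mhc : measurable_fun [set: R1] (fun x : R1 => h x * cutoff N%:R x)%R.
  exact: measurable_funM.
have mgc : measurable_fun [set: R1] (fun x : R1 => g_ n x * cutoff N%:R x)%R.
  exact: measurable_funM.
apply: le_trans (le_integral_dist mh mhc mgc) _.
rewrite [e in e%:E]splitr EFinD; apply: leeD => //.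
apply: le_trans hg; rewrite [leRHS]integral_mkcond.
have [mhg _] := nn (measurable_funB mh mg).
apply: ge0_le_integral => //.
- by apply/measurable_EFinP; apply: measurableT_comp => //; exact: measurable_funB.
- exact/(measurable_restrictT _ mE)/measurable_funTS.
- move=> x _; rewrite patchE -mulrBl normrM; case: ifPn => xE.
    rewrite lee_fin ler_piMr//; have /andP[c0 c1] := cutoff_itv N%:R x.
    by rewrite ger0_norm.
  rewrite cutoff0 ?normr0 ?mulr0//; move: xE; rewrite notin_setE /E/= in_itv/=.
  by move=> /negP; rewrite -ler_norml -ltNge => /ltW.
Qed.

End DilationContinuity.

Section PlaneDilation.
Context {R : realType}.
Notation R1 := (measurableTypeR R).
Notation R2 := (R1 * R1)%type.
Notation mu1 := (@leb1 R).
Notation mu2 := (@plane_measure R).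
Local Open Scope ereal_scope.

(** On almost every line z.1 = x the one-dimensional result applies; the norms
    on lines are dominated by a multiple of those of k. *)
Lemma plane_dilation_continuous (k : R2 -> R) (c_ : nat -> R) (c : R) :
  measurable_fun [set: R2] k -> (forall z, (0 <= k z)%R) ->
  \int[mu2]_z (k z)%:E < +oo ->
  (0 < c)%R -> (forall n, (c / 2 <= c_ n)%R) -> c_ n @[n --> \oo] --> c ->
  \int[mu2]_z `|k (z.1, c_ n * z.2)%R - k (z.1, c * z.2)%R|%:E @[n --> \oo]
    --> 0.
Proof.
move=> mk k0 ik c0 c_ge cc.
have cp n : (0 < c_ n)%R by apply: lt_le_trans (c_ge n); rewrite divr_gt0.
have nk : nnmeas (fun z => (k z)%:E).
  by split => [|z]; [exact/measurable_EFinP|rewrite lee_fin].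
have msl (x : R1) : measurable_fun [set: R1] (fun y : R1 => k (x, y)).
  by apply: (measurableT_comp mk); exact: measurable_fun_pair.
pose diff n (z : R2) : \bar R :=
  `|k (z.1, c_ n * z.2)%R - k (z.1, c * z.2)%R|%:E.
have mkd (a : R) : measurable_fun [set: R2]
    (fun z : R2 => k (z.1, a * z.2)%R).
  apply: (measurableT_comp mk); apply: measurable_fun_pair => //.
  exact: measurable_funM.
have nd n : nnmeas (diff n).
  split => [|z]; last by rewrite lee_fin.
  apply/measurable_EFinP; apply: measurableT_comp => //.
  exact: measurable_funB.
pose phi n (x : R1) := \int[mu1]_y diff n (x, y).
have mphi n : measurable_fun [set: R1] (phi n).
  have [md d0] := nd n.
  exact: (measurable_fun_fubini_tonelli_F (m2 := mu1) (diff n)).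
pose psi (x : R1) := (c^-1 * 3)%:E * \int[mu1]_y (k (x, y))%:E.
have mpsi0 : measurable_fun [set: R1] (fun x : R1 => \int[mu1]_y (k (x, y))%:E).
  have [? ?] := nk.
  exact: (measurable_fun_fubini_tonelli_F (m2 := mu1) (fun z => (k z)%:E)).
have ci : (0 <= c^-1 * 3)%R by rewrite mulr_ge0// invr_ge0 ltW.
have psi0 x : 0 <= \int[mu1]_y (k (x, y))%:E.
  by apply: integral_ge0 => y _; rewrite lee_fin.
have ipsi : mu1.-integrable setT psi.
  apply/integrableP; split; first exact: measurable_funeM.
  under eq_integral do rewrite gee0_abs ?mule_ge0 ?lee_fin//.
  rewrite ge0_integralZl ?lee_fin//.
  by rewrite -(plane_tonelli12 nk) lte_mul_pinfty ?lee_fin.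
have kfin : {ae mu1, forall x : R1,
    mu1.-integrable setT (fun y : R1 => (k (x, y))%:E)}.
  have ikk : ((@leb1 R) \x (@leb1 R)).-integrable setT (fun z => (k z)%:E).
    apply/integrableP; split; first by case: nk.
    by under eq_integral do rewrite gee0_abs ?lee_fin//.
  exact: (ae_integrable1 ikk).
rewrite [X in X @ _ --> _](_ : _ = fun n => \int[mu1]_x phi n x); last first.
  by apply/funext => n; rewrite -(plane_tonelli12 (nd n)).
have phi0 n x : 0 <= phi n x by apply: integral_ge0 => y _; case: (nd n).
have [|||_ _] := @dominated_convergence _ _ _ mu1 setT measurableT
  phi (cst 0) psi mphi (measurable_cst _).
- apply: filterS kfin => x ix _.
  exact: (@L1_dilation_continuous _ (fun y => k (x, y)) ix c_ c).
- exact: ipsi.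
- apply: aeW => x n _; rewrite gee0_abs//.
  have mx := msl x.
  have md (a : R) := @measurable_dilation _ a _ mx.
  have mE (a : R) : measurable_fun [set: R1] (fun y : R1 => `|k (x, a * y)%R|%:E).
    by apply/measurable_EFinP; apply: measurableT_comp => //; exact: md.
  apply: (@le_trans _ _ (\int[mu1]_y `|k (x, c_ n * y)%R|%:E +
      \int[mu1]_y `|k (x, c * y)%R|%:E)).
    rewrite -ge0_integralD//.
    have [? ?] := nnmeas_timeslice x (nd n).
    apply: ge0_le_integral => //; first exact: emeasurable_funD.
    by move=> y _; rewrite /diff/= -EFinD lee_fin ler_normB.
  rewrite (integral_dilation (cp n) mx) (integral_dilation c0 mx).
  rewrite -ge0_muleDl ?lee_fin ?invr_ge0 ?(ltW c0) ?(ltW (cp n))//.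
  rewrite /psi; under eq_integral do rewrite ger0_norm//.
  rewrite -EFinD; apply: lee_wpmul2r => //; rewrite lee_fin.
  apply: (@le_trans _ _ ((c / 2)^-1 + c^-1)%R).
    by rewrite lerD2r lef_pV2 ?posrE// divr_gt0.
  by rewrite invf_div; lra.
by rewrite integral0.
Qed.

End PlaneDilation.

Section CollisionFlow.
Context {R : realType}.
Notation R1 := (measurableTypeR R).
Notation R2 := (R1 * R1)%type.
Notation mu1 := (@leb1 R).
Notation mu2 := (@plane_measure R).
Variable gamma : R.

Lemma PhiE (t : R) (z : R2) :
  Phi t z = (1 + expR (- t)) / 2 * z.1 + (1 - expR (- t)) / 2 * z.2.
Proof. by rewrite /Phi; field. Qed.

Lemma Phi_starE (t : R) (z : R2) :
  Phi_star t z = (1 - expR (- t)) / 2 * z.1 + (1 + expR (- t)) / 2 * z.2.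
Proof. by rewrite /Phi_star; field. Qed.

Definition flow (t : R) (z : R2) : R2 := (Phi t z, Phi_star t z).

Lemma flowD (s t : R) (z : R2) : flow s (flow t z) = flow (s + t) z.
Proof.
have E : expR (- (s + t)) = expR (- s) * expR (- t) by rewrite opprD expRD.
rewrite /flow /Phi /Phi_star/= E.
by congr (_, _); field.
Qed.

Lemma measurable_flow (u : R -> R) : measurable_fun [set: R1] u ->
  measurable_fun [set: R2 * R1] (fun p : R2 * R1 => flow (u p.2) p.1).
Proof.
move=> mu.
have me : measurable_fun [set: R2 * R1] (fun p : R2 * R1 => expR (- u p.2)).
  apply: measurableT_comp => //; apply: measurableT_comp => //.
  exact: (measurableT_comp mu).
have m1 : measurable_fun [set: R2 * R1] (fun p : R2 * R1 => p.1.1 : R).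
  by apply: (measurableT_comp measurable_fst).
have m2 : measurable_fun [set: R2 * R1] (fun p : R2 * R1 => p.1.2 : R).
  by apply: (measurableT_comp measurable_snd).
apply: measurable_fun_pair; rewrite /Phi /Phi_star.
  apply: measurable_funD; first by apply: measurable_funM => //; exact: measurable_funD.
  by apply: measurable_funM => //; apply: measurable_funM => //; exact: measurable_funB.
apply: measurable_funD; first by apply: measurable_funM => //; exact: measurable_funD.
by apply: measurable_funM => //; apply: measurable_funM => //; exact: measurable_funB.
Qed.

(** The flow preserves z.1 + z.2 and multiplies z.1 - z.2 by exp(-t), hence its
    determinant is exp(-t). *)
Lemma integral_flow (t : R) (h : R2 -> \bar R) : nnmeas h ->
  (\int[mu2]_z h (flow t z) = (expR t)%:E * \int[mu2]_z h z)%E.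
Proof.
move=> nh; set r := expR (- t).
have r0 : 0 < r by exact: expR_gt0.
have D : (1 + r) / 2 * ((1 + r) / 2) - (1 - r) / 2 * ((1 - r) / 2) = r.
  by field.
have := @ge0_integral_linear _ ((1 + r) / 2) ((1 - r) / 2) ((1 - r) / 2)
  ((1 + r) / 2) h.
rewrite D => H; rewrite -[expR t]invrK -expRN -/r -H//; last first.
  by rewrite divr_gt0// addr_gt0.
by apply: eq_integral => z _; rewrite /flow PhiE Phi_starE.
Qed.

(** For [sigma = 1] this is the semigroup S, for [sigma = -1] its inverse. *)
Program Definition collision_flow (sigma : R) : wflow mu2 := {|
  weight := fun t => expR ((1 - gamma) * (sigma * t));
  transport := fun t => flow (- (sigma * t));
  gain := fun t => expR (- gamma * (sigma * t)) |}.
Next Obligation. by move=> *; exact: expR_gt0. Qed.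
Next Obligation. by move=> *; exact: expR_gt0. Qed.
Next Obligation.
move=> sigma; apply: measurableT_comp => //.
by apply: measurable_funM => //; exact: measurable_funM.
Qed.
Next Obligation.
move=> sigma; apply: measurableT_comp => //.
by apply: measurable_funM => //; exact: measurable_funM.
Qed.
Next Obligation.
move=> sigma; apply: (@measurable_flow (fun t => - (sigma * t))).
by apply: measurableT_comp => //; exact: measurable_funM.
Qed.
Next Obligation.
move=> sigma t h mh h0.
rewrite ge0_integralZl//; last first.
  apply: (measurableT_comp mh).
  apply: (measurableT_comp (@measurable_flow (fun=> - (sigma * t)) _)
    (g := fun z => (z, t))) => //.
rewrite integral_flow// muleA -EFinM -expRD.
by congr ((expR _)%:E * _)%E; ring.
Qed.

End CollisionFlow.

Section CollisionContinuity.
Context {R : realType}.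
Notation R1 := (measurableTypeR R).
Notation R2 := (R1 * R1)%type.
Notation mu1 := (@leb1 R).
Notation mu2 := (@plane_measure R).
Local Open Scope ereal_scope.

Lemma cvg0_sequential (f : R -> \bar R) (t : R) :
  (forall s, 0 <= f s) -> (forall s, f s < +oo) ->
  (forall u : nat -> R, u n @[n --> \oo] --> t -> f (u n) @[n --> \oo] --> 0) ->
  f s @[s --> t] --> 0.
Proof.
move=> f0 fy fu; apply: cvg_EFin.
  by apply: nearW => s; rewrite ge0_fin_numE.
apply/(@cvg_nbhsP R R^o) => u ut.
by have /fine_cvgP[_] := fu u ut.
Qed.

(** In the coordinates (a, b), with z = (a - b, a + b), the flow is a dilation
    in b. The sign of b makes the change of coordinates have determinant 2. *)
Lemma flow_diagonal (t a b : R) :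
  flow (- t) ((1 * a + -1 * b)%R, (1 * a + 1 * b)%R) =
  ((1 * a + -1 * (expR t * b))%R, (1 * a + 1 * (expR t * b))%R) :> R2.
Proof. by rewrite /flow PhiE Phi_starE/= opprK; congr (_, _); field. Qed.

(** In diagonal coordinates this is [plane_dilation_continuous]. *)
Lemma flow_continuous (k : R2 -> R) (t : R) :
  measurable_fun setT k -> (forall z, (0 <= k z)%R) ->
  \int[mu2]_z (k z)%:E < +oo ->
  \int[mu2]_z `|k (flow (- s) z) - k (flow (- t) z)|%:E @[s --> t] --> 0.
Proof.
move=> mk k0 ik.
have nk : nnmeas (fun z => (k z)%:E).
  by split => [|z]; [exact/measurable_EFinP|rewrite lee_fin].
have mfl (s : R) : measurable_fun [set: R2] (fun z : R2 => k (flow (- s) z)).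
  apply: (measurableT_comp mk).
  apply: (measurableT_comp (@measurable_flow _ (fun=> - s)%R _)
    (g := fun z : R2 => (z, s))) => //.
have mE (s : R) : measurable_fun [set: R2] (fun z : R2 => (k (flow (- s) z))%:E).
  exact/measurable_EFinP.
have md (s r : R) : measurable_fun [set: R2]
    (fun z : R2 => `|k (flow (- s) z) - k (flow (- r) z)|%:E).
  apply/measurable_EFinP; apply: measurableT_comp => //.
  exact: measurable_funB.
apply: cvg0_sequential.
- by move=> s; apply: integral_ge0 => z _; rewrite lee_fin.
- move=> s; apply: (@le_lt_trans _ _ (\int[mu2]_z (k (flow (- s) z))%:E +
    \int[mu2]_z (k (flow (- t) z))%:E)).
    rewrite -ge0_integralD//; try by move=> z _; rewrite lee_fin.
    apply: ge0_le_integral => //; first exact: emeasurable_funD.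
    move=> z _; rewrite -EFinD lee_fin (le_trans (ler_normB _ _))//.
    by rewrite !ger0_norm.
  by rewrite !(integral_flow _ nk) -ge0_muleDl ?lee_fin ?expR_ge0//
    -EFinD lte_mul_pinfty// lee_fin addr_ge0 ?expR_ge0.
move=> u ut.
pose kappa (z : R2) := k ((1 * z.1 + -1 * z.2)%R, (1 * z.1 + 1 * z.2)%R).
have mkappa : measurable_fun [set: R2] kappa.
  apply: (measurableT_comp mk); apply: measurable_fun_pair;
  exact: measurable_linear_form.
have det : (1 * 1 - -1 * 1 = 2 :> R)%R by ring.
have ikappa : \int[mu2]_z (kappa z)%:E < +oo.
  rewrite (@ge0_integral_linear _ 1 (-1) 1 1 (fun z => (k z)%:E))//.
    by rewrite lte_mul_pinfty// ?lee_fin ?invr_ge0 ?det.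
(* the maximum with c / 2 does not change the sequence from some rank on *)
pose c := expR t; pose c_ n := Num.max (expR (u n)) (c / 2)%R.
have c0 : (0 < c)%R by exact: expR_gt0.
have cc0 : expR (u n) @[n --> \oo] --> c.
  by apply: continuous_cvg => //; exact: continuous_expR.
have c_E : \forall n \near \oo, c_ n = expR (u n).
  have /cvgrPdist_le/(_ (c / 2)%R) := cc0.
  rewrite divr_gt0// => /(_ isT); apply: filterS => n; rewrite ler_distl.
  move=> /andP[_ cn]; rewrite /c_ max_l//; lra.
have cc : c_ n @[n --> \oo] --> c.
  apply: cvg_trans cc0; apply: near_eq_cvg.
  by apply: filterS c_E => n ->.
have cge n : (c / 2 <= c_ n)%R by rewrite le_max lexx orbT.
have K := plane_dilation_continuous mkappa (fun z => k0 _) ikappa c0 cge cc.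
have : 2%:E * \int[mu2]_z
    `|kappa (z.1, c_ n * z.2)%R - kappa (z.1, c * z.2)%R|%:E @[n --> \oo] --> 0.
  by rewrite -[X in _ --> X](mule0 2%:E); exact: cvgeZl K.
apply: cvg_trans; apply: near_eq_cvg; apply: filterS c_E => n ->.
have nd : nnmeas (fun z : R2 => `|k (flow (- u n) z) - k (flow (- t) z)|%:E).
  by split => // z; rewrite lee_fin.
have := @ge0_integral_linear _ 1 (-1) 1 1 _ ltr01 _ nd.
rewrite det => /(_ (ltr0Sn _ _)) E.
transitivity (2%:E * (2^-1%:E * \int[mu2]_z
    `|k (flow (- u n) z) - k (flow (- t) z)|%:E)).
  rewrite -E; congr (_ * _); apply: eq_integral => z _.
  by rewrite !flow_diagonal.
by rewrite muleA -EFinM mulfV// mul1e.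
Qed.

(** The exponential weight is split off:
    w(s) k_s - w(t) k_t = (w(s) - w(t)) k_s + w(t) (k_s - k_t). *)
Lemma collision_flow_continuous (gamma t : R) :
  L1_strongly_continuous (collision_flow gamma 1) t.
Proof.
move=> k mk k0 ik; suff : \int[mu2]_z `|expR ((1 - gamma) * (1 * s)) * k (flow (- (1 * s)) z) -
    expR ((1 - gamma) * (1 * t)) * k (flow (- (1 * t)) z)|%:E @[s --> t] --> 0.
  exact: cvg_within_filter.
have nk : nnmeas (fun z => (k z)%:E).
  by split => [|z]; [exact/measurable_EFinP|rewrite lee_fin].
pose w (s : R) := expR ((1 - gamma) * (1 * s))%R.
pose m := fine (\int[mu2]_z (k z)%:E).
have mE : m%:E = \int[mu2]_z (k z)%:E.
  by rewrite fineK// ge0_fin_numE// integral_ge0// => z _; rewrite lee_fin.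
pose H (s : R) := \int[mu2]_z `|k (flow (- s) z) - k (flow (- t) z)|%:E.
have mfl (s : R) : measurable_fun [set: R2] (fun z : R2 => k (flow (- s) z)).
  apply: (measurableT_comp mk).
  apply: (measurableT_comp (@measurable_flow _ (fun=> - s)%R _)
    (g := fun z : R2 => (z, s))) => //.
have H0 s : 0 <= H s by apply: integral_ge0 => z _; rewrite lee_fin.
apply: (@squeeze_cvg0 R R (nbhs t) _ _
  (fun s => (`|w s - w t| * (expR (- s) * m))%:E + (w t)%:E * H s)).
  apply: nearW => s; apply/andP; split.
    by apply: integral_ge0 => z _; rewrite lee_fin.
  rewrite EFinM EFinM mE -(integral_flow _ nk) /H.
  have mEs : measurable_fun [set: R2] (fun z : R2 => (k (flow (- s) z))%:E).
    exact/measurable_EFinP.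
  have md : measurable_fun [set: R2]
      (fun z : R2 => `|k (flow (- s) z) - k (flow (- t) z)|%:E).
    apply/measurable_EFinP; apply: measurableT_comp => //.
    exact: measurable_funB.
  have -> : \int[mu2]_x `|w s * k (flow (- (1 * s)) x) -
       w t * k (flow (- (1 * t)) x)|%:E =
      \int[mu2]_x `|w s * k (flow (- s) x) - w t * k (flow (- t) x)|%:E.
    by rewrite !mul1r.
  rewrite -ge0_integralZl//; last by move=> z _; rewrite lee_fin.
  rewrite -ge0_integralZl// ?lee_fin ?expR_ge0//.
  rewrite -ge0_integralD//; last 4 first.
  + by move=> z _; rewrite mule_ge0// lee_fin.
  + exact: measurable_funeM.
  + by move=> z _; rewrite mule_ge0// lee_fin ?expR_ge0.
  + exact: measurable_funeM.
  apply: ge0_le_integral => //.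
  + apply/measurable_EFinP; apply: measurableT_comp => //.
    by apply: measurable_funB; exact: measurable_funM.
  + by apply: emeasurable_funD; exact: measurable_funeM.
  move=> z _; rewrite -!EFinM -EFinD lee_fin.
  apply: (le_trans (ler_distD (w t * k (flow (- s) z))%R _ _)).
  rewrite -mulrBl normrM (ger0_norm (k0 _)) lerD2l -mulrBr normrM.
  by rewrite (gtr0_norm (expR_gt0 _)).
have c1 : (`|w s - w t| * (expR (- s) * m))%R @[s --> t] -->
    (`|w t - w t| * (expR (- t) * m))%R.
  apply: cvgM.
    apply: cvg_norm; apply: cvgB; last exact: cvg_cst.
    apply: continuous_cvg; first exact: continuous_expR.
    apply: cvgM; first exact: cvg_cst.
    by apply: cvgM; [exact: cvg_cst|exact: cvg_id].
  apply: cvgM; last exact: cvg_cst.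
  apply: continuous_cvg; first exact: continuous_expR.
  by apply: cvgN; exact: cvg_id.
rewrite subrr normr0 mul0r in c1.
have c2 : (`|w s - w t| * (expR (- s) * m))%:E @[s --> t] --> 0%:E.
  by apply: cvg_EFin; first exact: nearW.
have c3 : (w t)%:E * H s @[s --> t] --> (w t)%:E * 0.
  by apply: cvgeZl => //; exact: flow_continuous.
have c4 := cvgeD (isT : (0%:E : \bar R) +? ((w t)%:E * 0)) c2 c3.
by rewrite mule0 adde0 in c4; exact: (c4 _).
Qed.

End CollisionContinuity.

(** * The mass system *)

Section OneSidedDerivative.
Context {R : realType}.
Implicit Types (M : R -> R) (t l : R).

Lemma has_derivative_ge0_dist M t l : has_derivative_ge0 M t l ->
  forall e : R, 0 < e -> \forall h \near 0, h != 0 -> 0 <= t + h ->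
    `|l - h^-1 * (M (t + h) - M t)| <= e.
Proof.
move=> /cvgrPdist_le H e e0; have := H e e0.
exact.
Qed.

Lemma has_derivative_ge0_continuous M t l : has_derivative_ge0 M t l ->
  M s @[s --> within `[0, +oo[ (nbhs t)] --> M t.
Proof.
move=> /has_derivative_ge0_dist/(_ 1 ltr01) H.
apply/cvgrPdist_le => /= e e0.
have c0 : 0 < `|l| + 1 by rewrite ltr_wpDl.
have d0 : 0 < e / (`|l| + 1) by rewrite divr_gt0.
have small : \forall h \near (0 : R), `|h| <= e / (`|l| + 1).
  apply: filterS (nbhs0_le d0) => h; exact.
have : \forall h \near (0 : R), 0 <= t + h -> `|M t - M (t + h)| <= e.
  apply: filterS2 H small => h Hh hs th.
  have [->|h0] := eqVneq h 0; first by rewrite addr0 subrr normr0 ltW.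
  have {Hh} := Hh h0 th; set D := _ * _ => lD.
  have DM : M (t + h) - M t = h * D by rewrite /D mulrA mulfV// mul1r.
  rewrite distrC DM normrM.
  have Dl : `|D| <= `|l| + 1.
    rewrite -[D](subKr l) (le_trans (ler_normB _ _))// lerD2l//.
  apply: (le_trans (ler_pM _ _ hs Dl)) => //.
  by rewrite divfK// gt_eqF.
move=> near0; rewrite /within /=.
have : \forall s \near t, 0 <= t + (s - t) -> `|M t - M (t + (s - t))| <= e.
  have : s - t @[s --> t] --> t - t by apply: cvgB; [exact: cvg_id|exact: cvg_cst].
  by rewrite subrr => /(_ _ near0).
by apply: filterS => s; rewrite subrKC in_itv/= andbT.
Qed.

Lemma has_derivative_ge0_is_derive M t l : 0 < t -> has_derivative_ge0 M t l ->
  is_derive t 1 M l.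
Proof.
move=> t0 /has_derivative_ge0_dist H.
have cv : h^-1 *: ((M \o shift t) (h *: 1) - M t) @[h --> 0^'] --> l.
  apply/cvgrPdist_le => /= e e0; rewrite /dnbhs /within/=.
  have pos : \forall h \near (0 : R), 0 <= t + h.
    apply: filterS (nbhs0_le t0) => h.
    by rewrite ler_norml => /andP[h1 _]; lra.
  apply: filterS2 pos (H _ e0) => h th Hh h0.
  by have := Hh h0 th; rewrite /shift/= [h *: 1]mulr1 (addrC h).
by apply: DeriveDef; [exact: cvgP cv|exact: cvg_lim cv].
Qed.

(** Replacing M by its value at 0 on negative times keeps the one-sided
    derivatives and makes M continuous on the whole line, so that the theorems
    on two-sided limits apply up to the time 0. *)
Definition clamp M (t : R) : R := M (Num.max 0 t).

Lemma clampE M t : 0 <= t -> clamp M t = M t.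
Proof. by move=> t0; rewrite /clamp max_r. Qed.

Lemma continuous_max0 : continuous (fun t : R => Num.max 0 t).
Proof.
move=> x; have := @continuous_max R R (fun=> 0) (fun t => t) x.
by apply; [exact: cvg_cst|exact: cvg_id].
Qed.

Lemma clamp_continuous M :
  (forall t, 0 <= t -> M s @[s --> within `[0, +oo[ (nbhs t)] --> M t) ->
  continuous (clamp M).
Proof.
move=> H x; apply/cvgrPdist_le => /= e e0.
have mx0 y : 0 <= Num.max 0 y :> R by rewrite le_max lexx.
have /cvgrPdist_le/(_ e e0) := H _ (mx0 x).
rewrite /within/= => near0; have nearx := continuous_max0 near0.
apply: (@filterS _ _ (@nbhs_filter _ x) _ _ _ nearx) => y /=.
by apply; rewrite in_itv/= andbT.
Qed.

Lemma has_derivative_ge0_clamp (M : R -> R) (t l : R) : 0 <= t ->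
  has_derivative_ge0 M t l -> has_derivative_ge0 (clamp M) t l.
Proof.
move=> t0 H; rewrite /has_derivative_ge0; apply: cvg_trans H.
apply: near_eq_cvg.
apply: (filterS _ (@withinT _ 0^' [set h : R | 0 <= t + h] _)) => h /= th.
by rewrite !clampE.
Qed.

Lemma FTC_ge0 (F f : R -> R) (t : R) : 0 <= t ->
  {in `[0, t], continuous F} -> {in `[0, t], continuous f} ->
  (forall x, 0 < x < t -> is_derive x 1 F (f x)) ->
  (\int[@leb1 R]_(s in `[0%R, t]) (f s)%:E = (F t - F 0)%:E)%E.
Proof.
rewrite le_eqVlt => /predU1P[<- _ _ _|t0 cF cf dF].
  by rewrite set_itv1 integral_set1 subrr.
rewrite EFinB; apply: (continuous_FTC2 t0).
- apply: continuous_in_subspaceT => x; rewrite inE => xt; exact: cf.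
- split.
  + move=> x; rewrite in_itv/= => xt; have [] := dF _ xt; exact.
  + by apply: cvg_at_right_filter; apply: cF; rewrite in_itv/= lexx ltW.
  + by apply: cvg_at_left_filter; apply: cF; rewrite in_itv/= lexx ltW.
- move=> x; rewrite in_itv/= => xt; rewrite derive1E.
  have [_ DF] := dF _ xt; exact: DF.
Qed.

End OneSidedDerivative.

Section MassSystem.
Context {R : realType}.
Variables (lambda gamma : R) (Mf Mg : R -> R).
Hypotheses (lambda_gt0 : 0 < lambda) (gamma_gt0 : 0 < gamma).
Hypothesis system : mass_system lambda gamma Mf Mg.

Let mf := clamp Mf.
Let mg := clamp Mg.

Lemma continuous_clamp_Mf : continuous mf.
Proof.
apply: clamp_continuous => t t0.
by have [/has_derivative_ge0_continuous] := system t0.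
Qed.

Lemma continuous_clamp_Mg : continuous mg.
Proof.
apply: clamp_continuous => t t0.
by have [_ /has_derivative_ge0_continuous] := system t0.
Qed.

Lemma is_derive_clamp_Mf (t : R) : 0 < t ->
  is_derive t 1 mf (2 * gamma * mg t - 2 * lambda * mf t ^+ 2).
Proof.
move=> t0; have [Hf _] := system (ltW t0).
apply: has_derivative_ge0_is_derive => //.
by rewrite /mf /mg !(clampE _ (ltW t0)); apply: has_derivative_ge0_clamp; first exact: ltW.
Qed.

Lemma is_derive_clamp_Mg (t : R) : 0 < t ->
  is_derive t 1 mg (lambda * mf t ^+ 2 - gamma * mg t).
Proof.
move=> t0; have [_ Hg] := system (ltW t0).
apply: has_derivative_ge0_is_derive => //.
by rewrite /mf /mg !(clampE _ (ltW t0)); apply: has_derivative_ge0_clamp; first exact: ltW.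
Qed.

(** A primitive from -1, in order to be differentiable at 0 on both sides. *)
Let Q (x : R) : R := \int[@lebesgue_measure R]_(s in `[-1, x]) mf s.

Lemma integrable_clamp_Mf (a b : R) :
  (@lebesgue_measure R).-integrable `[a, b] (EFin \o mf).
Proof.
apply: continuous_compact_integrable; first exact: segment_compact.
by apply: continuous_subspaceT => x; exact: continuous_clamp_Mf.
Qed.

Lemma is_derive_Q (x : R) : -1 < x -> is_derive x 1 Q (mf x).
Proof.
move=> x1.
have [dQ QE] := continuous_FTC1_closed (ltr_pwDr ltr01 (lexx x))
  (integrable_clamp_Mf (-1) (x + 1)) x1 (@continuous_clamp_Mf x).
by apply: DeriveDef; [exact: dQ|rewrite -derive1E QE].
Qed.

Lemma Rintegral_Mf (s t : R) : 0 <= s -> s <= t ->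
  \int[@leb1 R]_(r in `[s, t]) Mf r = Q t - Q s.
Proof.
move=> s0 st.
have s1 : -1 <= s by apply: le_trans s0; rewrite lerN10.
rewrite (Rintegral_itvB (integrable_clamp_Mf (-1) t)) ?bnd_simp//.
rewrite Rintegral_itv_obnd_cbnd; last first.
  apply: integrableS (integrable_clamp_Mf s t) => //.
  exact: subset_itv_oc_cc.
apply: eq_Rintegral => r; rewrite inE/= in_itv/= => /andP[sr _].
by rewrite /mf clampE// (le_trans s0).
Qed.

(** The damping from time 0 to t; the damping from s to t is
    [decay t / decay s]. *)
Definition decay (t : R) : R :=
  expR (- (2 * lambda * (Q (Num.max 0 t) - Q 0))).

Lemma damping_decay (s t : R) : 0 <= s <= t ->
  damping lambda Mf s t = decay t / decay s.
Proof.
move=> /andP[s0 st]; rewrite /damping Rintegral_Mf// /decay -expRN -expRD.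
rewrite !max_r// ?(le_trans s0)//.
by congr expR; ring.
Qed.

Lemma decay0 : decay 0 = 1.
Proof. by rewrite /decay max_r// subrr mulr0 oppr0 expR0. Qed.

Lemma decay_gt0 t : 0 < decay t. Proof. exact: expR_gt0. Qed.

Lemma continuous_decay : continuous decay.
Proof.
move=> x; have m0 : -1 < Num.max 0 x by rewrite lt_max ltrN10.
have cQ : {for Num.max 0 x, continuous Q}.
  apply: differentiable_continuous; apply/derivable1_diffP.
  by have [] := is_derive_Q m0.
have cQm : {for x, continuous (Q \o (fun t => Num.max 0 t))}.
  by apply: continuous_comp; [exact: continuous_max0|exact: cQ].
apply: continuous_cvg; first exact: continuous_expR.
apply: cvgN; apply: cvgM; first exact: cvg_cst.
by apply: cvgB; [exact: cQm|exact: cvg_cst].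
Qed.

Let IF (t : R) : R := expR (2 * lambda * (Q t - Q 0)).

Let IFE t : 0 <= t -> IF t = (decay t)^-1.
Proof. by move=> t0; rewrite /IF /decay max_r// expRN invrK. Qed.

Let is_derive_IF (t : R) : -1 < t ->
  is_derive t 1 IF (IF t * (2 * lambda * mf t)).
Proof.
move=> t1; apply: is_derive1_comp; have dQ := is_derive_Q t1.
have d := is_deriveB dQ (is_derive_cst (Q 0) t 1).
have := is_deriveZ (2 * lambda) d.
by rewrite subr0.
Qed.

(** The integrating factor turns the derivative of M_f / decay into
    2 gamma M_g / decay. *)
Lemma mass_f_mild (t : R) : 0 <= t ->
  ((Mf t)%:E = (decay t)%:E * ((Mf 0)%:E +
   \int[@leb1 R]_(s in `[0%R, t]) ((decay s)^-1 * (2 * gamma * Mg s))%:E))%E.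
Proof.
move=> t0.
have cIF (x : R) : 0 <= x -> {for x, continuous IF}.
  move=> x0; apply: differentiable_continuous; apply/derivable1_diffP.
  by have [] := is_derive_IF (lt_le_trans (ltrN10 R) x0).
rewrite (_ : (\int[_]_(s in _) _)%E = (mf t * IF t - mf 0 * IF 0)%:E).
  rewrite /mf !clampE// !IFE// decay0 -EFinD -EFinM; congr EFin.
  by rewrite invr1 mulr1 addrC subrK mulrC -mulrA mulVf ?mulr1// gt_eqF// decay_gt0.
transitivity (\int[@leb1 R]_(s in `[0%R, t])
    (IF s * (2 * gamma * mg s))%:E)%E.
  apply: eq_integral => s; rewrite inE/= in_itv/= => /andP[s0 _].
  by rewrite /mg clampE// IFE.
apply: (@FTC_ge0 _ (fun s => mf s * IF s)) => //.
- move=> x; rewrite in_itv/= => /andP[x0 _].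
  by apply: cvgM; [exact: continuous_clamp_Mf|exact: cIF].
- move=> x; rewrite in_itv/= => /andP[x0 _].
  apply: cvgM; first exact: cIF.
  by apply: cvgM; [exact: cvg_cst|exact: continuous_clamp_Mg].
- move=> x /andP[x0 _].
  apply: (is_derive_eq (is_deriveM (is_derive_clamp_Mf x0)
    (is_derive_IF (lt_trans (ltrN10 R) x0)))).
  rewrite /GRing.scale/=; ring.
Qed.

Lemma mass_g_mild (t : R) : 0 <= t ->
  ((Mg t)%:E = (expR (- gamma * t))%:E * ((Mg 0)%:E +
   \int[@leb1 R]_(s in `[0%R, t])
     (expR (gamma * s) * (lambda * Mf s ^+ 2))%:E))%E.
Proof.
move=> t0; pose J (s : R) := expR (gamma * s).
have dJ (x : R) : is_derive x 1 J (J x * gamma).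
  apply: is_derive1_comp.
  have := is_deriveZ gamma (is_derive_id x 1).
  by rewrite /GRing.scale/= mulr1.
have cJ (x : R) : {for x, continuous J}.
  by apply: differentiable_continuous; apply/derivable1_diffP; have [] := dJ x.
rewrite (_ : (\int[_]_(s in _) _)%E = (mg t * J t - mg 0 * J 0)%:E).
  rewrite /mg !clampE// /J -EFinD -EFinM; congr EFin.
  by rewrite mulr0 expR0 mulr1 addrC subrK mulrC -mulrA mulNr expRN mulfV
    ?mulr1// gt_eqF// expR_gt0.
transitivity (\int[@leb1 R]_(s in `[0%R, t])
    (J s * (lambda * mf s ^+ 2))%:E)%E.
  apply: eq_integral => s; rewrite inE/= in_itv/= => /andP[s0 _].
  by rewrite /mf clampE.
apply: (@FTC_ge0 _ (fun s => mg s * J s)) => //.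
- move=> x _; by apply: cvgM; [exact: continuous_clamp_Mg|exact: cJ].
- move=> x _; apply: cvgM; first exact: cJ.
  apply: cvgM; first exact: cvg_cst.
  by apply: cvgM; exact: continuous_clamp_Mf.
- move=> x /andP[x0 _].
  apply: (is_derive_eq (is_deriveM (is_derive_clamp_Mg x0) (dJ x))).
  rewrite /GRing.scale/=; ring.
Qed.

(** The integrated form has M_f only through its square. *)
Lemma Mg_ge0 (t : R) : 0 <= Mg 0 -> 0 <= t -> 0 <= Mg t.
Proof.
move=> Mg0 t0; rewrite -lee_fin mass_g_mild// mule_ge0 ?lee_fin ?expR_ge0//.
rewrite adde_ge0 ?lee_fin// integral_ge0// => s _.
by rewrite lee_fin mulr_ge0 ?expR_ge0// mulr_ge0 ?sqr_ge0// ltW.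
Qed.

Lemma Mf_ge0 (t : R) : 0 <= Mf 0 -> 0 <= Mg 0 -> 0 <= t -> 0 <= Mf t.
Proof.
move=> Mf0 Mg0 t0; rewrite -lee_fin mass_f_mild//.
rewrite mule_ge0 ?lee_fin ?(ltW (decay_gt0 _))//.
rewrite adde_ge0 ?lee_fin// integral_ge0// => s /=.
rewrite in_itv/= => /andP[s0 _].
rewrite lee_fin; apply: mulr_ge0; first by rewrite invr_ge0 ltW// decay_gt0.
by apply: mulr_ge0; [rewrite mulr_ge0// ltW|exact: Mg_ge0].
Qed.

Lemma decay_nonincreasing (s t : R) : 0 <= Mf 0 -> 0 <= Mg 0 ->
  0 <= s <= t -> decay t <= decay s.
Proof.
move=> Mf0 Mg0 st; have /andP[s0 _] := st.
rewrite -[leRHS]mul1r -ler_pdivrMr ?decay_gt0// -damping_decay// /damping.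
rewrite -expR0 ler_expR -!mulrA mulr_le0_ge0// ?oppr_le0//.
apply: mulr_ge0; first exact: ltW.
apply: Rintegral_ge0 => r /=.
by rewrite in_itv/= => /andP[sr _]; apply: Mf_ge0 => //; rewrite (le_trans s0).
Qed.

End MassSystem.

(** * The two Duhamel operators of the model *)

Section ScalarFlow.
Context {d : measure_display} {T : measurableType d} {R : realType}.
Variable mu : {sigma_finite_measure set T -> \bar R}.
Notation R1 := (measurableTypeR R).

Lemma integral_scalar (c : R) (h : T -> \bar R) : 0 < c ->
  measurable_fun setT h -> (forall x, 0 <= h x)%E ->
  (\int[mu]_x (c%:E * h x) = c%:E * \int[mu]_x h x)%E.
Proof. by move=> c0 mh h0; rewrite ge0_integralZl// lee_fin ltW. Qed.

Definition scalar_flow (a : R -> R) (a_gt0 : forall t, 0 < a t)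
    (ma : measurable_fun [set: R1] a) : wflow mu :=
  @Wflow _ T R mu a (fun _ x => x) a a_gt0 a_gt0 ma ma measurable_fst
    (fun t h => integral_scalar (a_gt0 t)).

End ScalarFlow.

Section AlmostEverywhere.
Context {d : measure_display} {T : measurableType d} {R : realType}.
Variable mu : {sigma_finite_measure set T -> \bar R}.
Notation R1 := (measurableTypeR R).
Local Open Scope ereal_scope.

Lemma ge0_integral0_ae (h : T -> \bar R) : nnmeas h -> \int[mu]_x h x = 0 ->
  {ae mu, forall x, h x = 0}.
Proof.
move=> [mh h0] h_int.
have : \int[mu]_x `|h x| = 0 by under eq_integral do rewrite gee0_abs//.
by move=> /(ae_eq_integral_abs _ measurableT mh); apply: filterS => x; apply.
Qed.

Lemma ae_ysection0 (N : set (T * R1)) (s : R1) :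
  measurable N -> {ae mu, forall x, ~ N (x, s)} -> mu (ysection N s) = 0.
Proof.
move=> mN [A [mA A0 NA]].
apply: (subset_measure0 _ mA) => //; first exact: measurable_ysection.
by move=> x; rewrite /ysection/= inE => Nx; apply: NA => /=; apply.
Qed.

(** The mass balance, applied to the indicator of a null set. *)
Lemma ae_transport (U : wflow mu) (t : R) (P : T -> Prop) :
  {ae mu, forall x, P x} -> {ae mu, forall x, P (transport U t x)}.
Proof.
move=> [N [mN N0 PN]].
pose h (x : T) : \bar R := (\1_N x)%:E.
have nh : nnmeas h.
  by split => [|x]; [exact/measurable_EFinP/measurable_indic|rewrite lee_fin].
have : \int[mu]_x act U t h x = 0.
  have [mh h0] := nh.
  rewrite integral_transport//; have := integral_indic mu measurableT mN.
  rewrite setIT => h_int; rewrite -[RHS](mule0 (gain U t)%:E).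
  by congr (_ * _); exact: eq_trans h_int N0.
move=> /(ge0_integral0_ae (nnmeas_act U t nh)); apply: filterS => x /eqP.
rewrite /act mule_eq0 eqe gt_eqF ?weight_gt0//= /h indicE eqe.
have [xN|xN] := boolP (_ \in N); first by rewrite oner_eq0.
by move=> _; apply: contrapT => nP; move/negP: xN; apply; exact/mem_set/PN.
Qed.

End AlmostEverywhere.

Section Operators.
Context {R : realType}.
Notation R1 := (measurableTypeR R).
Notation R2 := (R1 * R1)%type.
Notation mu1 := (@leb1 R).
Notation mu2 := (@plane_measure R).
Variables (lambda gamma : R) (a : R -> R).
Hypotheses (lambda_gt0 : 0 < lambda) (gamma_gt0 : 0 < gamma).
Hypotheses (a_gt0 : forall t, 0 < a t) (ma : measurable_fun [set: R1] a).

Lemma inv_gt0 t : 0 < (a t)^-1. Proof. by rewrite invr_gt0. Qed.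

Lemma measurable_inv : measurable_fun [set: R1] (fun t => (a t)^-1).
Proof.
have -> : (fun t => (a t)^-1) = (fun t => expR (- ln (a t))).
  by apply/funext => t; rewrite expRN lnK// posrE.
apply: measurableT_comp => //; apply: measurableT_comp => //.
exact: (measurableT_comp (@measurable_ln R)).
Qed.

Let UA := scalar_flow mu1 a_gt0 ma.
Let VA := scalar_flow mu1 inv_gt0 measurable_inv.
Let UB : wflow mu2 := collision_flow gamma 1.
Let VB : wflow mu2 := collision_flow gamma (-1).
Local Open Scope ereal_scope.
Implicit Types (f : R1 * R1 -> \bar R) (g : R2 * R1 -> \bar R).

(** Sources of the two equations: pairs split into two singles at rate gamma,
    two singles merge into a pair at rate lambda. *)
Definition splitting g : R1 * R1 -> \bar R :=
  fun p => (2 * gamma)%:E * \int[mu1]_y g ((p.1, y), p.2).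

Definition merging f f' : R2 * R1 -> \bar R :=
  fun p => lambda%:E * (f (p.1.1, p.2) * f' (p.1.2, p.2)).

Definition f_step (y : R1 -> \bar R) g := duhamel UA VA y (splitting g).
Definition g_step (y : R2 -> \bar R) f f' := duhamel UB VB y (merging f f').

Let gamma2 : 0 <= (2 * gamma)%:E.
Proof. by rewrite lee_fin mulr_ge0// ltW. Qed.

Lemma nnmeas_partner g : nnmeas g ->
  nnmeas (fun p : R1 * R1 => \int[mu1]_y g ((p.1, y), p.2)).
Proof.
move=> [mg g0]; split => [|p]; last exact: integral_ge0.
pose h (q : (R1 * R1) * R1) := g ((q.1.1, q.2), q.1.2).
have mh : measurable_fun setT h.
  apply: (measurableT_comp mg); apply: measurable_fun_pair.
    apply: measurable_fun_pair => //.
    exact: (measurableT_comp measurable_fst).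
  exact: (measurableT_comp measurable_snd).
have := measurable_fun_fubini_tonelli_F (m2 := mu1) h mh (fun q => g0 _).
by apply: eq_measurable_fun => -[x t].
Qed.

Lemma nnmeas_splitting g : nnmeas g -> nnmeas (splitting g).
Proof.
move=> /nnmeas_partner[m0 h0]; split => [|p]; last by rewrite mule_ge0.
exact: measurable_funeM.
Qed.

Lemma nnmeas_merging f f' : nnmeas f -> nnmeas f' -> nnmeas (merging f f').
Proof.
move=> [mf f0] [mf' f0']; split => [|p]; last first.
  by rewrite mule_ge0 ?lee_fin ?(ltW lambda_gt0)// mule_ge0.
apply: measurable_funeM; apply: emeasurable_funM.
  apply: (measurableT_comp mf); apply: measurable_fun_pair => //.
  by apply: (measurableT_comp measurable_fst).
apply: (measurableT_comp mf'); apply: measurable_fun_pair => //.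
by apply: (measurableT_comp measurable_snd).
Qed.

Lemma integral_splitting g s : nnmeas g ->
  \int[mu1]_x splitting g (x, s) = (2 * gamma)%:E * \int[mu2]_z g (z, s).
Proof.
move=> ng; have [mp p0] := nnmeas_slice s (nnmeas_partner ng).
rewrite /splitting/= ge0_integralZl//; last by move=> x _; exact: (p0 x).
by rewrite (plane_tonelli12 (nnmeas_slice s ng)).
Qed.

Lemma integral_merging f f' s : nnmeas f -> nnmeas f' ->
  \int[mu2]_z merging f f' (z, s) =
  lambda%:E * (\int[mu1]_x f (x, s) * \int[mu1]_x f' (x, s)).
Proof.
move=> nf nf'; have nm := nnmeas_slice s (nnmeas_merging nf nf').
have [mf f0] := nnmeas_slice s nf; have [mf' f0'] := nnmeas_slice s nf'.
rewrite (plane_tonelli12 nm) /merging/=.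
have lam : 0 <= lambda%:E by rewrite lee_fin ltW.
have int0 : 0 <= \int[mu1]_x f' (x, s) by exact: integral_ge0.
transitivity (\int[mu1]_x (lambda%:E * \int[mu1]_y f' (y, s) * f (x, s))).
  apply: eq_integral => x _; rewrite muleAC -ge0_integralZl//.
    by apply: eq_integral => y _; rewrite muleA.
  by rewrite mule_ge0.
by rewrite ge0_integralZl ?mule_ge0// -muleA [_ * \int[_]_x f (x, s)]muleC.
Qed.

Lemma nnmeas_f_step y g : nnmeas y -> nnmeas g -> nnmeas (f_step y g).
Proof. by move=> ny ng; apply: nnmeas_duhamel => //; exact: nnmeas_splitting. Qed.

Lemma nnmeas_g_step y f f' : nnmeas y -> nnmeas f -> nnmeas f' ->
  nnmeas (g_step y f f').
Proof.
by move=> ny nf nf'; apply: nnmeas_duhamel => //; exact: nnmeas_merging.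
Qed.

Lemma integral_f_step y g t : nnmeas y -> nnmeas g ->
  \int[mu1]_x f_step y g (x, t) =
  (a t)%:E * (\int[mu1]_x y x + \int[mu1]_(s in `[0%R, t])
     (((a s)^-1)%:E * ((2 * gamma)%:E * \int[mu2]_z g (z, s)))).
Proof.
move=> ny ng; rewrite integral_duhamel//; last exact: nnmeas_splitting.
congr (_ * (_ + _)); apply: eq_integral => s _.
by rewrite -integral_splitting.
Qed.

Lemma integral_g_step y f f' t : nnmeas y -> nnmeas f -> nnmeas f' ->
  \int[mu2]_z g_step y f f' (z, t) =
  (expR (- gamma * t))%:E * (\int[mu2]_z y z + \int[mu1]_(s in `[0%R, t])
     ((expR (gamma * s))%:E *
      (lambda%:E * (\int[mu1]_x f (x, s) * \int[mu1]_x f' (x, s))))).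
Proof.
move=> ny nf nf'; rewrite integral_duhamel//; last exact: nnmeas_merging.
congr ((expR _)%:E * (_ + _)) => /=; first by rewrite mul1r.
apply: eq_integral => s _; rewrite integral_merging//.
by rewrite mulN1r mulrNN.
Qed.

End Operators.

(** * Changing representatives in the mild equations *)

Section Versions.
Context {d : measure_display} {T : measurableType d} {R : realType}.
Variable mu : {sigma_finite_measure set T -> \bar R}.
Notation R1 := (measurableTypeR R).
Local Open Scope ereal_scope.

Definition future : set (T * R1) := [set p | (0 <= p.2 :> R)%R].

Lemma measurable_future : measurable future.
Proof.
have m2 : measurable_fun setT (fun p : T * R1 => (p.2 : R)%:E).
  by apply/measurable_EFinP; exact: measurable_snd.
have := measurable_lee measurableT (measurable_cst 0%:E) m2.
by congr measurable; apply/seteqP; split => p /=; rewrite ?lee_fin// => -[].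
Qed.

(** Slicewise almost everywhere equality at nonnegative times, the relation
    between a jointly measurable representative and the curve of its classes. *)
Definition version (f : T * R1 -> R) (F : T * R1 -> \bar R) :=
  measurable_fun future f /\
  forall t : R, (0 <= t)%R -> {ae mu, forall x, (f (x, t))%:E = F (x, t)}.

(** A single jointly measurable exceptional set, as needed by
    [duhamel_negligible]. *)
Lemma version_defect f F : nnmeas F -> version f F ->
  exists N : set (T * R1), [/\ measurable N,
    forall s, (0 <= s)%R -> mu (ysection N s) = 0 &
    forall p, (0 <= p.2 :> R)%R -> ~ N p -> (f p)%:E = F p].
Proof.
move=> [mF _] [mf fF].
have mfE : measurable_fun future (fun p => (f p)%:E) by exact/measurable_EFinP.
exists (future `&` [set p | (f p)%:E != F p]).
have mN := measurable_neqe measurable_future mfE (measurable_funTS mF).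
split => // [s s0|p p0 Np].
  apply: ae_ysection0 => //; apply: filterS (fF _ s0) => x fx.
  by move=> [_ /=]; rewrite fx eqxx.
by apply/eqP/negPn/negP => fp; exact: Np.
Qed.

Lemma measurable_future_extend (f : T * R1 -> R) : measurable_fun future f ->
  measurable_fun setT (f \_ future).
Proof. by move=> mf; exact/(measurable_restrictT _ measurable_future). Qed.

End Versions.

Section MildEquations.
Context {R : realType}.
Notation R1 := (measurableTypeR R).
Notation R2 := (R1 * R1)%type.
Notation mu1 := (@leb1 R).
Notation mu2 := (@plane_measure R).
Variables (lambda gamma : R) (Mf : R -> R) (a : R -> R).
Hypotheses (lambda_gt0 : 0 < lambda) (gamma_gt0 : 0 < gamma).
Hypotheses (a_gt0 : forall t, 0 < a t) (ma : measurable_fun [set: R1] a).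
Hypothesis a0 : a 0 = 1.
Hypothesis dampingE : forall s t, 0 <= s <= t -> damping lambda Mf s t = a t / a s.
Local Open Scope ereal_scope.

Let fstep := f_step gamma a_gt0 ma.
Let gstep := g_step lambda gamma.

Definition pospart {X : Type} (h : X -> R) : X -> \bar R :=
  fun x => (Num.max (h x) 0)%:E.

Lemma nnmeas_pospart {d} {X : measurableType d} (h : X -> R) :
  measurable_fun setT h -> nnmeas (pospart h).
Proof.
move=> mh; split => [|x]; last by rewrite lee_fin le_max lexx orbT.
by apply/measurable_EFinP; apply: measurable_maxr.
Qed.

Lemma pospartE {X : Type} (h : X -> R) x : (0 <= h x)%R -> pospart h x = (h x)%:E.
Proof. by move=> hx; rewrite /pospart max_l. Qed.

Lemma measurable_partner (g : R2 * R1 -> R) : measurable_fun setT g ->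
  measurable_fun setT
    (fun p : R1 * R1 => \int[mu1]_y (g ((p.1, y), p.2))%:E).
Proof.
move=> mg; pose G (p : R2 * R1) : \bar R := (g p)%:E.
have mG : measurable_fun setT G by exact/measurable_EFinP.
have [mp _] := nnmeas_partner (conj (measurable_funepos mG) (funepos_ge0 G)).
have [mn _] := nnmeas_partner (conj (measurable_funeneg mG) (funeneg_ge0 G)).
have := emeasurable_funB mp mn.
apply: eq_measurable_fun => p _; rewrite [RHS]integralE.
congr (_ - _); apply: eq_integral => y _; first by rewrite !funeposE.
by rewrite !funenegE.
Qed.

(** Let N be the set where the two versions of the source differ. The points
    (x, s) whose line {(x, y)} meets N at time s in a set of positive measure
    form a set with null slices; outside of it the inner integrals agree. *)
Lemma f_equation_step (f0 : R1 -> R) (g : R2 * R1 -> R) (G : R2 * R1 -> \bar R) t :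
  measurable_fun setT f0 -> {ae mu1, forall x, (0 <= f0 x)%R} ->
  nnmeas G -> version mu2 g G -> (0 <= t)%R ->
  {ae mu1, forall x,
    (damping lambda Mf 0 t * f0 x)%:E + (2 * gamma)%:E *
      \int[mu1]_(s in `[0%R, t]) ((damping lambda Mf s t)%:E *
         \int[mu1]_y (g ((x, y), s))%:E) =
    fstep (pospart f0) G (x, t)}.
Proof.
move=> mf0 f00 nG vG t0.
have [N [mN N0 NE]] := version_defect nG vG.
have [mg _] := vG.
pose nN (p : R2 * R1) : \bar R := (\1_N p)%:E.
have nnN : nnmeas nN.
  by split => [|p]; [exact/measurable_EFinP/measurable_indic|rewrite lee_fin].
pose D (p : R1 * R1) := \int[mu1]_y nN ((p.1, y), p.2).
have [mD D0] : nnmeas D := nnmeas_partner nnN.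
(* D (x, s) is the measure of the exceptional part of the line through x *)
pose NA : set (R1 * R1) := [set p | D p != 0].
have mNA : measurable NA.
  have := measurable_neqe measurableT mD (measurable_cst 0).
  by rewrite setTI.
have NA0 s : (0 <= s <= t)%R -> mu1 (ysection NA s) = 0.
  move=> /andP[s0 _]; apply: ae_ysection0 => //.
  have nDs := nnmeas_slice s (conj mD D0).
  have : \int[mu1]_x D (x, s) = 0.
    have [mNs Ns0] := nnmeas_slice s nnN.
    rewrite -(plane_tonelli12 (nnmeas_slice s nnN)) -(N0 _ s0).
    have := integral_indic mu2 measurableT (measurable_ysection s mN).
    rewrite setIT => <-; apply: eq_integral => z _.
    by rewrite /nN !indicE mem_ysection.
  by move=> /(ge0_integral0_ae nDs); apply: filterS => x Dx; rewrite /NA/= Dx eqxx.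
have := duhamel_negligible (scalar_flow mu1 a_gt0 ma)
  (scalar_flow mu1 (inv_gt0 a_gt0) (measurable_inv a_gt0 ma)) mNA NA0.
apply: filterS2 f00 => x f0x /= NAx.
rewrite /fstep /f_step duhamel_unfold//; last 2 first.
- exact: nnmeas_pospart.
- exact: nnmeas_splitting.
rewrite /act/= dampingE ?lexx// a0 divr1 pospartE// EFinM; congr (_ + _).
have [mP P0] := nnmeas_timeslice x (nnmeas_partner nG).
pose H (s : R1) := (a t * (a s)^-1)%:E * \int[mu1]_y G ((x, y), s).
have ainv := measurable_inv a_gt0 ma.
have mw : measurable_fun [set: R1] (fun s : R1 => (a t * (a s)^-1)%:E : \bar R).
  by apply/measurable_EFinP; exact: measurable_funM.
have mH : measurable_fun setT H by exact: emeasurable_funM.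
have w0 s : 0 <= (a t * (a s)^-1)%:E.
  by rewrite lee_fin mulr_ge0 ?invr_ge0 ?(ltW (a_gt0 _)).
have mI : measurable (`[0%R, t]%classic : set R1) by exact: measurable_itv.
transitivity ((2 * gamma)%:E * \int[mu1]_(s in `[0%R, t]) H s); last first.
  rewrite -ge0_integralZl//.
  - by apply: eq_integral => s _; rewrite /H /splitting/= muleCA.
  - exact: measurable_funTS.
  - by move=> s _; rewrite /H mule_ge0// integral_ge0// => y _; case: nG.
  - by rewrite lee_fin mulr_ge0// ltW.
congr (_ * _).
(* extended by zero to negative times, g is measurable everywhere and so is
   the time integrand *)
pose H' (s : R1) := (a t * (a s)^-1)%:E *
  \int[mu1]_y ((g \_ future) ((x, y), s))%:E.
transitivity (\int[mu1]_(s in `[0%R, t]) H' s).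
  apply: eq_integral => s; rewrite inE/= in_itv/= => /andP[s0 st].
  rewrite /H' dampingE ?s0//; congr (_ * _); apply: eq_integral => y _.
  by rewrite patchE mem_set.
have mg' := measurable_future_extend mg.
have mH' : measurable_fun setT H'.
  apply: emeasurable_funM => //.
  exact: (measurableT_comp (measurable_partner mg') (measurable_pair1 x)).
apply: ae_eq_integral => //; [exact: measurable_funTS..|].
apply: (@filterS _ _ (ae_filter_ringOfSetsType mu1) _ _ _ NAx) => s NAs.
rewrite /= in_itv/= => st.
have {NAs} := NAs st; have /andP[s0 _] := st.
move=> /negP/negPn/eqP Ds; rewrite /H' /H; congr (_ * _).
have nsl (h : R2 * R1 -> \bar R) : nnmeas h -> nnmeas (fun y : R1 => h ((x, y), s)).
  move=> nh; apply: (nnmeas_comp nh); apply: measurable_fun_pair => //.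
apply: ae_eq_integral => //.
- apply/measurable_EFinP.
  apply: (measurableT_comp mg' (g := fun y : R1 => ((x, y), s))).
  by apply: measurable_fun_pair => //.
- by have [] := nsl _ nG.
apply: filterS (ge0_integral0_ae (nsl _ nnN) Ds) => y /eqP.
rewrite /nN indicE eqe => Ny _; rewrite patchE mem_set//.
apply: NE => // Nxy; move: Ny; rewrite mem_set//.
by rewrite oner_eq0.
Qed.

Lemma semigroup_flow (t : R) (h : R2 -> R) z :
  semigroup gamma t h z = (expR ((1 - gamma) * t) * h (flow (- t) z))%R.
Proof. by []. Qed.

(** The source at (z, s) involves f at (z.1, s) and (z.2, s), so the exceptional
    set is a union of two cylinders over the one of f, each with null slices. *)
Lemma g_equation_step (g0 : R2 -> R) (f : R1 * R1 -> R) (F : R1 * R1 -> \bar R) t :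
  measurable_fun setT g0 -> {ae mu2, forall z, (0 <= g0 z)%R} ->
  nnmeas F -> version mu1 f F -> (0 <= t)%R ->
  {ae mu2, forall z,
    (semigroup gamma t g0 z)%:E + lambda%:E *
      \int[mu1]_(s in `[0%R, t])
        (semigroup gamma (t - s) (fun p => f (p.1, s) * f (p.2, s))%R z)%:E =
    gstep (pospart g0) F F (z, t)}.
Proof.
move=> mg0 g00 nF vF t0.
have [N [mN N0 NE]] := version_defect nF vF.
have [mf _] := vF; have [mF F0] := nF.
pose N1 : set (R2 * R1) := (fun p => (p.1.1, p.2)) @^-1` N.
pose N2 : set (R2 * R1) := (fun p => (p.1.2, p.2)) @^-1` N.
have m11 : measurable_fun [set: R2 * R1] (fun p : R2 * R1 => (p.1.1, p.2)).
  by apply: measurable_fun_pair => //; exact: (measurableT_comp measurable_fst).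
have m12 : measurable_fun [set: R2 * R1] (fun p : R2 * R1 => (p.1.2, p.2)).
  by apply: measurable_fun_pair => //; exact: (measurableT_comp measurable_snd).
have mN1 : measurable N1 by rewrite -[N1]setTI; exact: m11.
have mN2 : measurable N2 by rewrite -[N2]setTI; exact: m12.
have NB0 s : (0 <= s <= t)%R -> mu2 (ysection (N1 `|` N2) s) = 0.
  move=> /andP[s0 _]; have mNs := measurable_ysection s mN.
  have -> : ysection (N1 `|` N2) s =
      ysection N s `*` setT `|` setT `*` ysection N s.
    apply/seteqP; split => -[x y]; rewrite /ysection/= !inE /N1 /N2/=.
      by move=> [?|?]; [left|right]; split => //=; rewrite inE.
    by move=> [[? _]|[_ ?]]; [left|right].
  have Ns0 : @lebesgue_measure R (ysection N s) = 0 := N0 _ s0.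
  have X1 : mu2 (ysection N s `*` setT) = 0.
    rewrite [LHS]product_measure1E//; apply/eqP; rewrite mule_eq0.
    by apply/orP; left; apply/eqP.
  have X2 : mu2 (setT `*` ysection N s) = 0.
    rewrite [LHS]product_measure1E//; apply/eqP; rewrite mule_eq0.
    by apply/orP; right; apply/eqP.
  exact: eq_trans (measureU0 (measurableX mNs measurableT)
    (measurableX measurableT mNs) X2) X1.
have NBz := duhamel_negligible (collision_flow gamma 1)
  (collision_flow gamma (-1)) (measurableU _ _ mN1 mN2) NB0.
have g0z := ae_transport (collision_flow gamma 1) t g00.
apply: (@filterS2 _ _ (ae_filter_ringOfSetsType mu2) _ _ _ _ g0z NBz) => z g0z0 NBs.
rewrite /gstep /g_step duhamel_unfold//; last 2 first.
- exact: nnmeas_pospart.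
- exact: nnmeas_merging.
rewrite /act/= pospartE// semigroup_flow -EFinM mul1r; congr (_ + _).
pose w (s : R1) := expR ((1 - gamma) * (t - s))%R.
pose K (s : R1) : R := (w s * ((f \_ future) ((flow (- (t - s)) z).1, s) *
   (f \_ future) ((flow (- (t - s)) z).2, s)))%R.
pose H (s : R1) := (w s)%:E * (F ((flow (- (t - s)) z).1, s) *
   F ((flow (- (t - s)) z).2, s)).
have mI : measurable (`[0%R, t]%classic : set R1) by exact: measurable_itv.
have mw : measurable_fun [set: R1] w.
  apply: measurableT_comp => //; apply: measurable_funM => //.
  exact: measurable_funB.
have mfl : measurable_fun [set: R1] (fun s : R1 => flow (- (t - s)) z).
  apply: (measurableT_comp (@measurable_flow _ (fun s => - (t - s))%R _)
    (g := fun s : R1 => (z, s))).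
    by apply: measurableT_comp => //; exact: measurable_funB.
  exact: measurable_fun_pair.
have mp1 : measurable_fun [set: R1] (fun s : R1 => ((flow (- (t - s)) z).1, s)).
  by apply: measurable_fun_pair => //; exact: (measurableT_comp measurable_fst mfl).
have mp2 : measurable_fun [set: R1] (fun s : R1 => ((flow (- (t - s)) z).2, s)).
  by apply: measurable_fun_pair => //; exact: (measurableT_comp measurable_snd mfl).
have mf' := measurable_future_extend mf.
have mK : measurable_fun setT K.
  apply: measurable_funM => //; apply: measurable_funM.
    exact: (measurableT_comp mf' mp1).
  exact: (measurableT_comp mf' mp2).
have mH : measurable_fun setT H.
  apply: emeasurable_funM; first exact/measurable_EFinP.
  by apply: emeasurable_funM; [exact: (measurableT_comp mF mp1)|
    exact: (measurableT_comp mF mp2)].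
transitivity (lambda%:E * \int[mu1]_(s in `[0%R, t]) H s); last first.
  rewrite -ge0_integralZl//.
  - apply: eq_integral => s _; rewrite flowD /merging muleCA; congr (_ * _).
      by rewrite -expRD /w; congr (expR _)%:E; ring.
    by rewrite (_ : - (-1 * s) - t = - (t - s))%R; last ring.
  - exact: measurable_funTS.
  - by move=> s _; rewrite /H mule_ge0 ?lee_fin ?expR_ge0// mule_ge0.
  - by rewrite lee_fin ltW.
congr (_ * _).
transitivity (\int[mu1]_(s in `[0%R, t]) (K s)%:E).
  apply: eq_integral => s; rewrite inE/= in_itv/= => /andP[s0 st].
  by rewrite semigroup_flow /K !patchE !mem_set.
apply: ae_eq_integral => //.
- by apply: measurable_funTS; exact/measurable_EFinP.
- exact: measurable_funTS.
apply: (@filterS _ _ (ae_filter_ringOfSetsType mu1) _ _ _ NBs) => s NBss.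
rewrite /= in_itv/= => st; have {NBss} := NBss st; have /andP[s0 _] := st.
have -> : transport (collision_flow gamma (-1)) s
    (transport (collision_flow gamma 1) t z) = flow (- (t - s)) z.
  by rewrite [LHS]flowD; congr (flow _ z); ring.
move=> Nz; rewrite /K /H !patchE !mem_set// EFinM EFinM.
by rewrite !NE// => Ns; apply: Nz; [right|left].
Qed.

(** The mild equations hold for real representatives, whose integrals converge
    in the signed sense, if and only if the Duhamel formulas hold for
    nonnegative versions, to which Tonelli and monotone convergence apply. *)
Lemma mild_equationsP (f0 : R1 -> R) (g0 : R2 -> R) f F g G :
  measurable_fun setT f0 -> {ae mu1, forall x, (0 <= f0 x)%R} ->
  measurable_fun setT g0 -> {ae mu2, forall z, (0 <= g0 z)%R} ->
  nnmeas F -> version mu1 f F -> nnmeas G -> version mu2 g G ->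
  mild_equations lambda gamma Mf f0 g0 f g <->
  forall t : R, (0 <= t)%R ->
    {ae mu1, forall x, F (x, t) = fstep (pospart f0) G (x, t)} /\
    {ae mu2, forall z, G (z, t) = gstep (pospart g0) F F (z, t)}.
Proof.
move=> mf0 f00 mg0 g00 nF vF nG vG.
split=> H t t0; have [Hf Hg] := H t t0; have vf := vF.2 t t0;
  have vg := vG.2 t t0; have Ef := f_equation_step mf0 f00 nG vG t0;
  have Eg := g_equation_step mg0 g00 nF vF t0; split.
- apply: (@filterS3 _ _ (ae_filter_ringOfSetsType mu1) _ _ _ _ _ Hf vf Ef).
  by move=> x h1 h2 <-; rewrite -h2 h1.
- apply: (@filterS3 _ _ (ae_filter_ringOfSetsType mu2) _ _ _ _ _ Hg vg Eg).
  by move=> z h1 h2 <-; rewrite -h2 h1.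
- apply: (@filterS3 _ _ (ae_filter_ringOfSetsType mu1) _ _ _ _ _ Hf vf Ef).
  by move=> x h1 -> ->.
- apply: (@filterS3 _ _ (ae_filter_ringOfSetsType mu2) _ _ _ _ _ Hg vg Eg).
  by move=> z h1 -> ->.
Qed.

End MildEquations.

(** * Curves of integrable classes *)

Section L1Classes.
Context {d : measure_display} {T : measurableType d} {R : realType}.
Variable mu : {measure set T -> \bar R}.
Local Open Scope ereal_scope.
Notation Q := {mfun_ mu, T >-> measurableTypeR R}.

Lemma L1_measurable (u : LspaceType1 mu) : measurable_fun setT (u : T -> R).
Proof. exact: (measurable_funPT (repr (u : Q))). Qed.

Lemma L1_finite (u : LspaceType1 mu) :
  \int[mu]_x `|(u : T -> R) x|%:E < +oo.
Proof.
have := @Lebesgue_finite _ _ _ mu 1%E (lexx 1%E) u.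
by rewrite /finite_norm Lnorm1.
Qed.

Lemma L1_eq (u v : LspaceType1 mu) :
  {ae mu, forall x, (u : T -> R) x = (v : T -> R) x} -> u = v.
Proof.
move=> uv.
have E : (u : Q) = (v : Q).
  rewrite -[LHS]reprK -[RHS]reprK; apply/eqquotP/asboolP.
  by apply: filterS uv => x ? _.
case: u v E {uv} => [u [[hu]]] [v [[hv]]] /= E.
by subst v; congr LebesgueSpace.Pack; rewrite (Prop_irrelevance hu hv).
Qed.

Lemma L1_exists (h : T -> R) : measurable_fun setT h ->
  \int[mu]_x `|h x|%:E < +oo ->
  {u : LspaceType1 mu | {ae mu, forall x, (u : T -> R) x = h x}}.
Proof.
move=> mh ih.
have mh' : @measurable_fun _ _ T (measurableTypeR R) setT h := mh.
pose hm : {mfun T >-> measurableTypeR R} :=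
  HB.pack (h : T -> measurableTypeR R)
    (isMeasurableFun.Build _ _ T (measurableTypeR R) h mh').
pose q : Q := \pi_Q%qT hm.
have qh : {ae mu, forall x, (q : T -> R) x = h x}.
  have /eqP : (repr q = hm %[mod Q])%qT by rewrite reprK.
  rewrite eqmodE => /asboolP.
  by apply: filterS => x; apply.
have mq : measurable_fun setT (q : T -> R) := measurable_funPT (repr q).
have qfin : finite_norm mu 1 q.
  rewrite /finite_norm Lnorm1 (le_lt_trans _ ih)//.
  rewrite (@ge0_ae_eq_integral _ _ _ mu setT _ (fun x => `|h x|%:E))//.
  - by apply/measurable_EFinP; apply: measurableT_comp.
  - by apply/measurable_EFinP; apply: measurableT_comp.
  - by apply: filterS qh => x /= -> _.
pose u : LspaceType1 mu := HB.pack q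
  (isFinLebesgue.Build _ _ _ mu 1%E (lexx 1%E) q qfin).
by exists u.
Qed.

End L1Classes.

Section L1Curves.
Context {d : measure_display} {T : measurableType d} {R : realType}.
Variable mu : {measure set T -> \bar R}.
Local Open Scope ereal_scope.
Implicit Types u v : LspaceType1 mu.

Let norm1 u : \bar R := \int[mu]_x `|(u : T -> R) x|%:E.

Lemma L1_distE u v :
  L1_dist u v = \int[mu]_x `|(u : T -> R) x - (v : T -> R) x|%:E.
Proof. by rewrite /L1_dist Lnorm1. Qed.

Lemma L1_dist_ge0 u v : 0 <= L1_dist u v.
Proof. by rewrite L1_distE; apply: integral_ge0 => x _; rewrite lee_fin. Qed.

Lemma le_norm1_dist u v : norm1 u <= norm1 v + L1_dist u v.
Proof.
have mu' := L1_measurable u; have mv := L1_measurable v.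
have m1 : measurable_fun setT (fun x => `|(u : T -> R) x|%:E).
  by apply/measurable_EFinP; apply: measurableT_comp.
have m2 : measurable_fun setT (fun x => `|(v : T -> R) x|%:E).
  by apply/measurable_EFinP; apply: measurableT_comp.
have m3 : measurable_fun setT (fun x => `|(u : T -> R) x - (v : T -> R) x|%:E).
  by apply/measurable_EFinP; apply: measurableT_comp => //; exact: measurable_funB.
rewrite L1_distE /norm1 -ge0_integralD//; try by move=> x _; rewrite lee_fin.
apply: ge0_le_integral => //; first exact: emeasurable_funD.
move=> x _; rewrite -EFinD lee_fin.
by rewrite -[X in (`|X| <= _)%R](subrKC ((v : T -> R) x)) ler_normD.
Qed.

Lemma L1_dist_sym u v : L1_dist u v = L1_dist v u.
Proof. by rewrite !L1_distE; apply: eq_integral => x _; rewrite distrC. Qed.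

(** The norm is a continuous function of time. *)
Lemma C_L1_bounded (u : R -> LspaceType1 mu) (b : R) : C_L1_nneg u ->
  (0 <= b)%R -> exists K : R, (0 <= K)%R /\
  forall t, (0 <= t <= b)%R -> norm1 (u t) <= K%:E.
Proof.
move=> Cu b0; pose N t := fine (norm1 (u t)).
have NE t : (N t)%:E = norm1 (u t).
  rewrite fineK// ge0_fin_numE; first exact: L1_finite.
  by apply: integral_ge0 => x _; rewrite lee_fin.
have N0 t : (0 <= N t)%R.
  by rewrite fine_ge0//; apply: integral_ge0 => x _; rewrite lee_fin.
have cN : continuous (clamp N).
  apply: clamp_continuous => t t0; have [_] := Cu t t0.
  move/(ge0_cvge0P (fun s => L1_dist_ge0 (u s) (u t))) => H.
  apply/cvgrPdist_le => /= e e0; apply: filterS (H e e0) => s dist.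
  have st := le_trans (le_norm1_dist (u s) (u t)) (leeD2l _ dist).
  have := le_norm1_dist (u t) (u s); rewrite L1_dist_sym => ts.
  have {}ts := le_trans ts (leeD2l _ dist).
  move: st ts; rewrite -!NE -!EFinD !lee_fin ler_norml => st ts.
  by apply/andP; split; lra.
have [c _ Nc] := @EVT_max _ _ 0%R b b0 (continuous_subspaceT cN).
exists (clamp N c); split; first exact: N0.
move=> t tb; rewrite -NE lee_fin; have /andP[t0 _] := tb.
by rewrite -(clampE N t0); apply: Nc; rewrite in_itv/=.
Qed.

End L1Curves.

(** * Uniqueness *)

Section Gronwall.
Context {R : realType}.
Notation R1 := (measurableTypeR R).
Notation mu1 := (@leb1 R).
Local Open Scope ereal_scope.

Lemma integral_expR (c t : R) : (0 < c)%R -> (0 <= t)%R ->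
  \int[mu1]_(s in `[0%R, t]) (expR (c * s))%:E = ((expR (c * t) - 1) / c)%:E.
Proof.
move=> c0 t0.
have dJ (x : R) : is_derive x 1%R (fun s => expR (c * s) / c)%R (expR (c * x)).
  have dE : is_derive x 1%R (fun s => expR (c * s))%R (expR (c * x) * c)%R.
    apply: is_derive1_comp.
    have := is_deriveZ c (is_derive_id x 1%R).
    by rewrite /GRing.scale/= mulr1.
  have -> : (fun s => expR (c * s) / c)%R = (c^-1 \*: (fun s => expR (c * s)))%R.
    by apply/funext => s /=; rewrite mulrC.
  apply: (is_derive_eq (is_deriveZ c^-1 dE)).
  by rewrite /GRing.scale/= mulrCA mulVf ?mulr1// gt_eqF.
have cE (x : R) : {for x, continuous (fun s => expR (c * s))%R}.
  apply: continuous_comp; last exact: continuous_expR.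
  by apply: cvgM; [exact: cvg_cst|exact: cvg_id].
rewrite (@FTC_ge0 _ (fun s => expR (c * s) / c)%R)//.
  by rewrite mulr0 expR0 mulrBl.
  by move=> x _; apply: cvgM; [exact: cE|exact: cvg_cst].
by move=> x _; exact: cE.
Qed.

(** If D t <= k exp(2 C t) on [0, b], then integration of the hypothesis gives
    D t <= (k / 2) exp(2 C t): the bound can be halved indefinitely. *)
Lemma gronwall0 (D : R1 -> \bar R) (C K b : R) :
  measurable_fun setT D -> (forall t, 0 <= D t) -> (0 < C)%R -> (0 <= K)%R ->
  (forall t, (0 <= t <= b)%R -> D t <= K%:E) ->
  (forall t, (0 <= t <= b)%R ->
     D t <= C%:E * \int[mu1]_(s in `[0%R, t]) D s) ->
  forall t, (0 <= t <= b)%R -> D t = 0.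
Proof.
move=> mD D0 C0 K0 DK DC.
have C20 : (0 < 2 * C)%R by rewrite mulr_gt0.
have bound n t : (0 <= t <= b)%R -> D t <= (K / 2 ^+ n * expR (2 * C * t))%:E.
  elim: n t => [|n IH] t tb; have /andP[t0 tb'] := tb.
    rewrite expr0 divr1 (le_trans (DK t tb))// lee_fin ler_peMr//.
    by rewrite -[leLHS]expR0 ler_expR mulr_ge0// ltW.
  apply: (le_trans (DC t tb)).
  have KE0 : (0 <= K / 2 ^+ n)%R by rewrite divr_ge0// exprn_ge0.
  have me : measurable_fun [set: R1] (fun s : R1 => (expR (2 * C * s))%:E : \bar R).
    by apply/measurable_EFinP; apply: measurableT_comp => //; exact: measurable_funM.
  apply: (@le_trans _ _ (C%:E * \int[mu1]_(s in `[0%R, t])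
      ((K / 2 ^+ n)%:E * (expR (2 * C * s))%:E))).
    apply: lee_wpmul2l; first by rewrite lee_fin ltW.
    apply: ge0_le_integral => //.
    - exact: measurable_funTS.
    - by apply: measurable_funTS; exact: measurable_funeM.
    - move=> s; rewrite /= in_itv/= => /andP[s0 st].
      by rewrite -EFinM IH// s0 (le_trans st).
  rewrite ge0_integralZl//; last exact: measurable_funTS.
  rewrite integral_expR// -!EFinM lee_fin exprS.
  have e0 : (expR (2 * C * t) - 1 <= expR (2 * C * t))%R by rewrite gerBl.
  rewrite (_ : (C * _)%R = (K / 2 ^+ n / 2) * (expR (2 * C * t) - 1))%R; last first.
    by field; rewrite ?expf_neq0// gt_eqF.
  rewrite (_ : K / (2 * 2 ^+ n) = K / 2 ^+ n / 2)%R; last first.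
    by rewrite invfM mulrA mulrAC.
  by rewrite ler_wpM2l// divr_ge0.
move=> t tb; apply/eqP; rewrite eq_le D0 andbT.
pose M := (K * expR (2 * C * t))%R.
have M0 : (0 <= M)%R by rewrite mulr_ge0// expR_ge0.
apply/lee_addgt0Pr => e e0; rewrite add0e.
have [n Mn] : exists n, (M / e < 2 ^+ n)%R.
  exists (Num.bound (M / e)); apply: (lt_le_trans (archi_boundP _)).
    by rewrite divr_ge0// ltW.
  by rewrite -natrX ler_nat ltnW// ltn_expl.
apply: (le_trans (bound n t tb)); rewrite lee_fin mulrAC -/M.
rewrite ler_pdivrMr ?exprn_gt0// mulrC -ler_pdivrMr//; exact: ltW.
Qed.

End Gronwall.

Section Contraction.
Context {d : measure_display} {T : measurableType d} {R : realType}.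
Variable mu : {sigma_finite_measure set T -> \bar R}.
Notation R1 := (measurableTypeR R).
Local Open Scope ereal_scope.

(** Without initial data a Duhamel integral creates no more mass than its
    source does. *)
Lemma integral_duhamel0_le (U V : wflow mu) q (t : R) : nnmeas q ->
  (forall s, 0 <= s <= t -> gain U t * gain V s <= 1)%R ->
  \int[mu]_x duhamel U V (cst 0) q (x, t) <=
  \int[@leb1 R]_(s in `[0%R, t]) \int[mu]_x q (x, s).
Proof.
move=> nq UV; rewrite integral_duhamel//.
have [mq q0] := nq.
have q_int s : 0 <= \int[mu]_x q (x, s) by apply: integral_ge0.
have mqi := measurable_mass mu mq q0.
have mgq : measurable_fun [set: R1] (fun s : R1 => (gain V s)%:E * \int[mu]_x q (x, s)).
  by apply: emeasurable_funM => //; apply/measurable_EFinP; exact: measurable_gain.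
have gV s : 0 <= (gain V s)%:E by rewrite lee_fin ltW// gain_gt0.
have gU : 0 <= (gain U t)%:E by rewrite lee_fin ltW// gain_gt0.
rewrite integral0 add0e -ge0_integralZl//; last 2 first.
- exact: measurable_funTS.
- by move=> s _; exact: mule_ge0.
apply: ge0_le_integral => //.
- by move=> s _; rewrite !mule_ge0.
- by apply: measurable_funTS; exact: measurable_funeM.
- exact: measurable_funTS.
- move=> s; rewrite /= in_itv/= => st; rewrite muleA -EFinM.
  by rewrite -[leRHS]mul1e lee_wpmul2r// lee_fin UV.
Qed.

End Contraction.

Section Stability.
Context {R : realType}.
Notation R1 := (measurableTypeR R).
Notation R2 := (R1 * R1)%type.
Notation mu1 := (@leb1 R).
Notation mu2 := (@plane_measure R).
Variables (lambda gamma : R) (a : R -> R).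
Hypotheses (lambda_gt0 : 0 < lambda) (gamma_gt0 : 0 < gamma).
Hypotheses (a_gt0 : forall t, 0 < a t) (ma : measurable_fun [set: R1] a).
Hypothesis a_noninc : forall s t, 0 <= s <= t -> a t <= a s.
Local Open Scope ereal_scope.

Let fstep := f_step gamma a_gt0 ma.
Let gstep := g_step lambda gamma.
Let UB := collision_flow gamma 1.
Let VB := collision_flow gamma (-1).
Implicit Types (F : R1 * R1 -> \bar R) (G : R2 * R1 -> \bar R).

Lemma le_splitting G G' : nnmeas G -> nnmeas G' -> (forall p, G p <= G' p) ->
  forall p, splitting gamma G p <= splitting gamma G' p.
Proof.
move=> nG nG' GG p; apply: lee_wpmul2l; first by rewrite lee_fin mulr_ge0// ltW.
have ms (H : R2 * R1 -> \bar R) : nnmeas H ->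
    measurable_fun [set: R1] (fun y : R1 => H ((p.1, y), p.2)).
  move=> [mH _]; apply: (measurableT_comp mH); apply: measurable_fun_pair => //.
apply: ge0_le_integral => //; [by move=> y _; case: nG|exact: ms|exact: ms].
Qed.

Lemma splittingD G G' : nnmeas G -> nnmeas G' ->
  splitting gamma (G \+ G') = splitting gamma G \+ splitting gamma G'.
Proof.
move=> nG nG'; apply/funext => p; rewrite /splitting/=.
have ms (H : R2 * R1 -> \bar R) : nnmeas H ->
    nnmeas (fun y : R1 => H ((p.1, y), p.2)).
  move=> nH; apply: (nnmeas_comp nH); apply: measurable_fun_pair => //.
have [m1 h1] := ms _ nG; have [m2 h2] := ms _ nG'.
by rewrite ge0_integralD// ge0_muleDr//; exact: integral_ge0.
Qed.

Lemma f_step_stability y G G' D (x : R1) (t : R) : nnmeas y ->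
  nnmeas G -> nnmeas G' -> nnmeas D -> (forall p, G p <= G' p + D p) ->
  fstep y G (x, t) <= fstep y G' (x, t) + fstep (cst 0) D (x, t).
Proof.
move=> ny nG nG' nD GG.
have nS := nnmeas_splitting gamma_gt0.
rewrite /fstep /f_step -duhamelD; [|by []|exact: nS|exact: nS].
apply: le_duhamel.
- exact: nS.
- by apply: nnmeasD; exact: nS.
- by [].
- move=> {}x s _; apply: le_trans (le_splitting nG (nnmeasD nG' nD) GG _) _.
  by rewrite splittingD.
Qed.

(** F(x) F(y) - F'(x) F'(y) is at most D(x) F(y) + F'(x) D(y); both F and F'
    are replaced by F + F', so that the bound is symmetric in them. *)
Lemma g_step_stability y F F' D z (t : R) : nnmeas y ->
  nnmeas F -> nnmeas F' -> nnmeas D -> (forall p, F p <= F' p + D p) ->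
  gstep y F F (z, t) <= gstep y F' F' (z, t) +
    duhamel UB VB (cst 0)
      (merging lambda D (F \+ F') \+ merging lambda (F \+ F') D) (z, t).
Proof.
move=> ny nF nF' nD FF.
have nS := nnmeas_merging lambda_gt0.
have nFF := nnmeasD nF nF'.
rewrite /gstep /g_step -duhamelD; [|by []|exact: nS|by apply: nnmeasD; exact: nS].
apply: le_duhamel.
- exact: nS.
- by apply: nnmeasD; [exact: nS|apply: nnmeasD; exact: nS].
- by [].
- move=> {}z s _; rewrite /merging/=.
  have lam : 0 <= lambda%:E by rewrite lee_fin ltW.
  set p := (z.1, s); set p' := (z.2, s).
  have [[_ F0] [_ F0']] := (nF, nF'); have [_ D0] := nD.
  rewrite -!ge0_muleDr ?mule_ge0 ?adde_ge0 ?mule_ge0 ?adde_ge0//.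
  apply: lee_wpmul2l => //.
  apply: (@le_trans _ _ ((F' p + D p) * F p')); first exact: lee_wpmul2r.
  rewrite ge0_muleDl//.
  apply: (@le_trans _ _ (F' p * (F' p' + D p') + D p * F p')).
    by apply: leeD => //; exact: lee_wpmul2l.
  rewrite ge0_muleDr// -addeA; apply: leeD => //; rewrite addeC; apply: leeD.
    by apply: lee_wpmul2l => //; rewrite leeDl.
  by apply: lee_wpmul2r => //; rewrite leeDr.
Qed.

Lemma f_step0_mass G (t : R) : nnmeas G ->
  \int[mu1]_x fstep (cst 0) G (x, t) <=
  (2 * gamma)%:E * \int[mu1]_(s in `[0%R, t]) \int[mu2]_z G (z, s).
Proof.
move=> nG; have [mG G0] := nG.
have nS := nnmeas_splitting gamma_gt0 nG.
apply: le_trans (integral_duhamel0_le nS _) _.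
  move=> s st /=; rewrite ler_pdivrMr// mul1r; exact: a_noninc.
rewrite -ge0_integralZl//.
- by rewrite le_eqVlt; apply/orP; left; apply/eqP; apply: eq_integral => s _;
     rewrite integral_splitting.
- by apply: measurable_funTS; exact: (measurable_mass mu2).
- by move=> s _; exact: integral_ge0.
- by rewrite lee_fin mulr_ge0// ltW.
Qed.

Lemma g_step0_mass F D (t K : R) : nnmeas F -> nnmeas D -> (0 <= K)%R ->
  (forall s, (0 <= s <= t)%R -> \int[mu1]_x F (x, s) <= K%:E) ->
  \int[mu2]_z duhamel UB VB (cst 0)
      (merging lambda D F \+ merging lambda F D) (z, t) <=
  (2 * lambda * K)%:E * \int[mu1]_(s in `[0%R, t]) \int[mu1]_x D (x, s).
Proof.
move=> nF nD K0 FK; have [mD D0] := nD; have [mF F0] := nF.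
have nDF := nnmeas_merging lambda_gt0 nD nF.
have nFD := nnmeas_merging lambda_gt0 nF nD.
have nM := nnmeasD nDF nFD.
apply: le_trans (integral_duhamel0_le nM _) _.
  move=> s /andP[s0 st] /=; rewrite -expRD -[leRHS]expR0 ler_expR.
  rewrite (_ : _ + _ = - (gamma * (t - s)))%R; last by ring.
  by rewrite oppr_le0 mulr_ge0 ?subr_ge0// ltW.
have D_int s : 0 <= \int[mu1]_x D (x, s) by exact: integral_ge0.
have mDi := measurable_mass mu1 mD D0.
rewrite -ge0_integralZl//.
- have [mMi _] : nnmeas (fun s : R1 => \int[mu2]_z
      (merging lambda D F \+ merging lambda F D) (z, s)).
    split => [|s]; first exact: (measurable_mass mu2 nM.1 nM.2).
    by apply: integral_ge0 => z _; case: nM.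
  apply: ge0_le_integral => //.
  + by move=> s _; apply: integral_ge0 => z _; case: nM.
  + exact: measurable_funTS.
  + by apply: measurable_funTS; exact: measurable_funeM.
  move=> s; rewrite /= in_itv/= => st.
  have [m1 h1] := nnmeas_slice s nDF; have [m2 h2] := nnmeas_slice s nFD.
  rewrite ge0_integralD// !integral_merging//.
  rewrite [X in _ + _ * X]muleC.
  have half : lambda%:E * (\int[mu1]_x D (x, s) * \int[mu1]_x F (x, s)) <=
      (lambda * K)%:E * \int[mu1]_x D (x, s).
    rewrite EFinM -muleA; apply: lee_wpmul2l; first by rewrite lee_fin ltW.
    by rewrite muleC; apply: lee_wpmul2r => //; exact: FK.
  apply: (le_trans (leeD half half)).
  have lK : 0 <= (lambda * K)%:E by rewrite lee_fin mulr_ge0// ltW.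
  rewrite -ge0_muleDl// -EFinD (_ : lambda * K + lambda * K = 2 * lambda * K)%R//.
  by ring.
- exact: measurable_funTS.
- by rewrite lee_fin !mulr_ge0// ltW.
Qed.

Lemma ae_dist_le {d} {T : measurableType d} {mu : {sigma_finite_measure set T -> \bar R}}
    (h1 h2 : T -> R) (A1 A2 E : T -> \bar R) :
  (forall x, 0 <= E x) ->
  (forall x, A1 x <= A2 x + E x) -> (forall x, A2 x <= A1 x + E x) ->
  {ae mu, forall x, (h1 x)%:E = A1 x} -> {ae mu, forall x, (h2 x)%:E = A2 x} ->
  {ae mu, forall x, `|h1 x - h2 x|%:E <= E x}.
Proof.
move=> E0 A12 A21; apply: filterS2 => x h1x h2x.
have := A12 x; have := A21 x; rewrite -h1x -h2x.
case: (E x) (E0 x) => [e _|_|]; [|by move=> *; rewrite leey|by []].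
by rewrite -!EFinD !lee_fin ler_norml => *; apply/andP; split; lra.
Qed.

(** The pointwise distances of two solutions are bounded by the Duhamel
    integrals of these same distances with zero initial data; on masses this is
    the hypothesis of [gronwall0]. *)
Lemma step_uniqueness (y : R1 -> \bar R) (w : R2 -> \bar R)
    (f1 f2 : R1 * R1 -> R) (g1 g2 : R2 * R1 -> R) (b K : R) :
  nnmeas y -> nnmeas w ->
  nnmeas (EFin \o f1) -> nnmeas (EFin \o f2) ->
  nnmeas (EFin \o g1) -> nnmeas (EFin \o g2) -> (0 <= K)%R ->
  (forall t : R, (0 <= t <= b)%R ->
    [/\ \int[mu1]_x (f1 (x, t))%:E <= K%:E, \int[mu1]_x (f2 (x, t))%:E <= K%:E,
        \int[mu2]_z (g1 (z, t))%:E <= K%:E & \int[mu2]_z (g2 (z, t))%:E <= K%:E]) ->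
  (forall t : R, (0 <= t <= b)%R ->
    [/\ {ae mu1, forall x, (f1 (x, t))%:E = fstep y (EFin \o g1) (x, t)},
        {ae mu1, forall x, (f2 (x, t))%:E = fstep y (EFin \o g2) (x, t)},
        {ae mu2, forall z, (g1 (z, t))%:E = gstep w (EFin \o f1) (EFin \o f1) (z, t)} &
        {ae mu2, forall z, (g2 (z, t))%:E = gstep w (EFin \o f2) (EFin \o f2) (z, t)}]) ->
  forall t : R, (0 <= t <= b)%R ->
    {ae mu1, forall x, f1 (x, t) = f2 (x, t)} /\
    {ae mu2, forall z, g1 (z, t) = g2 (z, t)}.
Proof.
move=> ny nw nf1 nf2 ng1 ng2 K0 massK eqs.
have nfF := nnmeasD nf1 nf2.
have dist_nn d (X : measurableType d) (h1 h2 : X -> R) :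
    nnmeas (EFin \o h1) -> nnmeas (EFin \o h2) ->
    nnmeas (fun p => `|h1 p - h2 p|%:E).
  move=> [/measurable_EFinP m1 _] [/measurable_EFinP m2 _].
  split => [|p]; last by rewrite lee_fin.
  by apply/measurable_EFinP; apply: measurableT_comp => //; exact: measurable_funB.
pose df (p : R1 * R1) : \bar R := `|f1 p - f2 p|%:E.
pose dg (p : R2 * R1) : \bar R := `|g1 p - g2 p|%:E.
have ndf : nnmeas df by exact: dist_nn.
have ndg : nnmeas dg by exact: dist_nn.
have dist_l (X : Type) (h1 h2 : X -> R) p :
    (EFin \o h1) p <= (EFin \o h2) p + `|h1 p - h2 p|%:E.
  by rewrite /= -EFinD lee_fin -lerBlDl ler_norm.
have dist_r (X : Type) (h1 h2 : X -> R) p :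
    (EFin \o h2) p <= (EFin \o h1) p + `|h1 p - h2 p|%:E.
  by rewrite distrC.
pose Df (t : R1) := \int[mu1]_x df (x, t).
pose Dg (t : R1) := \int[mu2]_z dg (z, t).
have nDf : nnmeas Df.
  split => [|t]; first exact: (measurable_mass mu1 ndf.1 ndf.2).
  by apply: integral_ge0 => x _; case: ndf.
have nDg : nnmeas Dg.
  split => [|t]; first exact: (measurable_mass mu2 ndg.1 ndg.2).
  by apply: integral_ge0 => x _; case: ndg.
have [mDf Df0] := nDf; have [mDg Dg0] := nDg.
have Df_le t : (0 <= t <= b)%R ->
    Df t <= (2 * gamma)%:E * \int[mu1]_(s in `[0%R, t]) Dg s.
  move=> tb; have [E1 E2 _ _] := eqs t tb.
  apply: le_trans (f_step0_mass t ndg).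
  have nE := nnmeas_slice t (nnmeas_f_step gamma_gt0 a_gt0 ma (@nnmeas0 _ _ R) ndg).
  have [mE E0] := nE; have [md d0] := nnmeas_slice t ndf.
  apply: ae_ge0_le_integral => //.
  apply: filterS (ae_dist_le E0 _ _ E1 E2) => x; first by move=> h _.
  + exact: f_step_stability.
  + exact: f_step_stability.
have f12_mass s : (0 <= s <= b)%R ->
    \int[mu1]_x ((EFin \o f1) \+ (EFin \o f2)) (x, s) <= (2 * K)%:E.
  move=> sb; have [h1 h2 _ _] := massK s sb.
  have [m1 p1] := nnmeas_slice s nf1; have [m2 p2] := nnmeas_slice s nf2.
  by rewrite ge0_integralD// mulr_natl mulr2n EFinD leeD.
have Dg_le t : (0 <= t <= b)%R ->
    Dg t <= (2 * lambda * (2 * K))%:E * \int[mu1]_(s in `[0%R, t]) Df s.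
  move=> tb; have [_ _ E1 E2] := eqs t tb.
  have K2 : (0 <= 2 * K)%R by rewrite mulr_ge0.
  have massF s : (0 <= s <= t)%R ->
      \int[mu1]_x ((EFin \o f1) \+ (EFin \o f2)) (x, s) <= (2 * K)%:E.
    move=> /andP[s0 st]; apply: f12_mass; rewrite s0 (le_trans st)//.
    by case/andP: tb.
  apply: le_trans (g_step0_mass nfF ndf K2 massF).
  pose E p := duhamel UB VB (cst 0) (merging lambda df
    ((EFin \o f1) \+ (EFin \o f2)) \+
    merging lambda ((EFin \o f1) \+ (EFin \o f2)) df) p.
  have nS := nnmeas_merging lambda_gt0.
  have nE0 : nnmeas E.
    by apply: nnmeas_duhamel; [exact: nnmeas0|apply: nnmeasD; exact: nS].
  have [mE E0] := nnmeas_slice t nE0; have [md d0] := nnmeas_slice t ndg.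
  (* the bound of g_step_stability is symmetric up to the order of this sum *)
  have comm : (EFin \o f2) \+ (EFin \o f1) = (EFin \o f1) \+ (EFin \o f2).
    by apply/funext => p; rewrite /= addeC.
  apply: ae_ge0_le_integral => //.
    by move=> z _; exact: E0.
  have A12 z : gstep w (EFin \o f1) (EFin \o f1) (z, t) <=
      gstep w (EFin \o f2) (EFin \o f2) (z, t) + E (z, t).
    exact: g_step_stability.
  have A21 z : gstep w (EFin \o f2) (EFin \o f2) (z, t) <=
      gstep w (EFin \o f1) (EFin \o f1) (z, t) + E (z, t).
    by rewrite /E -comm; apply: g_step_stability.
  have dE := ae_dist_le E0 A12 A21 E1 E2.
  by apply: (@filterS _ _ (ae_filter_ringOfSetsType mu2) _ _ _ dE) => z h _.
pose C : R := (2 * gamma + 2 * lambda * (2 * K))%R.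
have gK : (0 < 2 * gamma)%R by rewrite mulr_gt0.
have lK : (0 <= 2 * lambda * (2 * K))%R by rewrite !mulr_ge0// ltW.
have C0 : (0 < C)%R by rewrite ltr_wpDr.
have int_ge0 (h : R1 -> \bar R) (D : set R1) : nnmeas h ->
    0 <= \int[mu1]_(s in D) h s.
  by move=> [_ h0]; exact: integral_ge0.
have D_bound t : (0 <= t <= b)%R -> (Df \+ Dg) t <= (2 * (2 * K))%:E.
  move=> tb; have [F1 F2 G1 G2] := massK t tb.
  have dist_mass d (X : measurableType d) (mu : {sigma_finite_measure set X -> \bar R})
      (h1 h2 : X * R1 -> R) : nnmeas (EFin \o h1) -> nnmeas (EFin \o h2) ->
      \int[mu]_x (h1 (x, t))%:E <= K%:E -> \int[mu]_x (h2 (x, t))%:E <= K%:E ->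
      \int[mu]_x `|h1 (x, t) - h2 (x, t)|%:E <= (2 * K)%:E.
    move=> n1 n2 i1 i2.
    have [m1 p1] := nnmeas_slice t n1; have [m2 p2] := nnmeas_slice t n2.
    have {}p1 x : 0 <= (h1 (x, t))%:E := p1 x.
    have {}p2 x : 0 <= (h2 (x, t))%:E := p2 x.
    have {}m1 : measurable_fun setT (fun x => (h1 (x, t))%:E) := m1.
    have {}m2 : measurable_fun setT (fun x => (h2 (x, t))%:E) := m2.
    have [md _] := nnmeas_slice t (dist_nn _ _ _ _ n1 n2).
    rewrite mulr_natl mulr2n EFinD; apply: le_trans (leeD i1 i2).
    rewrite -ge0_integralD//.
    apply: ge0_le_integral => //; first exact: emeasurable_funD.
    move=> x _; rewrite -EFinD lee_fin (le_trans (ler_normB _ _))//.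
    by rewrite !ger0_norm// -lee_fin.
  rewrite mulr_natl mulr2n EFinD; apply: leeD; exact: dist_mass.
have D_step t : (0 <= t <= b)%R ->
    (Df \+ Dg) t <= C%:E * \int[mu1]_(s in `[0%R, t]) (Df \+ Dg) s.
  move=> tb; apply: (le_trans (leeD (Df_le t tb) (Dg_le t tb))).
  have -> : \int[mu1]_(s in `[0%R, t]) (Df \+ Dg) s =
      \int[mu1]_(s in `[0%R, t]) Df s + \int[mu1]_(s in `[0%R, t]) Dg s.
    by rewrite ge0_integralD//; exact: measurable_funTS.
  have I1 := int_ge0 Df `[0%R, t]%classic nDf.
  have I2 := int_ge0 Dg `[0%R, t]%classic nDg.
  rewrite (ge0_muleDr _ I1 I2) [leLHS]addeC; apply: leeD.
    by apply: lee_wpmul2r => //; rewrite lee_fin lerDr ltW.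
  by apply: lee_wpmul2r => //; rewrite lee_fin lerDl.
move=> t tb.
have [mD D0] := nnmeasD nDf nDg.
have K4 : (0 <= 2 * (2 * K))%R by rewrite !mulr_ge0.
have Dt0 := gronwall0 mD D0 C0 K4 D_bound D_step tb.
have [Dft Dgt] : Df t = 0 /\ Dg t = 0.
  move: Dt0 => /eqP; rewrite /= padde_eq0//.
  by move=> /andP[/eqP ? /eqP ?].
split.
  have f0 := ge0_integral0_ae (nnmeas_slice t ndf) Dft.
  apply: (@filterS _ _ (ae_filter_ringOfSetsType mu1) _ _ _ f0) => x /eqP.
  by rewrite /df eqe normr_eq0 subr_eq0 => /eqP.
have g0 := ge0_integral0_ae (nnmeas_slice t ndg) Dgt.
apply: (@filterS _ _ (ae_filter_ringOfSetsType mu2) _ _ _ g0) => z /eqP.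
by rewrite /dg eqe normr_eq0 subr_eq0 => /eqP.
Qed.

End Stability.

(** * Existence *)

Section Iteration.
Context {R : realType}.
Notation R1 := (measurableTypeR R).
Notation R2 := (R1 * R1)%type.
Notation mu1 := (@leb1 R).
Notation mu2 := (@plane_measure R).
Variables (lambda gamma : R) (a : R -> R) (Mf Mg : R -> R).
Hypotheses (lambda_gt0 : 0 < lambda) (gamma_gt0 : 0 < gamma).
Hypotheses (a_gt0 : forall t, 0 < a t) (ma : measurable_fun [set: R1] a).
Hypotheses (mMf : measurable_fun [set: R1] Mf) (mMg : measurable_fun [set: R1] Mg).
Hypotheses (Mf0 : forall t, 0 <= t -> 0 <= Mf t).
Hypotheses (Mg0 : forall t, 0 <= t -> 0 <= Mg t).
Local Open Scope ereal_scope.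
Variables (y : R1 -> \bar R) (w : R2 -> \bar R).
Hypotheses (ny : nnmeas y) (nw : nnmeas w).
Hypothesis Mf_mild : forall t : R, (0 <= t)%R ->
  (Mf t)%:E = (a t)%:E * (\int[mu1]_x y x +
   \int[mu1]_(s in `[0%R, t]) ((a s)^-1 * (2 * gamma * Mg s))%:E).
Hypothesis Mg_mild : forall t : R, (0 <= t)%R ->
  (Mg t)%:E = (expR (- gamma * t))%:E * (\int[mu2]_z w z +
   \int[mu1]_(s in `[0%R, t]) (expR (gamma * s) * (lambda * Mf s ^+ 2))%:E).

Let fstep := f_step gamma a_gt0 ma.
Let gstep := g_step lambda gamma.

Fixpoint picard (n : nat) : (R1 * R1 -> \bar R) * (R2 * R1 -> \bar R) :=
  if n is n'.+1 then
    (fstep y (picard n').2, gstep w (picard n').1 (picard n').1)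
  else (cst 0, cst 0).

Lemma nnmeas_picard n : nnmeas (picard n).1 /\ nnmeas (picard n).2.
Proof.
elim: n => [|n [IH1 IH2]]; first by split; exact: nnmeas0.
by split; [exact: nnmeas_f_step|exact: nnmeas_g_step].
Qed.

Lemma le_merging (F F' : R1 * R1 -> \bar R) : nnmeas F -> nnmeas F' ->
  (forall p, F p <= F' p) ->
  forall p, merging lambda F F p <= merging lambda F' F' p.
Proof.
move=> [_ F0] [_ F0'] FF p; apply: lee_wpmul2l; first by rewrite lee_fin ltW.
exact: lee_pmul.
Qed.

Lemma picard_nondecreasing p p' :
  {homo (fun n => (picard n).1 p) : n m / (n <= m)%N >-> n <= m} /\
  {homo (fun n => (picard n).2 p') : n m / (n <= m)%N >-> n <= m}.
Proof.
have step n : (forall p, (picard n).1 p <= (picard n.+1).1 p) /\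
    (forall p, (picard n).2 p <= (picard n.+1).2 p).
  elim: n => [|n [IH1 IH2]].
    have [[_ h1] [_ h2]] := nnmeas_picard 1.
    by split => q; [exact: h1|exact: h2].
  have [n1 n2] := nnmeas_picard n; have [n1' n2'] := nnmeas_picard n.+1.
  split => -[x t]; apply: le_duhamel => //.
  - exact: nnmeas_splitting.
  - exact: nnmeas_splitting.
  - by move=> {}x s _; apply: le_splitting.
  - exact: nnmeas_merging.
  - exact: nnmeas_merging.
  - by move=> {}x s _; apply: le_merging.
by split; apply: homo_leq => // [? ? ?|n]; [exact: le_trans|case: (step n)|
  exact: le_trans|case: (step n)].
Qed.

(** The mass system is the integrated form of the two equations with equality,
    and their right-hand sides are monotone in the masses: the bound is
    inherited from one iterate to the next. *)
Lemma picard_mass n (t : R) : (0 <= t)%R ->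
  \int[mu1]_x (picard n).1 (x, t) <= (Mf t)%:E /\
  \int[mu2]_z (picard n).2 (z, t) <= (Mg t)%:E.
Proof.
elim: n t => [|n IH] t t0 /=.
  by rewrite !integral0 !lee_fin Mf0// Mg0.
have [nF nG] := nnmeas_picard n.
have [mF F0] := nF; have [mG G0] := nG.
have IF s : 0 <= \int[mu1]_x (picard n).1 (x, s) by exact: integral_ge0.
have IG s : 0 <= \int[mu2]_z (picard n).2 (z, s) by exact: integral_ge0.
have mIF := measurable_mass mu1 mF F0; have mIG := measurable_mass mu2 mG G0.
have ainv := measurable_inv a_gt0 ma.
split.
  rewrite integral_f_step// Mf_mild//; apply: lee_wpmul2l.
    by rewrite lee_fin ltW.
  apply: leeD => //; apply: ge0_le_integral => //.
  - by move=> s _; rewrite !mule_ge0 ?lee_fin ?invr_ge0 ?mulr_ge0 ?(ltW (a_gt0 _)) ?(ltW gamma_gt0).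
  - apply: measurable_funTS; apply: emeasurable_funM; first exact/measurable_EFinP.
    exact: measurable_funeM.
  - apply: measurable_funTS; apply/measurable_EFinP; apply: measurable_funM => //.
    exact: measurable_funM.
  - move=> s; rewrite /= in_itv/= => /andP[s0 _]; rewrite !EFinM.
    apply: lee_wpmul2l; first by rewrite lee_fin invr_ge0 ltW.
    rewrite -EFinM; apply: lee_wpmul2l; last by case: (IH s s0).
    by rewrite lee_fin mulr_ge0// ltW.
rewrite integral_g_step// Mg_mild//; apply: lee_wpmul2l.
  by rewrite lee_fin expR_ge0.
have me : measurable_fun [set: R1] (fun s : R1 => expR (gamma * s)%R).
  by apply: measurableT_comp => //; exact: measurable_funM.
apply: leeD => //; apply: ge0_le_integral => //.
- by move=> s _; rewrite !mule_ge0 ?lee_fin ?expR_ge0 ?(ltW lambda_gt0).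
- apply: measurable_funTS; apply: emeasurable_funM; first exact/measurable_EFinP.
  by apply: measurable_funeM; exact: emeasurable_funM.
- apply: measurable_funTS; apply/measurable_EFinP; apply: measurable_funM => //.
  by apply: measurable_funM => //; exact: measurable_funX.
- move=> s; rewrite /= in_itv/= => /andP[s0 _]; rewrite !EFinM.
  apply: lee_wpmul2l; first by rewrite lee_fin expR_ge0.
  apply: lee_wpmul2l; first by rewrite lee_fin ltW.
  by have [h _] := IH s s0; exact: lee_pmul.
Qed.

Lemma cvg_mass {d} {T : measurableType d} (mu : {sigma_finite_measure set T -> \bar R})
    (h_ : nat -> T -> \bar R) (h : T -> \bar R) :
  (forall n, nnmeas (h_ n)) ->
  (forall x, {homo (h_^~ x) : n m / (n <= m)%N >-> n <= m}) ->
  (forall x, h_ n x @[n --> \oo] --> h x) ->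
  \int[mu]_x h_ n x @[n --> \oo] --> \int[mu]_x h x.
Proof.
move=> nh nd cv; rewrite [X in _ --> X](_ : _ = \int[mu]_x limn (h_^~ x)).
  apply: cvg_monotone_convergence => //.
  - by move=> n; case: (nh n).
  - by move=> n x _; case: (nh n).
by apply: eq_integral => x _; apply/esym/cvg_lim => //; exact: cv.
Qed.

(** The iterates increase, so that their limit solves the equations at every
    point by monotone convergence, possibly with infinite values; the bound on
    the masses shows that these occur only on null sets. *)
Lemma step_existence : exists (F : R1 * R1 -> \bar R) (G : R2 * R1 -> \bar R),
  [/\ nnmeas F, nnmeas G,
      (forall p, F p = fstep y G p), (forall p, G p = gstep w F F p) &
      forall t : R, (0 <= t)%R ->
        \int[mu1]_x F (x, t) <= (Mf t)%:E /\ \int[mu2]_z G (z, t) <= (Mg t)%:E].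
Proof.
pose F p := limn (fun n => (picard n).1 p).
pose G p := limn (fun n => (picard n).2 p).
have ndF p := (picard_nondecreasing p (point, point, point)).1.
have ndG p := (picard_nondecreasing (point, point) p).2.
have FF p : (picard n).1 p @[n --> \oo] --> F p.
  exact: ereal_nondecreasing_is_cvgn.
have GG p : (picard n).2 p @[n --> \oo] --> G p.
  exact: ereal_nondecreasing_is_cvgn.
have nF n := (nnmeas_picard n).1; have nG n := (nnmeas_picard n).2.
have nF' : nnmeas F.
  split => [|p]; last by apply: cvge_to_ge (FF p) _; apply: nearW => n; case: (nF n).
  by apply: (emeasurable_fun_cvg (fun n => (picard n).1)) => [n|p _]; [case: (nF n)|].
have nG' : nnmeas G.
  split => [|p]; last by apply: cvge_to_ge (GG p) _; apply: nearW => n; case: (nG n).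
  by apply: (emeasurable_fun_cvg (fun n => (picard n).2)) => [n|p _]; [case: (nG n)|].
exists F, G; split => //.
- move=> p; have S : (picard n.+1).1 p @[n --> \oo] --> F p.
    by have := FF p; rewrite -(cvg_shiftS (fun n => (picard n).1 p)).
  apply: (cvg_unique _ S) => //; apply: cvg_duhamel => //.
  + by move=> n; exact: nnmeas_splitting.
  + by move=> q n m nm; apply: le_splitting => // r; exact: ndG.
  + move=> q; apply: cvgeZl => //; apply: cvg_mass.
    * move=> n; apply: (nnmeas_comp (nG n)); exact: measurable_fun_pair.
    * by move=> z; exact: ndG.
    * by move=> z; exact: GG.
- move=> p; have S : (picard n.+1).2 p @[n --> \oo] --> G p.
    by have := GG p; rewrite -(cvg_shiftS (fun n => (picard n).2 p)).
  apply: (cvg_unique _ S) => //; apply: cvg_duhamel => //.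
  + by move=> n; exact: nnmeas_merging.
  + by move=> q n m nm; apply: le_merging => // r; exact: ndF.
  + move=> q; apply: cvgeZl => //; apply: nondecreasing_cvgM => //.
    * by move=> n; case: (nF n).
    * by move=> n; case: (nF n).
- move=> t t0; split.
    have cF := cvg_mass (mu := mu1) (h := fun x => F (x, t))
      (fun n => nnmeas_slice t (nF n)) (fun x => ndF (x, t)) (fun x => FF (x, t)).
    by apply: (cvge_to_le cF); apply: nearW => n; case: (picard_mass n t0).
  have cG := cvg_mass (mu := mu2) (h := fun z => G (z, t))
    (fun n => nnmeas_slice t (nG n)) (fun z => ndG (z, t)) (fun z => GG (z, t)).
  by apply: (cvge_to_le cG); apply: nearW => n; case: (picard_mass n t0).
Qed.

End Iteration.

Section Representatives.
Context {d : measure_display} {T : measurableType d} {R : realType}.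
Variable mu : {sigma_finite_measure set T -> \bar R}.
Notation R1 := (measurableTypeR R).
Local Open Scope ereal_scope.

(** A representative of a curve of nonnegative classes is nonnegative only up to
    null sets, and unconstrained at negative times; this one is nonnegative and
    jointly measurable everywhere. *)
Definition future_part (f : T * R1 -> R) : T * R1 -> R :=
  (fun p => Num.max (f p) 0%R) \_ future.

Lemma future_partE f x (t : R) : (0 <= t)%R -> (0 <= f (x, t))%R ->
  future_part f (x, t) = f (x, t).
Proof. by move=> t0 f0; rewrite /future_part patchE mem_set//= max_l. Qed.

Lemma nnmeas_future_part f : measurable_fun future f ->
  nnmeas (EFin \o future_part f).
Proof.
move=> mf; split => [|p].
  apply/measurable_EFinP; apply: measurable_future_extend.
  by apply: measurable_maxr => //.
rewrite /= lee_fin /future_part patchE; case: ifPn => _ //.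
by rewrite le_max lexx orbT.
Qed.

Lemma represents_future_part f (u : R -> LspaceType1 mu) :
  represents f u -> C_L1_nneg u -> forall t : R, (0 <= t)%R ->
  {ae mu, forall x, f (x, t) = (u t : T -> R) x /\
     future_part f (x, t) = (u t : T -> R) x}.
Proof.
move=> [mf fu] Cu t t0; have [ut _] := Cu t t0.
apply: filterS2 (fu t t0) ut => x fx ux; split => //.
by rewrite future_partE// fx.
Qed.

Lemma version_future_part f (u : R -> LspaceType1 mu) :
  represents f u -> C_L1_nneg u -> version mu f (EFin \o future_part f).
Proof.
move=> fu Cu; split => [|t t0]; first by case: fu.
by apply: filterS (represents_future_part fu Cu t0) => x [-> /= ->].
Qed.

Lemma mass_future_part f (u : R -> LspaceType1 mu) (b : R) :
  represents f u -> C_L1_nneg u -> (0 <= b)%R ->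
  exists K : R, (0 <= K)%R /\ forall t, (0 <= t <= b)%R ->
    \int[mu]_x (future_part f (x, t))%:E <= K%:E.
Proof.
move=> fu Cu b0; have [K [K0 uK]] := C_L1_bounded Cu b0.
exists K; split => // t tb; have /andP[t0 _] := tb.
apply: le_trans (uK t tb).
have [mf f0] := nnmeas_slice t (nnmeas_future_part fu.1).
have mu' : measurable_fun setT (fun x => `|(u t : T -> R) x|%:E).
  by apply/measurable_EFinP; apply: measurableT_comp => //; exact: L1_measurable.
apply: ae_ge0_le_integral => //; first by move=> x _; exact: f0.
apply: filterS (represents_future_part fu Cu t0) => x [_ ->] _.
by rewrite lee_fin ler_norm.
Qed.

Lemma finite_version (F : T * R1 -> \bar R) : nnmeas F ->
  (forall t : R, (0 <= t)%R -> \int[mu]_x F (x, t) < +oo) ->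
  version mu (fine \o F) F.
Proof.
move=> nF iF; split => [|t t0].
  apply: measurable_funTS; apply: (measurableT_comp (fine_measurable measurableT)).
  by case: nF.
have [mf f0] := nnmeas_slice t nF.
have iFt : mu.-integrable setT (fun x => F (x, t)).
  apply/integrableP; split => //.
  by under eq_integral do rewrite gee0_abs//; exact: iF.
apply: filterS (integrable_ae measurableT iFt) => x /(_ I) Fx.
by rewrite /= fineK.
Qed.

(** The class of each slice is chosen separately; continuity for the pointwise
    values passes to the classes because the distance ignores null sets. *)
Lemma L1_curve (F : T * R1 -> \bar R) : nnmeas F ->
  (forall t : R, (0 <= t)%R -> \int[mu]_x F (x, t) < +oo) ->
  (forall t : R, (0 <= t)%R ->
    \int[mu]_x `|fine (F (x, s)) - fine (F (x, t))|%:E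
      @[s --> within `[0%R, +oo[ (nbhs t)] --> 0) ->
  exists u : R -> LspaceType1 mu, C_L1_nneg u /\ represents (fine \o F) u.
Proof.
move=> nF iF cF.
have mfine (t : R) : measurable_fun setT (fun x => fine (F (x, t))).
  apply: (measurableT_comp (fine_measurable measurableT)).
  by case: (nnmeas_slice t nF).
have fine0 p : (0 <= fine (F p))%R by rewrite fine_ge0//; case: nF.
have sliceP (t : R) : exists u : LspaceType1 mu, (0 <= t)%R ->
    {ae mu, forall x, (u : T -> R) x = fine (F (x, t))}.
  have [t0|tN] := leP 0%R t.
    have [|u ut] := @L1_exists _ _ _ mu _ (mfine t).
      apply: le_lt_trans (iF t t0); have [mF F0] := nnmeas_slice t nF.
      apply: ge0_le_integral => //.
      - by apply/measurable_EFinP; apply: measurableT_comp.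
      - move=> x _; rewrite ger0_norm//; move: (F0 x).
        by case: (F (x, t)) => //= *; rewrite leey.
    by exists u.
  have [|u _] := @L1_exists _ _ _ mu (cst 0%R) (measurable_cst _).
    by rewrite integral0_eq// => x _; rewrite normr0.
  by exists u.
have [u uE] := choice sliceP.
exists u; split; last first.
  split => [|t t0]; first by case: (finite_version nF iF).
  by apply: filterS (uE t t0) => x ->.
move=> t t0; split.
  by apply: filterS (uE t t0) => x ->; exact: fine0.
apply: cvg_trans (cF t t0); apply: near_eq_cvg.
apply: (filterS _ (@withinT _ (nbhs t) [set` `[0%R, +oo[] _)) => s /=.
rewrite in_itv/= andbT => s0; rewrite L1_distE.
have md : measurable_fun setT (fun x => `|fine (F (x, s)) - fine (F (x, t))|%:E).
  by apply/measurable_EFinP; apply: measurableT_comp => //; exact: measurable_funB.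
apply: ge0_ae_eq_integral => //.
- apply/measurable_EFinP; apply: measurableT_comp => //.
  by apply: measurable_funB; exact: L1_measurable.
- by apply: filterS2 (uE s s0) (uE t t0) => x -> ->.
Qed.

End Representatives.

Section ScalarContinuity.
Context {d : measure_display} {T : measurableType d} {R : realType}.
Variable mu : {sigma_finite_measure set T -> \bar R}.
Notation R1 := (measurableTypeR R).
Local Open Scope ereal_scope.

(** The distance of the images of k is |a s - a t| times the norm of k. *)
Lemma scalar_flow_continuous (a : R -> R) (a_gt0 : forall t, (0 < a t)%R)
    (ma : measurable_fun [set: R1] a) (t : R) : continuous a ->
  L1_strongly_continuous (scalar_flow mu a_gt0 ma) t.
Proof.
move=> ca k mk k0 ik.
pose m := fine (\int[mu]_x (k x)%:E).
have k_int : 0 <= \int[mu]_x (k x)%:E.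
  by apply: integral_ge0 => x _; rewrite lee_fin.
have mE : m%:E = \int[mu]_x (k x)%:E by rewrite fineK// ge0_fin_numE.
suff c : (`|a s - a t| * m)%:E @[s --> t] --> 0.
  apply: cvg_within_filter; rewrite [X in X @ _ --> _](_ : _ =
      fun s => (`|a s - a t| * m)%:E)//.
  apply/funext => s /=; rewrite EFinM mE -ge0_integralZl//.
  - by apply: eq_integral => x _; rewrite -mulrBl normrM (ger0_norm (k0 x)) EFinM.
  - exact/measurable_EFinP.
  - by move=> x _; rewrite lee_fin.
have c1 : (`|a s - a t| * m)%R @[s --> t] --> (`|a t - a t| * m)%R.
  apply: cvgM; last exact: cvg_cst.
  by apply: cvg_norm; apply: cvgB; [exact: ca|exact: cvg_cst].
rewrite subrr normr0 mul0r in c1.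
have c2 : (`|a s - a t| * m)%:E @[s --> t] --> 0%:E.
  by apply: cvg_EFin; [exact: nearW|exact: c1].
exact: c2.
Qed.

End ScalarContinuity.

(** * Well-posedness *)

Section Main.
Context {R : realType}.
Notation R1 := (measurableTypeR R).
Notation R2 := (R1 * R1)%type.
Notation mu1 := (@leb1 R).
Notation mu2 := (@plane_measure R).
Variables (lambda gamma : R).
Hypotheses (hlambda : 0 < lambda) (hgamma : 0 < gamma).
Variables (f0 : LspaceType1 (@leb1 R)) (g0 : LspaceType1 (@leb2 R)).
Hypotheses (hf0 : L1_nneg f0) (hg0 : L1_nneg g0).
Variables (Mf Mg : R -> R).
Hypothesis hM : mass_system lambda gamma Mf Mg.
Hypotheses (hMf0 : Mf 0 = \int[@leb1 R]_x f0 x)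
  (hMg0 : Mg 0 = \int[@leb2 R]_z g0 z).

Lemma integral_pospart {d} {X : measurableType d}
    (mu : {measure set X -> \bar R}) (h : LspaceType1 mu) : L1_nneg h ->
  (\int[mu]_x pospart (h : X -> R) x = (\int[mu]_x h x)%:E)%E.
Proof.
move=> h0; have mh := L1_measurable h; have [mp p0] := nnmeas_pospart mh.
have E : (\int[mu]_x pospart (h : X -> R) x = \int[mu]_x (h x)%:E)%E.
  apply: ae_eq_integral => //; first exact/measurable_EFinP.
  by apply: filterS h0 => x hx _; rewrite pospartE.
rewrite E fineK// ge0_fin_numE -E; last exact: integral_ge0.
apply: le_lt_trans (L1_finite h); apply: ge0_le_integral => //.
  by apply/measurable_EFinP; apply: measurableT_comp.
by move=> x _; rewrite lee_fin ge_max normr_ge0 ler_norm.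
Qed.

Let y := pospart (f0 : R1 -> R).
Let w := pospart (g0 : R2 -> R).

Let ny : nnmeas y. Proof. by apply: nnmeas_pospart; exact: L1_measurable. Qed.
Let nw : nnmeas w. Proof. by apply: nnmeas_pospart; exact: L1_measurable. Qed.

Let y_mass : (\int[mu1]_x y x = (Mf 0)%:E)%E.
Proof. by rewrite hMf0 -integral_pospart. Qed.

Let w_mass : (\int[mu2]_z w z = (Mg 0)%:E)%E.
Proof. by rewrite hMg0 -integral_pospart. Qed.

Let Mf0_ge0 : 0 <= Mf 0.
Proof. by rewrite -lee_fin -y_mass; apply: integral_ge0 => x _; case: ny. Qed.

Let Mg0_ge0 : 0 <= Mg 0.
Proof. by rewrite -lee_fin -w_mass; apply: integral_ge0 => x _; case: nw. Qed.

Let a := decay lambda Mf.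
Let a_gt0 : forall t, 0 < a t := decay_gt0 lambda Mf.
Let ca : continuous a := continuous_decay hM.
Let ma : measurable_fun [set: R1] a := continuous_measurable_fun ca.
Let a_noninc s t : 0 <= s <= t -> a t <= a s.
Proof. exact: decay_nonincreasing hlambda hgamma hM _ _ Mf0_ge0 Mg0_ge0. Qed.
Let dampingE s t : 0 <= s <= t -> damping lambda Mf s t = a t / a s.
Proof. exact: damping_decay hM s t. Qed.

Let fstep := f_step gamma a_gt0 ma.
Let gstep := g_step lambda gamma.

Let equationsP f F g G : nnmeas F -> version mu1 f F ->
  nnmeas G -> version mu2 g G ->
  mild_equations lambda gamma Mf f0 g0 f g <->
  forall t : R, 0 <= t ->
    {ae mu1, forall x, F (x, t) = fstep y G (x, t)} /\
    {ae mu2, forall z, G (z, t) = gstep w F F (z, t)}.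
Proof.
by apply: mild_equationsP => //; [exact: decay0|exact: L1_measurable|
  exact: L1_measurable].
Qed.

(** Any solution has bounded masses on [0, t], by continuity, and solves the
    Duhamel formulas after passing to nonnegative representatives. *)
Lemma mild_solution_unique u1 u2 v1 v2 :
  mild_solution lambda gamma Mf f0 g0 u1 v1 ->
  mild_solution lambda gamma Mf f0 g0 u2 v2 ->
  forall t : R, 0 <= t -> u1 t = u2 t /\ v1 t = v2 t.
Proof.
move=> [Cu1 Cv1 [f1 [g1 [fu1 gv1 eqs1]]]] [Cu2 Cv2 [f2 [g2 [fu2 gv2 eqs2]]]] t t0.
have nf1 := nnmeas_future_part fu1.1; have nf2 := nnmeas_future_part fu2.1.
have ng1 := nnmeas_future_part gv1.1; have ng2 := nnmeas_future_part gv2.1.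
have E1 := (equationsP nf1 (version_future_part fu1 Cu1) ng1
  (version_future_part (mu := mu2) gv1 Cv1)).1 eqs1.
have E2 := (equationsP nf2 (version_future_part fu2 Cu2) ng2
  (version_future_part (mu := mu2) gv2 Cv2)).1 eqs2.
have [K1 [K10 mK1]] := mass_future_part fu1 Cu1 t0.
have [K2 [K20 mK2]] := mass_future_part fu2 Cu2 t0.
have [K3 [K30 mK3]] := mass_future_part (mu := mu2) gv1 Cv1 t0.
have [K4 [K40 mK4]] := mass_future_part (mu := mu2) gv2 Cv2 t0.
pose K := K1 + K2 + K3 + K4.
have K0 : 0 <= K by rewrite !addr_ge0.
have [|s st||Ef Eg] := @step_uniqueness _ lambda gamma a hlambda hgamma a_gt0
  ma a_noninc y w _ _ _ _ t K ny nw nf1 nf2 ng1 ng2 K0 _ _ t.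
- move=> s st; split.
  + by apply: le_trans (mK1 s st) _; rewrite lee_fin /K; lra.
  + by apply: le_trans (mK2 s st) _; rewrite lee_fin /K; lra.
  + by apply: le_trans (mK3 s st) _; rewrite lee_fin /K; lra.
  + by apply: le_trans (mK4 s st) _; rewrite lee_fin /K; lra.
- have /andP[s0 _] := st; have [e1 e2] := E1 s s0; have [e3 e4] := E2 s s0.
  by split; [exact: e1|exact: e3|exact: e2|exact: e4].
- by rewrite t0 lexx.
split; apply: L1_eq.
  apply: filterS3 Ef (represents_future_part fu1 Cu1 t0)
    (represents_future_part fu2 Cu2 t0) => x e [_ <-] [_ <-]; exact: e.
have r1 := represents_future_part (mu := mu2) gv1 Cv1 t0.
have r2 := represents_future_part (mu := mu2) gv2 Cv2 t0.
apply: (@filterS3 _ _ (ae_filter_ringOfSetsType mu2) _ _ _ _ _ Eg r1 r2).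
by move=> z e [_ <-] [_ <-].
Qed.

Let bounded_on (M : R -> R) (b : R) : continuous M -> 0 <= b ->
  exists K, forall t, 0 <= t <= b -> M t <= K.
Proof.
move=> cM b0; have [c _ Mc] := @EVT_max _ _ 0 b b0 (continuous_subspaceT cM).
by exists (M c) => t tb; apply: Mc; rewrite in_itv/=.
Qed.

(** The limit of the Picard iterates, made finite; its continuity in time
    follows from the bounds of the sources by (M_f, M_g). *)
Lemma mild_solution_exists : exists (u : R -> LspaceType1 (@leb1 R))
  (v : R -> LspaceType1 (@leb2 R)), mild_solution lambda gamma Mf f0 g0 u v.
Proof.
pose mf := clamp Mf; pose mg := clamp Mg.
have cmf : continuous mf := continuous_clamp_Mf hM.
have cmg : continuous mg := continuous_clamp_Mg hM.
have mmf : measurable_fun [set: R1] mf := continuous_measurable_fun cmf.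
have mmg : measurable_fun [set: R1] mg := continuous_measurable_fun cmg.
have mf0 t : 0 <= t -> 0 <= mf t.
  by move=> t0; rewrite /mf clampE//; exact: (Mf_ge0 hlambda hgamma hM).
have mg0 t : 0 <= t -> 0 <= mg t.
  by move=> t0; rewrite /mg clampE//; exact: (Mg_ge0 hlambda hM).
have [||F [G [nF nG FE GE mass]]] := @step_existence _ lambda gamma a mf mg
  hlambda hgamma a_gt0 ma mmf mmg mf0 mg0 y w ny nw _ _.
- move=> t t0; rewrite /mf clampE// (mass_f_mild hM t0) y_mass.
  congr (_ * (_ + _))%E; apply: eq_integral => s.
  by rewrite inE/= in_itv/= => /andP[s0 _]; rewrite /mg clampE.
- move=> t t0; rewrite /mg clampE// (mass_g_mild hM t0) w_mass.
  congr (_ * (_ + _))%E; apply: eq_integral => s.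
  by rewrite inE/= in_itv/= => /andP[s0 _]; rewrite /mf clampE.
have iF t : 0 <= t -> (\int[mu1]_x F (x, t) < +oo)%E.
  by move=> t0; apply: le_lt_trans (mass t t0).1 _; rewrite ltry.
have iG t : 0 <= t -> (\int[mu2]_z G (z, t) < +oo)%E.
  by move=> t0; apply: le_lt_trans (mass t t0).2 _; rewrite ltry.
have a0 : a 0 = 1 := decay0 lambda Mf.
have [u [Cu uF]] : exists u : R -> LspaceType1 (@leb1 R),
    C_L1_nneg u /\ represents (fine \o F) u.
  apply: (L1_curve nF iF) => t t0.
  have b0 : 0 <= t + 1 by rewrite addr_ge0.
  have [K mgK] := bounded_on cmg b0.
  have -> : F = fstep y G by apply/funext.
  apply: (@cvg_duhamel_L1 _ _ _ _ _ _ _ _ t (t + 1) (a (t + 1))^-1 (2 * gamma * K)).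
  - exact: ny.
  - exact: nnmeas_splitting.
  - by rewrite y_mass ltry.
  - by rewrite t0 ltrDl ltr01.
  - move=> s sb; have /andP[s0 sb'] := sb; split => /=.
    + apply: (@le_trans _ _ 1).
        by rewrite -[leRHS]a0; apply: a_noninc; rewrite lexx.
      by rewrite invf_ge1// -[leRHS]a0; apply: a_noninc; rewrite lexx.
    + rewrite lef_pV2 ?posrE; [exact: a_noninc|exact: a_gt0|exact: a_gt0].
    + rewrite integral_splitting// (_ : (2 * gamma * K)%:E =
        ((2 * gamma)%:E * K%:E)%E)//.
      apply: lee_wpmul2l; first by rewrite lee_fin mulr_ge0// ltW.
      by apply: le_trans (mass s s0).2 _; rewrite lee_fin; exact: mgK.
  - exact: scalar_flow_continuous.
have [v [Cv vG]] : exists v : R -> LspaceType1 (@leb2 R),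
    C_L1_nneg v /\ represents (fine \o G) v.
  apply: (L1_curve (mu := mu2) nG iG) => t t0.
  have b0 : 0 <= t + 1 by rewrite addr_ge0.
  have [K mfK] := bounded_on cmf b0.
  have -> : G = gstep w F F by apply/funext.
  apply: (@cvg_duhamel_L1 _ _ _ _ _ _ _ _ t (t + 1) (expR (gamma * (t + 1)))
    (lambda * (K * K))).
  - exact: nw.
  - exact: nnmeas_merging.
  - by rewrite w_mass ltry.
  - by rewrite t0 ltrDl ltr01.
  - move=> s sb; have /andP[s0 sb'] := sb; split => /=.
    + rewrite ler_expR; apply: (@le_trans _ _ 0).
        by rewrite mul1r mulNr oppr_le0 mulr_ge0// ltW.
      by rewrite mulr_ge0// ltW.
    + by rewrite ler_expR mulN1r mulrNN ler_wpM2l// ltW.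
    + rewrite integral_merging// EFinM EFinM.
      apply: lee_wpmul2l; first by rewrite lee_fin ltW.
      have FK : (\int[mu1]_x F (x, s) <= K%:E)%E.
        by apply: le_trans (mass s s0).1 _; rewrite lee_fin; exact: mfK.
      have F0 : (0 <= \int[mu1]_x F (x, s))%E.
        by apply: integral_ge0 => x _; case: nF.
      exact: lee_pmul.
  - exact: collision_flow_continuous.
exists u, v; split => //; exists (fine \o F), (fine \o G); split => //.
apply/(equationsP nF (finite_version nF iF) nG (finite_version nG iG)) => t t0.
by split; apply: aeW => p; rewrite -?FE -?GE.
Qed.

End Main.

Theorem theorem2 (R : realType) (lambda gamma : R)
    (hlambda : 0 < lambda) (hgamma : 0 < gamma)
    (f0 : LspaceType1 (@leb1 R)) (g0 : LspaceType1 (@leb2 R))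
    (hf0 : L1_nneg f0) (hg0 : L1_nneg g0)
    (Mf Mg : R -> R)
    (hM : mass_system lambda gamma Mf Mg)
    (hMf0 : Mf 0 = \int[@leb1 R]_x f0 x)
    (hMg0 : Mg 0 = \int[@leb2 R]_z g0 z) :
  (exists (u : R -> LspaceType1 (@leb1 R)) (v : R -> LspaceType1 (@leb2 R)),
     mild_solution lambda gamma Mf f0 g0 u v) /\
  (forall (u1 u2 : R -> LspaceType1 (@leb1 R))
          (v1 v2 : R -> LspaceType1 (@leb2 R)),
     mild_solution lambda gamma Mf f0 g0 u1 v1 ->
     mild_solution lambda gamma Mf f0 g0 u2 v2 ->
     forall t : R, 0 <= t -> u1 t = u2 t /\ v1 t = v2 t).
Proof.
split; first exact: (mild_solution_exists hlambda hgamma hf0 hg0 hM hMf0 hMg0).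
move=> u1 u2 v1 v2.
exact: (mild_solution_unique hlambda hgamma hf0 hg0 hM hMf0 hMg0).
Qed.
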